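(* Let $C\subset\mathbb{R}^3$ be a convex compact body, $O\notin C$ a point, and $l$ a line through $O$ intersecting the interior of $C$. Let $B,B'$ be the points of intersection of $l$ with $\partial C$, where $[O,B)$ lies outside $C$ and $[B,B']\subset C$. For each half-plane $\Pi$ bounded by $l$, consider the planar convex curve $\partial C\cap\Pi$ with endpoints $B$ and $B'$, and the ray of support from $O$ to this curve in $\Pi$. Assume that (i) in each half-plane $\Pi$ bounded by $l$, the corresponding ray of support touches (is tangent to) the curve; (ii) there exists $k>0$ such that in any half-plane $\Pi$ bounded by $l$, the part of the curve between $B$ and the point of tangency is of class $C^1$ with curvature $\le k$. Then there exists a family of convex bodies $C(s)$, $s\in[-1,1]$, such that (a) $C(0)=C$; (b) $\partial_+C\subset\partial C(s)$ for all $s\in[-1,1]$; (c) the corresponding family of surface measures is a line segment with midpoint $\nu_C$, that is, for all $s\in[-1,1]$ $$\nu_{C(s)}=\nu_C+s\,(\nu_{C(1)}-\nu_C).$$ (d) Moreover, this family is not unique: there exist a set $\Theta$ and families of convex bodies $C^{(\theta)}(s)$, $s\in[-1,1]$, indexed by $\theta\in\Theta$, each satisfying (a), (b), (c), such that the union of the 1-dimensional subspaces spanned by the director vectors, $$\bigcup_{\theta\in\Theta}\{\lambda(\nu_{C^{(\theta)}(1)}-\nu_C):\lambda\in\mathbb{R}\},$$ is an infinite-dimensional subspace of the space of signed measures on $S^2$.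
   Context: A convex compact body is a compact convex set with nonempty interior. $\mathcal H^2$ is 2-dimensional Hausdorff measure. The surface measure $\nu_C$ of a convex compact body $C\subset\mathbb{R}^3$ is the Borel measure on $S^2$ that is the pushforward of $\mathcal H^2$ on $\partial C$ under the map $\xi\mapsto n_\xi$ (outer unit normal), defined at the (full-measure set of) regular points $\xi$ of $\partial C$. For $O\notin C$: $\partial_-C=\partial C\cap\operatorname{int}(\operatorname{Conv}(C\cup\{O\}))$ and $\partial_+C=\partial C\setminus\partial_-C$. The ray of support from $O$ in a half-plane $\Pi$ bounded by $l$ is the ray $\Pi\cap\partial K$, where $K$ is the union of all rays with origin $O$ meeting $C$. It meets the curve $\partial C\cap\Pi$ in a point or a segment; the point of tangency is the point $M$ of this intersection closest to $O$. The ray touches (is tangent to) the curve if its line is the unique line of support at $M$ to the planar convex body $C\cap\Pi$ in the plane containing $\Pi$. A $C^1$ curve has curvature $\le k$ if, for a natural (arc length) parametrization $\gamma$, the angle between any two unit vectors $\gamma'(\varsigma_1)$ and $\gamma'(\varsigma_2)$ does not exceed $k|\varsigma_2-\varsigma_1|$. *)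

(* Defs.v *)
From HB Require Import structures.
From mathcomp Require Import all_boot all_order all_algebra.
From mathcomp Require Import all_classical all_reals all_analysis.

Set Implicit Arguments.
Unset Strict Implicit.
Unset Printing Implicit Defensive.

Import Order.TTheory GRing.Theory Num.Theory.
Import numFieldNormedType.Exports.

Local Open Scope classical_set_scope.
Local Open Scope ring_scope.

(* R^3 is ['rV[R]_3].  The library norm of ['rV[R]_3] is the max norm: it is
   used only through the topology it induces.  All metric notions below refer
   to the Euclidean norm [enorm]. *)

Definition dot (R : realType) (u v : 'rV[R]_3) : R := (u *m v^T) 0 0.

Definition enorm (R : realType) (u : 'rV[R]_3) : R := Num.sqrt (dot u u).

Definition angle (R : realType) (u v : 'rV[R]_3) : R :=
  acos (dot u v / (enorm u * enorm v)).

Definition boundary (T : topologicalType) (A : set T) : set T :=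
  closure A `\` interior A.

Definition convex_body (R : realType) (C : set 'rV[R]_3) : Prop :=
  [/\ convex_set C, compact C & interior C !=set0].

Definition convex_hull (R : realType) (A : set 'rV[R]_3) : set 'rV[R]_3 :=
  smallest (@convex_set R 'rV[R]_3) A.

Definition boundary_minus (R : realType) (C : set 'rV[R]_3) (O : 'rV[R]_3) :=
  boundary C `&` interior (convex_hull (C `|` [set O])).

Definition boundary_plus (R : realType) (C : set 'rV[R]_3) (O : 'rV[R]_3) :=
  boundary C `\` boundary_minus C O.

Section segments_rays_lines_planes.
Context {R : realType}.
Implicit Types (p q u v w x : 'rV[R]_3) (l L P Pi : set 'rV[R]_3).

Definition segment p q : set 'rV[R]_3 :=
  [set p + t *: (q - p) | t in `[0, 1]].

Definition half_open_segment p q : set 'rV[R]_3 :=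
  [set p + t *: (q - p) | t in `[0, 1[].

Definition ray p q : set 'rV[R]_3 :=
  [set p + t *: (q - p) | t in `[0, +oo[].

Definition line p v : set 'rV[R]_3 := [set p + t *: v | t in [set: R]].

Definition is_line l : Prop := exists p v, v != 0 /\ l = line p v.

Definition is_plane P : Prop := exists p v w,
  free [:: v; w] /\ P = [set x | exists t r : R, x = p + t *: v + r *: w].

(* Half-planes are closed: they contain the line bounding them. *)
Definition half_plane_bounded_by l Pi : Prop := exists p v w,
  [/\ free [:: v; w], l = line p v &
      Pi = [set x | exists t r : R, 0 <= r /\ x = p + t *: v + r *: w]].

(* [L] is a line of support at [M] to the planar set [D], in the plane [P]. *)
Definition support_line P (D : set 'rV[R]_3) (M : 'rV[R]_3) L : Prop :=
  [/\ is_line L, L M, D M &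
      exists H, [/\ half_plane_bounded_by L H, H `<=` P & D `<=` H]].

End segments_rays_lines_planes.

Section support_rays.
Context {R : realType}.
Implicit Types (C Pi : set 'rV[R]_3) (O M : 'rV[R]_3).

Definition support_cone C O : set 'rV[R]_3 := \bigcup_(x in C) ray O x.

Definition support_ray C O Pi : set 'rV[R]_3 :=
  Pi `&` boundary (support_cone C O).

Definition tangency_point C O Pi M : Prop :=
  let T := support_ray C O Pi `&` (boundary C `&` Pi) in
  T M /\ forall N, T N -> enorm (M - O) <= enorm (N - O).

(* The line [L] carrying the ray of support is the unique line of support at
   the point of tangency [M] to [C `&` Pi], in the plane [P] containing [Pi]. *)
Definition ray_touches C O Pi M : Prop :=
  forall P, is_plane P -> Pi `<=` P ->
  exists L, [/\ is_line L, support_ray C O Pi `<=` L &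
    forall L', support_line P (C `&` Pi) M L' <-> L' = L].

End support_rays.

(* If [Gamma] is a simple arc, every connected subset of [Gamma] containing
   [p] and [q] contains the part of [Gamma] between [p] and [q], which is
   itself connected: that part is the intersection below. *)
Definition arc_between (T : topologicalType) (Gamma : set T) (p q : T) :=
  \bigcap_(A in [set A | [/\ A `<=` Gamma, connected A, A p & A q]]) A.

(* [gamma], on [[0, L]], is a natural parametrization of the simple arc [S],
   of class C^1 with derivative [tau]; derivatives at [0] and [L] are
   one-sided. *)
Definition natural_C1_parametrization (R : realType) (S : set 'rV[R]_3)
    (L : R) (gamma tau : R -> 'rV[R]_3) : Prop :=
  [/\ set_inj `[0, L] gamma,
      gamma @` `[0, L] = S,
      forall s : R, s \in `[0, L] ->
        (t - s)^-1 *: (gamma t - gamma s) @[t --> within `[0, L] s^'] --> tau s,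
      {within `[0, L], continuous tau} &
      forall s : R, s \in `[0, L] -> enorm (tau s) = 1].

Definition C1_with_curvature_le (R : realType) (S : set 'rV[R]_3) (k : R) :=
  exists (L : R) (gamma tau : R -> 'rV[R]_3),
  [/\ 0 < L, natural_C1_parametrization S L gamma tau &
      forall s1 s2 : R, s1 \in `[0, L] -> s2 \in `[0, L] ->
        angle (tau s1) (tau s2) <= k * `|s2 - s1|].

Section hausdorff2.
Context {R : realType}.
Local Open Scope ereal_scope.

(* Euclidean diameter; the element [0] gives the empty set diameter [0]. *)
Definition ediam (U : set 'rV[R]_3) : \bar R :=
  ereal_sup (0 |` [set (enorm (x.1 - x.2))%:E | x in U `*` U]).

Definition hausdorff2_pre (delta : R) (A : set 'rV[R]_3) : \bar R :=
  ereal_inf [set \sum_(0 <= i <oo) ((pi / 4)%:E * ediam (U i) ^+ 2) |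
             U in [set U : nat -> set 'rV[R]_3 |
                   A `<=` \bigcup_i U i /\ forall i, ediam (U i) <= delta%:E]].

(* The factor [pi / 4] makes [hausdorff2] the area on planes. *)
Definition hausdorff2 (A : set 'rV[R]_3) : \bar R :=
  ereal_sup [set hausdorff2_pre delta A | delta in `]0%R, +oo[].

End hausdorff2.

Definition sphere (R : realType) : set 'rV[R]_3 := [set n | enorm n = 1].
Arguments sphere R : clear implicits.

Lemma sphere_delta (R : realType) : (delta_mx 0 0 : 'rV[R]_3) \in sphere R.
Proof.
rewrite inE /sphere /= /enorm /dot trmx_delta mul_delta_mx.
by rewrite mxE !eqxx sqrtr1.
Qed.

(* The library builds sigma-algebras on pointed types only. *)
HB.instance Definition _ (R : realType) :=
  isPointed.Build (sphere R)
    (exist (fun n => n \in sphere R) (delta_mx 0 0) (sphere_delta R)).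

(* S^2 with the topology induced by R^3 and its Borel sigma-algebra. *)
Definition S2 (R : realType) := g_sigma_algebraType (open : set (set (sphere R))).

Section surface_measure.
Context {R : realType}.
Implicit Types (C : set 'rV[R]_3) (xi : 'rV[R]_3) (n : S2 R).

Definition outer_unit_normal C xi n : Prop :=
  forall y, C y -> dot (set_val n) (y - xi) <= 0.

Definition regular_point C xi : Prop :=
  boundary C xi /\ exists! n, outer_unit_normal C xi n.

(* Pushforward of [hausdorff2] by the normal map, which is only defined at
   regular points. Only its values on measurable sets are meaningful. *)
Definition surface_measure C (A : set (S2 R)) : \bar R :=
  hausdorff2
    [set xi | regular_point C xi /\ exists2 n, outer_unit_normal C xi n & A n].

End surface_measure.

Section families.
Context {R : realType}.
Local Open Scope ereal_scope.

Definition segment_family (C : set 'rV[R]_3) (O : 'rV[R]_3)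
    (F : R -> set 'rV[R]_3) : Prop :=
  [/\ forall s : R, s \in `[-1, 1]%R -> convex_body (F s),
      F 0%R = C,
      forall s : R, s \in `[-1, 1]%R -> boundary_plus C O `<=` boundary (F s) &
      forall s : R, s \in `[-1, 1]%R -> forall A : set (S2 R), measurable A ->
        surface_measure (F s) A = surface_measure C A +
          s%:E * (surface_measure (F 1%R) A - surface_measure C A)].

Definition director_vector (C : set 'rV[R]_3) (F : R -> set 'rV[R]_3)
    (sigma : {charge set (S2 R) -> \bar R}) : Prop :=
  forall A : set (S2 R), measurable A ->
    sigma A = surface_measure (F 1%R) A - surface_measure C A.

End families.

Section spaces_of_signed_measures.
Context d (T : measurableType d) (R : realType).
Local Open Scope ereal_scope.
Local Notation charges := ({charge set T -> \bar R}).
Implicit Types (sigma tau : charges) (V : set charges).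

(* Charges are functions on all sets; as signed measures they are equal when
   they agree on measurable sets. *)
Definition charge_eq sigma tau : Prop :=
  forall A, measurable A -> sigma A = tau A.

(* The set of signed measures [lambda sigma], with [lambda] real. *)
Definition charge_line sigma : set charges :=
  [set tau | exists lambda : R, charge_eq tau (cscale lambda sigma)].

Definition charge_subspace V : Prop :=
  [/\ V czero,
      forall sigma tau, V sigma -> V tau -> V (cadd sigma tau) &
      forall (a : R) sigma, V sigma -> V (cscale a sigma)].

Definition finite_dimensional V : Prop :=
  exists (n : nat) (e : 'I_n -> charges), forall sigma, V sigma ->
    exists c : 'I_n -> R, forall A, measurable A ->
      sigma A = \sum_(i < n) (c i)%:E * e i A.

End spaces_of_signed_measures.

(* Main.v *)
(* Let e = B - O.  A plane of support of C with outer normal n meets l at a point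
   O + x(n) e, and those separating O from C have 0 < x(n) <= 1.  The body C_g is
   bounded by the parallel planes through O + Phi(x(n)) e, where Phi' = g, Phi(x) = x
   for x <= 1/4 and g is constant for x >= 3/4.  Assumptions (i) and (ii) yield a gap
   inequality: if the plane of support at X with normal n passes through O + t e with
   t in [1/4, 3/4], then h(n') - n'.X >= c (h(n') - n'.(O + t e))^2 for all unit n',
   h being the support function of C.  Therefore, if g has a small Lipschitz constant,
   all displaced planes are planes of support of C_g; the planes of support of C at
   points of the part of the boundary which is not visible from O are unchanged.

   The union of the homothetic images of a body E with center Q and ratios in [r, 1]
   has surface measure r^2 nu_E + (1 - r^2) nu_F, F being the convex hull of E and Q.
   As C_g is a limit of bodies obtained from a fixed body by iterating this operation
   with centers on l, its surface measure is affine in w = g^2 - 1.  So the bodies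
   with g^2 = 1 + s w form the required family, and the director vectors of functions
   w with plateaus on disjoint intervals are linearly independent. *)
Require Import Defs.
From HB Require Import structures.
From mathcomp Require Import all_boot all_order all_algebra.
From mathcomp Require Import all_classical all_reals all_analysis.
From mathcomp Require Import ring lra.
Set Implicit Arguments.
Unset Strict Implicit.
Unset Printing Implicit Defensive.
Import Order.TTheory GRing.Theory Num.Theory.
Import numFieldNormedType.Exports.
Local Open Scope classical_set_scope.
Local Open Scope ring_scope.

(** The contact point of a displaced plane must stay on the inner side of every other displaced
    plane. For intercepts x and x' the excess is the Taylor remainder of Phi, of order eta (x' -
    x)^2, minus g(x) times the gap of C; a gap quadratic in x' - x is thus what a g of small
    Lipschitz constant needs. The gap degenerates near B, where the C^1 arc ends, and for planes
    almost through O, which touch C near the points of tangency. There g is constant, and the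
    displacement is the identity or a homothety, which needs no gap.

    Stretching multiplies slopes by a ratio at most 1, whereas sqrt(1 + w) may increase. The
    approximation therefore starts from the body of slope [base_slope eta], which grows faster than
    every sqrt(1 + w) in use. The convex hull that appears at each step does not depend on w, so
    only coefficients affine in w matter. Letting the step length tend to 0 requires weak continuity
    of the surface measure, obtained on closed sets of normals by comparing projections onto convex
    bodies. *)

Section euclidean_space.
Context {R : realType}.
Local Notation V := 'rV[R]_3.
Implicit Types (u v w x y z n : V) (A C D : set V).

Lemma dotE u v : dot u v = u 0 0 * v 0 0 + u 0 1 * v 0 1 + u 0 2 * v 0 2.
Proof.
rewrite /dot !mxE !big_ord_recl big_ord0 addr0 !mxE addrA.
by congr (_ * _ + _ * _ + _ * _); congr (_ _ _); apply/val_inj.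
Qed.

Lemma dotC u v : dot u v = dot v u.
Proof. by rewrite !dotE; ring. Qed.

Lemma dotDl u v w : dot (u + v) w = dot u w + dot v w.
Proof. by rewrite !dotE !mxE; ring. Qed.

Lemma dotDr u v w : dot w (u + v) = dot w u + dot w v.
Proof. by rewrite !dotE !mxE; ring. Qed.

Lemma dotNl u w : dot (- u) w = - dot u w.
Proof. by rewrite !dotE !mxE; ring. Qed.

Lemma dotNr u w : dot w (- u) = - dot w u.
Proof. by rewrite !dotE !mxE; ring. Qed.

Lemma dotZl a u w : dot (a *: u) w = a * dot u w.
Proof. by rewrite !dotE !mxE; ring. Qed.

Lemma dotZr a u w : dot w (a *: u) = a * dot w u.
Proof. by rewrite !dotE !mxE; ring. Qed.

Lemma dot0l u : dot 0 u = 0.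
Proof. by rewrite dotE !mxE; ring. Qed.

Lemma dot0r u : dot u 0 = 0.
Proof. by rewrite dotE !mxE; ring. Qed.

Definition dotX := (dotDl, dotDr, dotNl, dotNr, dotZl, dotZr, @dot0l, @dot0r).

Lemma dot_ge0 u : 0 <= dot u u.
Proof. by rewrite dotE -!expr2 !addr_ge0 ?sqr_ge0. Qed.

Lemma sqr_enorm u : enorm u ^+ 2 = dot u u.
Proof. by rewrite sqr_sqrtr// dot_ge0. Qed.

Lemma enorm_ge0 u : 0 <= enorm u.
Proof. exact: sqrtr_ge0. Qed.
Hint Resolve enorm_ge0 : core.

Lemma ord3P (i : 'I_3) : [\/ i = 0, i = 1 | i = 2].
Proof.
case: i => -[|[|[|//]]] Hi; [apply: Or31 | apply: Or32 | apply: Or33];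
  exact/val_inj.
Qed.

Lemma coord_le_enorm u i : `|u 0 i| <= enorm u.
Proof.
rewrite -sqrtr_sqr ler_wsqrtr// dotE -!expr2.
have := (sqr_ge0 (u 0 0), sqr_ge0 (u 0 1), sqr_ge0 (u 0 2)).
by case=> -[? ?] ?; case: (ord3P i) => ->; lra.
Qed.

Lemma dot_eq0 u : dot u u = 0 -> u = 0.
Proof.
move=> u0; apply/rowP => i; rewrite mxE; apply/eqP; rewrite -normr_le0.
by apply: (le_trans (coord_le_enorm u i)); rewrite /enorm u0 sqrtr0.
Qed.

Lemma enorm0 : enorm (0 : V) = 0.
Proof. by rewrite /enorm dot0l sqrtr0. Qed.

Lemma enorm_eq0 u : (enorm u == 0) = (u == 0).
Proof.
apply/eqP/eqP => [u0|->]; last exact: enorm0.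
by apply: dot_eq0; rewrite -sqr_enorm u0 expr0n.
Qed.

Lemma enorm_gt0 u : (0 < enorm u) = (u != 0).
Proof. by rewrite lt_neqAle enorm_ge0 andbT eq_sym enorm_eq0. Qed.

Lemma dot_gt0 u : u != 0 -> 0 < dot u u.
Proof. by rewrite -enorm_gt0 -sqr_enorm => ?; rewrite exprn_gt0. Qed.

Lemma enormZ a u : enorm (a *: u) = `|a| * enorm u.
Proof.
by rewrite /enorm dotZl dotZr mulrA -expr2 sqrtrM ?sqr_ge0// sqrtr_sqr.
Qed.

Lemma enormN u : enorm (- u) = enorm u.
Proof. by rewrite -scaleN1r enormZ normrN1 mul1r. Qed.

Lemma enormBC u v : enorm (u - v) = enorm (v - u).
Proof. by rewrite -enormN opprB. Qed.

Lemma dot_sqr_le u v : dot u v ^+ 2 <= dot u u * dot v v.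
Proof.
rewrite !dotE.
set a := u 0 0; set b := u 0 1; set c := u 0 2.
set d := v 0 0; set e := v 0 1; set f := v 0 2.
(* By Lagrange's identity the difference of the two sides is the sum of these squares. *)
have := (sqr_ge0 (a * e - b * d), sqr_ge0 (a * f - c * d),
  sqr_ge0 (b * f - c * e)).
by case=> -[? ?] ?; nra.
Qed.

Lemma dot_le_enorm u v : `|dot u v| <= enorm u * enorm v.
Proof.
rewrite -(ler_pXn2r (_ : 0 < 2)%N) ?nnegrE ?mulr_ge0//.
by rewrite real_normK ?num_real// exprMn !sqr_enorm dot_sqr_le.
Qed.

Lemma dot_le u v : dot u v <= enorm u * enorm v.
Proof. exact: le_trans (ler_norm _) (dot_le_enorm u v). Qed.

Lemma dot_unit_le n u : enorm n = 1 -> `|dot n u| <= enorm u.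
Proof. by move=> n1; have := dot_le_enorm n u; rewrite n1 mul1r. Qed.

Lemma enormD u v : enorm (u + v) <= enorm u + enorm v.
Proof.
rewrite -(ler_pXn2r (_ : 0 < 2)%N) ?nnegrE ?addr_ge0//.
rewrite sqr_enorm !dotX (dotC v u) sqrrD !sqr_enorm.
by have := dot_le u v; rewrite mulr2n; lra.
Qed.

Lemma enormB_le u v w : enorm (u - w) <= enorm (u - v) + enorm (v - w).
Proof. by have := enormD (u - v) (v - w); rewrite addrA subrK. Qed.

Lemma enorm_le_dot u v : (enorm u <= enorm v) = (dot u u <= dot v v).
Proof. by rewrite -!sqr_enorm ler_pXn2r ?nnegrE. Qed.

Lemma enorm_normalize u : u != 0 -> enorm ((enorm u)^-1 *: u) = 1.
Proof.
rewrite -enorm_gt0 => u0; rewrite enormZ ger0_norm ?invr_ge0//.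
by rewrite mulVf// gt_eqF.
Qed.

Lemma enorm_neq0 n : enorm n = 1 -> n != 0.
Proof. by rewrite -enorm_gt0 => ->. Qed.

Lemma enorm_le_max u c : 0 <= c -> (forall i, `|u 0 i| <= c) -> enorm u <= 2 * c.
Proof.
move=> c0 uc.
have s i : u 0 i ^+ 2 <= c ^+ 2.
  by rewrite -real_normK ?num_real// ler_pXn2r ?nnegrE.
rewrite -(ler_pXn2r (_ : 0 < 2)%N) ?nnegrE ?mulr_ge0//.
rewrite sqr_enorm dotE -!expr2; have := (s 0, s 1, s 2, sqr_ge0 c).
by case=> -[[? ?] ?] ?; nra.
Qed.

Lemma mx_norm_coord (u : V) i : `|u 0 i| <= `|u|.
Proof.
rewrite [leRHS]/Num.norm /= mx_normrE.
by apply/bigmax_geP; right => /=; exists (0, i).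
Qed.

Lemma enorm_le_norm (u : V) : enorm u <= 2 * `|u|.
Proof. by apply: enorm_le_max => // i; exact: mx_norm_coord. Qed.

Lemma norm_le_enorm (u : V) : `|u| <= enorm u.
Proof.
rewrite [leLHS]/Num.norm /= mx_normrE; apply: bigmax_le => // -[i j] _ /=.
by rewrite ord1 coord_le_enorm.
Qed.

(** The topology comes from the max norm and the metric notions from the Euclidean one; comparing
    the norms in both directions lets all later arguments use Euclidean balls. *)
Lemma nbhs_enormP x A :
  nbhs x A <-> exists2 e, 0 < e & forall y, enorm (y - x) < e -> A y.
Proof.
split=> [|[e e0 sA]].
  rewrite -nbhs_ballE => -[e /= e0 sA].
  exists e => // y yx; apply: sA; rewrite -ball_normE /= distrC.
  exact: le_lt_trans (norm_le_enorm _) yx.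
rewrite -nbhs_ballE; exists (e / 2) => /=; first by rewrite divr_gt0.
move=> y; rewrite -ball_normE /= distrC => yx; apply: sA.
apply: (le_lt_trans (enorm_le_norm _)); lra.
Qed.

Lemma interior_enormP C x :
  interior C x <-> exists2 e, 0 < e & forall y, enorm (y - x) <= e -> C y.
Proof.
split=> [/nbhs_enormP[e e0 sA]|[e e0 sA]].
  by exists (e / 2) => [|y yx]; [rewrite divr_gt0| apply: sA; lra].
by apply/nbhs_enormP; exists e => // y /ltW /sA.
Qed.

Lemma closed_enormP A :
  closed A <-> forall x, (forall e, 0 < e -> exists2 y, A y & enorm (y - x) < e) -> A x.
Proof.
split=> [cA x xA|H x clx].
  apply: cA => U /nbhs_enormP[e e0 sU]; have [y Ay yx] := xA e e0.
  by exists y; split => //; apply: sU.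
apply: H => e e0.
have [|y [Ay]] := clx [set y | enorm (y - x) < e]; last by exists y.
by apply/nbhs_enormP; exists e.
Qed.

Lemma continuous_coord i : continuous (fun u : V => u 0 i).
Proof. exact: coord_continuous. Qed.

Lemma continuous_dot (T : topologicalType) (f g : T -> V) (t : T) :
  {for t, continuous f} -> {for t, continuous g} ->
  {for t, continuous (fun s => dot (f s) (g s))}.
Proof.
move=> cf cg.
have c (h : T -> V) i : {for t, continuous h} ->
    (fun s => h s 0 i) s @[s --> t] --> h t 0 i.
  move=> ch; apply: (@continuous_comp _ _ _ h (fun u : V => u 0 i)) => //.
  exact: continuous_coord.
have -> : (fun s => dot (f s) (g s)) = (fun s : T =>
    f s 0 0 * g s 0 0 + f s 0 1 * g s 0 1 + f s 0 2 * g s 0 2).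
  by apply/funext => s; rewrite dotE.
apply: cvgD; first apply: cvgD.
all: by apply: cvgM; apply: c.
Qed.

Lemma continuous_dotr n : continuous (dot n).
Proof.
move=> x; apply: (@continuous_dot _ (fun=> n) idfun).
  exact: cst_continuous.
exact: cvg_id.
Qed.

Lemma continuous_enorm : continuous (@enorm R).
Proof.
move=> x; apply: (@continuous_comp _ _ _ (fun u : V => dot u u) Num.sqrt).
  by apply: (@continuous_dot V (fun u => u) (fun u => u) x); exact: cvg_id.
exact: sqrt_continuous.
Qed.

Lemma compact_enorm A M : closed A -> (forall x, A x -> enorm x <= M) -> compact A.
Proof.
move=> cA bA; apply: bounded_closed_compact => //.
exists M; split => [|N MN x Ax]; first exact: num_real.
by apply: le_trans (norm_le_enorm _) _; apply: le_trans (bA _ Ax) (ltW MN).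
Qed.

Lemma compact_bounded A : compact A -> exists2 M, 0 < M & forall x, A x -> enorm x <= M.
Proof.
move=> /compact_bounded[M [_ bM]]; exists (2 * (`|M| + 1)) => [|x Ax].
  by have := normr_ge0 M; lra.
apply: (le_trans (enorm_le_norm _)); rewrite ler_pM2l//; apply: bM => //.
by rewrite (le_lt_trans (ler_norm M))// ltrDl.
Qed.

Lemma compact_is_closed A : compact A -> closed A.
Proof. by apply: compact_closed; exact: norm_hausdorff. Qed.

Lemma EVT_max_dot n A : A !=set0 -> compact A ->
  exists2 x, A x & forall y, A y -> dot n y <= dot n x.
Proof.
move=> A0 cA; have [|x /set_mem Ax xm] := @EVT_max_rV R 3 (dot n) A A0 cA.
  by apply: continuous_subspaceT; exact: continuous_dotr.
by exists x => // y Ay; apply: xm; exact: mem_set.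
Qed.

Lemma convex_setP C : convex_set C <->
  forall x y t, 0 <= t -> t <= 1 -> C x -> C y -> C (x + t *: (y - x)).
Proof.
split=> [cC x y t t0 t1 Cx Cy|H x y t /set_mem Cx /set_mem Cy].
  have t0' : 0 <= 1 - t by lra.
  have t1' : 1 - t <= 1 by lra.
  have := cC x y (Itv01 t0' t1') (mem_set Cx) (mem_set Cy); rewrite inE.
  congr (C _); apply/rowP => i.
  by rewrite /conv/= /unstable.onem !mxE /=; ring.
apply/mem_set; rewrite [conv _ _ _](_ : _ = x + (1 - t%:num) *: (y - x)).
  have [h0 h1] : 0 <= t%:num /\ t%:num <= 1 by split.
  by apply: H => //; lra.
apply/rowP => i.
by rewrite /conv/= /unstable.onem !mxE /=; ring.
Qed.

End euclidean_space.
Global Hint Resolve enorm_ge0 : core.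

Ltac vring := apply/rowP => ?; rewrite ?mxE; ring.

(** * Convex bodies: separation, support functions, normals *)

Section convex_bodies.
Context {R : realType}.
Local Notation V := 'rV[R]_3.
Implicit Types (u v w x y z n m : V) (A C D : set V).

Lemma body_convex C : convex_body C ->
  forall x y t, 0 <= t -> t <= 1 -> C x -> C y -> C (x + t *: (y - x)).
Proof. by case=> /convex_setP. Qed.

Lemma body_closed C : convex_body C -> closed C.
Proof. by case=> _ /compact_is_closed. Qed.

Lemma body_bounded C : convex_body C ->
  exists2 M, 0 < M & forall x, C x -> enorm x <= M.
Proof. by case=> _ /compact_bounded. Qed.

Lemma body_ball C : convex_body C ->
  exists z rho, 0 < rho /\ forall y, enorm (y - z) <= rho -> C y.
Proof. by case=> _ _ [z /interior_enormP[e e0 H]]; exists z, e. Qed.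

Lemma body_neq0 C : convex_body C -> C !=set0.
Proof. by case=> _ _ [z /interior_subset Cz]; exists z. Qed.

(** The direction is that from the nearest point [p] of [C] to [x], and [d] is the distance of [x]
    from [C]. *)
Lemma separation C x : convex_set C -> compact C -> C !=set0 -> ~ C x ->
  exists n d, [/\ enorm n = 1, 0 < d & forall y, C y -> dot n y + d <= dot n x].
Proof.
move=> /convex_setP cC kC C0 Cx.
have [|p /set_mem Cp pm] := @EVT_min_rV R 3 (fun y => enorm (y - x)) C C0 kC.
  apply: continuous_subspaceT => y.
  apply: (@continuous_comp _ _ _ (fun u => u - x) (@enorm R)).
    by apply: (@cvgB _ _ _ (nbhs y)); [exact: cvg_id|exact: cvg_cst].
  exact: continuous_enorm.
set v := x - p.
have v0 : v != 0 by rewrite subr_eq0; apply/eqP => e; apply: Cx; rewrite e.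
have key y : C y -> dot v (y - p) <= 0.
  move=> Cy; rewrite leNgt; apply/negP => c0.
  set c := dot v (y - p) in c0; set w := dot (y - p) (y - p).
  (* With [t * w <= c], going from [p] towards [y] changes the squared distance to [x] by
     [t * (t * w - 2 * c) < 0], against the choice of [p]. *)
  have [t [t0 t1 tw]] : exists t, [/\ 0 < t, t <= 1 & t * w <= c].
    have [wc|wc] := leP w c; first by exists 1; rewrite mul1r.
    have w0 : 0 < w by apply: lt_trans wc.
    by exists (c / w); rewrite divr_gt0// ler_pdivrMr// mul1r ltW// divfK ?gt_eqF.
  have /mem_set/pm : C (p + t *: (y - p)) by apply: cC => //; exact: ltW.
  rewrite enorm_le_dot (_ : p + _ - x = t *: (y - p) - v); last by rewrite /v; vring.
  rewrite (_ : p - x = - v); last by rewrite /v; vring.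
  have -> : dot (t *: (y - p) - v) (t *: (y - p) - v) =
      t * (t * w - c *+ 2) + dot (- v) (- v).
    by rewrite /w /c !dotE !mxE; ring.
  by rewrite lerDr; nra.
have ev : 0 < enorm v by rewrite enorm_gt0.
exists ((enorm v)^-1 *: v), (enorm v); split; rewrite ?enorm_normalize// => y Cy.
have E : dot v x = dot v y + enorm v ^+ 2 - dot v (y - p).
  by rewrite sqr_enorm /v !dotE !mxE; ring.
rewrite !dotZl E.
have -> : (enorm v)^-1 * (dot v y + enorm v ^+ 2 - dot v (y - p)) =
    (enorm v)^-1 * dot v y + enorm v - (enorm v)^-1 * dot v (y - p).
  by field; rewrite gt_eqF.
have := mulr_ge0_le0 (ltW (_ : 0 < (enorm v)^-1)) (key y Cy).
by rewrite invr_gt0 => /(_ ev); lra.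
Qed.

Lemma sphere_compact : compact [set n : V | enorm n = 1].
Proof.
apply: (@compact_enorm _ _ 1) => [|n /= ->//].
rewrite (_ : [set n | _] = @enorm R @^-1` [set 1]); last by [].
by apply: closed_comp => [n _|]; [exact: continuous_enorm|exact: closed_eq].
Qed.

Definition supp C n : R := sup [set dot n y | y in C].

Lemma supp_att C n : convex_body C -> exists2 x, C x & dot n x = supp C n.
Proof.
move=> hC; have [_ kC _] := hC; have [x Cx xm] := EVT_max_dot n (body_neq0 hC) kC.
exists x => //; apply/eqP; rewrite eq_le; apply/andP; split.
  apply: ub_le_sup; last by exists x.
  by exists (dot n x) => _ [y Cy <-]; exact: xm.
by apply: ge_sup; [exists (dot n x), x|move=> _ [y Cy <-]; exact: xm].
Qed.

Lemma supp_ub C n y : convex_body C -> C y -> dot n y <= supp C n.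
Proof.
move=> hC Cy; have [_ kC _] := hC.
have [x Cx xm] := EVT_max_dot n (body_neq0 hC) kC.
apply: ub_le_sup; last by exists y.
by exists (dot n x) => _ [u Cu <-]; exact: xm.
Qed.

Lemma supp_le C n c : convex_body C -> (forall y, C y -> dot n y <= c) -> supp C n <= c.
Proof. by move=> hC H; have [x Cx <-] := supp_att n hC; exact: H. Qed.

Lemma suppZ C n a : convex_body C -> 0 <= a -> supp C (a *: n) = a * supp C n.
Proof.
move=> hC a0; apply/eqP; rewrite eq_le; apply/andP; split.
  by apply: supp_le => // y Cy; rewrite dotZl ler_wpM2l// supp_ub.
by have [x Cx <-] := supp_att n hC; rewrite -dotZl supp_ub.
Qed.

Lemma supp_lip C M n m : convex_body C -> (forall x, C x -> enorm x <= M) ->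
  `|supp C n - supp C m| <= M * enorm (n - m).
Proof.
move=> hC bC; wlog s : n m / supp C m <= supp C n.
  move=> H; case: (leP (supp C m) (supp C n)) => [/H//|/ltW /H].
  by rewrite distrC enormBC.
rewrite ger0_norm ?subr_ge0//; have [x Cx e] := supp_att n hC.
have := supp_ub m hC Cx; have := dot_le (n - m) x.
rewrite !dotX => h1 h2; have := bC _ Cx; have := enorm_ge0 (n - m).
by nra.
Qed.

Lemma continuous_supp C : convex_body C -> continuous (supp C).
Proof.
move=> hC n; have [M M0 bM] := body_bounded hC.
apply/(@cvgrPdist_lt _ _ _ (nbhs n)) => e e0; apply/nbhs_enormP.
exists (e / M) => [|m]; first by rewrite divr_gt0.
rewrite enormBC ltr_pdivlMr// mulrC; apply: le_lt_trans.
exact: supp_lip.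
Qed.

Lemma supp_ball C z rho n : convex_body C -> 0 < rho ->
  (forall y, enorm (y - z) <= rho -> C y) ->
  dot n z + rho * enorm n <= supp C n.
Proof.
move=> hC r0 bC; have [->|n0] := eqVneq n 0.
  rewrite dot0l enorm0 mulr0 addr0; have Cz : C z by apply: bC; rewrite subrr enorm0 ltW.
  by have := supp_ub 0 hC Cz; rewrite dot0l.
have e0 : 0 < enorm n by rewrite enorm_gt0.
have /(supp_ub n hC) : C (z + rho *: ((enorm n)^-1 *: n)).
  apply: bC; rewrite addrAC subrr add0r enormZ enorm_normalize// mulr1.
  by rewrite ger0_norm// ltW.
rewrite !dotX -(sqr_enorm n) (_ : (enorm n)^-1 * _ = enorm n)//.
by rewrite expr2 mulrA mulVf ?mul1r// gt_eqF.
Qed.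

Definition normal C x n := [/\ C x, enorm n = 1 & forall y, C y -> dot n (y - x) <= 0].

Lemma normal_supp C x n : convex_body C -> normal C x n -> dot n x = supp C n.
Proof.
move=> hC [Cx n1 H]; apply/eqP; rewrite eq_le supp_ub//=.
by apply: supp_le => // y /H; rewrite dotDr dotNr subr_le0.
Qed.

Lemma supp_normal C x n : convex_body C -> C x -> enorm n = 1 -> dot n x = supp C n ->
  normal C x n.
Proof.
by move=> hC Cx n1 e; split=> // y Cy; rewrite dotDr dotNr subr_le0 e supp_ub.
Qed.

Lemma body_in_supp C x : convex_body C ->
  (forall n, enorm n = 1 -> dot n x <= supp C n) -> C x.
Proof.
move=> hC H; apply: contrapT => Cx; have [cC kC _] := hC.
have [n [d [n1 d0 nd]]] := separation cC kC (body_neq0 hC) Cx.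
have [y Cy e] := supp_att n hC.
by have := nd _ Cy; have := H n n1; lra.
Qed.

Lemma body_supp_subset C D : convex_body C -> convex_body D ->
  (forall n, enorm n = 1 -> supp C n <= supp D n) -> C `<=` D.
Proof.
move=> hC hD H x Cx; apply: body_in_supp => // n n1.
exact: le_trans (supp_ub n hC Cx) (H n n1).
Qed.

(** Supporting hyperplane theorem. The slack [supp C n - dot n x] has a minimum [d] on the unit
    sphere; if [d > 0], all points within [d / 2] of [x] satisfy the inequalities defining [C], so
    [x] is interior. *)
Lemma boundary_bodyP C x : convex_body C -> boundary C x <-> exists n, normal C x n.
Proof.
move=> hC; have clC := body_closed hC.
split=> [[]|[n [Cx n1 H]]]; last first.
  split; first exact: subset_closure.
  move=> /interior_enormP[e e0 /(_ (x + e *: n))].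
  rewrite addrAC subrr add0r enormZ n1 mulr1 (ger0_norm (ltW e0)) => /(_ (lexx _)) /H.
  rewrite addrAC subrr add0r dotZr -(sqr_enorm n) n1; nra.
move=> /clC Cx nCx.
have sne : [set n : V | enorm n = 1] !=set0.
  by exists (delta_mx 0 0); have := sphere_delta R; rewrite inE.
have [|n /set_mem /= n1 nm] := @EVT_min_rV R 3 (fun n => supp C n - dot n x) _ sne sphere_compact.
  apply: continuous_subspaceT => n.
  apply: (@cvgB _ _ _ (nbhs n) _ (supp C) (fun n => dot n x)).
    exact: continuous_supp.
  apply: (@continuous_dot _ _ idfun (fun=> x)); first exact: cvg_id.
  exact: cst_continuous.
exists n; apply: supp_normal => //; apply/eqP; rewrite eq_le supp_ub//=.
rewrite -subr_le0 leNgt; apply/negP; set d := supp C n - dot n x => d0.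
apply: nCx; apply/interior_enormP; exists (d / 2) => [|y yx]; first by rewrite divr_gt0.
apply: body_in_supp => // m m1.
have := nm m; rewrite inE -/d => /(_ m1).
have := dot_unit_le (y - x) m1; rewrite ler_norml dotDr dotNr => /andP[_].
by lra.
Qed.

(** The boundary point sits at the supremum of the parameters whose point lies in [C]: a ball inside
    [C] around it would allow a larger parameter. *)
Lemma crossing C p q : closed C -> C p -> ~ C q ->
  exists t, [/\ 0 <= t, t <= 1 & boundary C (p + t *: (q - p))].
Proof.
move=> clC Cp Cq; set S := [set t | [/\ 0 <= t, t <= 1 & C (p + t *: (q - p))]].
have S0 : S 0 by split=> //; rewrite scale0r addr0.
have hS : has_sup S by split; [exists 0|exists 1 => t []].
have s0 : 0 <= sup S by apply: ub_le_sup => //; case: hS.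
have s1 : sup S <= 1 by apply: ge_sup; [exists 0|move=> t []].
have d0 : 0 < enorm (q - p).
  by rewrite enorm_gt0 subr_eq0; apply/eqP => e; apply: Cq; rewrite e.
have line_dist a b : enorm (p + a *: (q - p) - (p + b *: (q - p))) = `|a - b| * enorm (q - p).
  by rewrite -enormZ; congr enorm; vring.
have Cs : C (p + sup S *: (q - p)).
  move/closed_enormP: (clC); apply => e e0.
  have [t St lt] := sup_adherent (divr_gt0 e0 d0) hS.
  have ts : t <= sup S by apply: ub_le_sup => //; case: hS.
  case: St => ? ? Ct; exists (p + t *: (q - p)) => //.
  rewrite line_dist -ltr_pdivlMr// ler0_norm; lra.
exists (sup S); split=> //; split; first exact: subset_closure.
move=> /interior_enormP[e e0 H].
have [s1'|s1'] := eqVneq (sup S) 1.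
  by apply: Cq; move: Cs; rewrite s1' scale1r addrCA subrr addr0.
have {}s1' : sup S < 1 by rewrite lt_neqAle s1'.
have := divr_gt0 e0 d0; set r := e / _ => r0.
have [m0 [m1 m2]] : 0 < Num.min r (1 - sup S) /\ Num.min r (1 - sup S) <= r /\ Num.min r (1 - sup S) <= 1 - sup S.
  by rewrite lt_min r0 subr_gt0 s1' !ge_min !lexx orbT.
set k := Num.min _ _ in m0 m1 m2.
have : S (sup S + k).
  split; [lra|lra|apply: H; rewrite line_dist addrAC subrr add0r (ger0_norm (ltW m0))].
  by rewrite -ler_pdivlMr.
by move=> /(ub_le_sup (proj2 hS)); lra.
Qed.

End convex_bodies.

(** * Hausdorff measure as a metric outer measure *)

Section hausdorff_outer_measure.
Context {R : realType}.
Local Notation V := 'rV[R]_3.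
Local Notation H2 := (@hausdorff2 R).
Implicit Types (x y : V) (A B E F U : set V) (d : R).
Local Open Scope ereal_scope.

Lemma ediam_ge0 U : 0 <= ediam U.
Proof. by apply: ereal_sup_ubound; left. Qed.

Lemma ediam_ge U x y : U x -> U y -> (enorm (x - y))%:E <= ediam U.
Proof. by move=> Ux Uy; apply: ereal_sup_ubound; right; exists (x, y). Qed.

Lemma ediam_le U c : 0 <= c -> (forall x y, U x -> U y -> (enorm (x - y))%:E <= c) ->
  ediam U <= c.
Proof. by move=> c0 Uc; apply: ge_ereal_sup => _ [->//|[[x y] [? ?] <-]]; exact: Uc. Qed.

Lemma ediam0 : ediam (set0 : set V) = 0.
Proof. by apply/eqP; rewrite eq_le ediam_ge0 ediam_le. Qed.

Let area U := (pi / 4)%:E * ediam U ^+ 2.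

Lemma area_ge0 U : 0 <= area U.
Proof.
by rewrite mule_ge0 ?expe_ge0 ?ediam_ge0// lee_fin divr_ge0// pi_ge0.
Qed.

(** Infinite weight on pieces of diameter more than [d] encodes the constraint on covers. So
    [hausdorff2_pre d] is the outer measure generated by this function on the discrete
    sigma-algebra, where every cover counts as measurable. *)
Let area_gauge d U := if ediam U <= d%:E then area U else +oo.

Let area_gauge_ge0 d U : 0 <= area_gauge d U.
Proof. by rewrite /area_gauge; case: ifP => // _; exact: area_ge0. Qed.

Let discrete := g_sigma_algebraType (@setT (set V)).

Let hausdorff2_preE d A :
  hausdorff2_pre d A = mu_ext (area_gauge d : set discrete -> \bar R) A.
Proof.
apply/eqP; rewrite eq_le; apply/andP; split; apply: le_ereal_inf_tmp.
  move=> _ [U [mU AU] <-].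
  have [Ud|/existsNP[i /negP Ud]] := pselect (forall i, ediam (U i) <= d%:E).
    apply: ereal_inf_lbound; exists U; first by split.
    by apply: eq_eseriesr => i _; rewrite /area_gauge Ud.
  rewrite (@eseries_pinfty _ _ _ i)//; first exact: leey.
    by move=> n _; rewrite -ltNye (lt_le_trans _ (area_gauge_ge0 d _)).
  by rewrite /area_gauge (negbTE Ud).
move=> _ [U [AU Ud] <-]; apply: ereal_inf_lbound; exists U.
  by split => // i; apply: sub_sigma_algebra.
by apply: eq_eseriesr => i _; rewrite /area_gauge Ud.
Qed.

Let hausdorff2_pre_ge0 d A : 0 <= hausdorff2_pre d A.
Proof. by rewrite hausdorff2_preE mu_ext_ge0. Qed.

Lemma hausdorff2_pre_le d A : (0 < d)%R -> hausdorff2_pre d A <= H2 A.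
Proof. by move=> d0; apply: ereal_sup_ubound; exists d => //=; rewrite in_itv/= d0. Qed.

Lemma hausdorff2_leP A c : (forall d, (0 < d)%R -> hausdorff2_pre d A <= c) -> H2 A <= c.
Proof.
move=> Ac; apply: ge_ereal_sup => _ [d /= + <-].
by rewrite in_itv/= andbT; exact: Ac.
Qed.

Lemma hausdorff2_ge0 A : 0 <= H2 A.
Proof. exact: le_trans (hausdorff2_pre_ge0 1 A) (hausdorff2_pre_le _ ltr01). Qed.

Let hausdorff2_0 : H2 set0 = 0.
Proof.
apply/eqP; rewrite eq_le hausdorff2_ge0 andbT; apply: hausdorff2_leP => d d0.
rewrite hausdorff2_preE mu_ext0// /area_gauge ediam0 lee_fin ltW// /area ediam0.
by rewrite expe2 mule0 mule0.
Qed.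

Lemma le_hausdorff2 : {homo H2 : A B / A `<=` B >-> A <= B}.
Proof.
move=> A B AB; apply: hausdorff2_leP => d d0.
apply: le_trans (hausdorff2_pre_le B d0).
by rewrite !hausdorff2_preE; exact: le_mu_ext.
Qed.

Let hausdorff2_sigma_subadditive : sigma_subadditive H2.
Proof.
move=> A; apply: hausdorff2_leP => d d0; rewrite hausdorff2_preE.
apply: le_trans (mu_ext_sigma_subadditive _ _) _ => //.
apply: lee_nneseries => [i _ _|i _]; rewrite -hausdorff2_preE//.
exact: hausdorff2_pre_le.
Qed.

HB.instance Definition _ := isOuterMeasure.Build R V H2
  hausdorff2_0 hausdorff2_ge0 le_hausdorff2 hausdorff2_sigma_subadditive.

Lemma hausdorff2_pre_mono d d' A : (d <= d')%R ->
  hausdorff2_pre d' A <= hausdorff2_pre d A.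
Proof.
move=> dd'; apply: le_ereal_inf_tmp => _ [U [AU Ud] <-].
apply: ereal_inf_lbound; exists U => //; split => // i.
by apply: le_trans (Ud i) _; rewrite lee_fin.
Qed.

(** A piece of diameter at most [r / 2] cannot meet both sets, so a fine cover of the union splits
    into a cover of [A] and one of [B]. *)
Lemma hausdorff2_metric A B (r : R) : (0 < r)%R ->
  (forall x y, A x -> B y -> (r <= enorm (x - y))%R) ->
  H2 A + H2 B <= H2 (A `|` B).
Proof.
move=> r0 rAB; have [->|fAB] := eqVneq (H2 (A `|` B)) +oo; first exact: leey.
have key d d' : (0 < d)%R -> (0 < d')%R ->
    hausdorff2_pre d A + hausdorff2_pre d' B <= H2 (A `|` B).
  move=> d0 d'0; pose m := (Num.min d (Num.min d' (r / 2)))%R.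
  have m0 : (0 < m)%R by rewrite !lt_min d0 d'0 divr_gt0.
  apply: (@le_trans _ _ (hausdorff2_pre m A + hausdorff2_pre m B)).
    by apply: leeD; apply: hausdorff2_pre_mono; rewrite /m !ge_min lexx ?orbT.
  apply: le_trans (hausdorff2_pre_le _ m0).
  apply: le_ereal_inf_tmp => _ [U [AU Ud] <-].
  pose W (D : set V) i := if pselect (U i `&` D !=set0) then U i else set0.
  have WP (D : set V) : D `<=` A `|` B ->
      hausdorff2_pre m D <= \sum_(0 <= i <oo) area (W D i).
    move=> DAB; apply: ereal_inf_lbound; exists (W D) => //; split.
      move=> x Dx; have [i _ Ux] := AU _ (DAB _ Dx).
      by exists i => //; rewrite /W; case: pselect => // -[]; exists x.
    by move=> i; rewrite /W; case: pselect => ? /=; rewrite ?Ud// ediam0 lee_fin ltW.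
  apply: (le_trans (leeD (WP A _) (WP B _))); [by left|by right|].
  rewrite -nneseriesD; [|by move=> i ? ?; apply: area_ge0|by move=> i ? ?; apply: area_ge0].
  apply: lee_nneseries => [i _ _|i _]; first by rewrite adde_ge0 ?area_ge0.
  rewrite {1 2}/W; case: pselect => [[x [Ux Ax]]|?]; case: pselect => [[y [Uy By]]|?] /=.
  - have := le_trans (ediam_ge Ux Uy) (Ud i); rewrite lee_fin => xy.
    have := rAB _ _ Ax By; have : (m <= r / 2)%R by rewrite /m !ge_min lexx !orbT.
    by move=> h1 h2; exfalso; move: r0 xy h1 h2; lra.
  - by rewrite {2}/area ediam0 expe2 mule0 mule0 adde0.
  - by rewrite {1}/area ediam0 expe2 mule0 mule0 add0e.
  - by rewrite /area ediam0 expe2 mule0 mule0 add0e area_ge0.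
have fin D d : D `<=` A `|` B -> (0 < d)%R -> hausdorff2_pre d D \is a fin_num.
  move=> DAB d0; rewrite ge0_fin_numE ?hausdorff2_pre_ge0//.
  apply: le_lt_trans (hausdorff2_pre_le _ d0) _.
  by apply: le_lt_trans (le_hausdorff2 DAB) _; rewrite ltey.
have fH D : D `<=` A `|` B -> H2 D \is a fin_num.
  move=> DAB; rewrite ge0_fin_numE ?hausdorff2_ge0//.
  by apply: le_lt_trans (le_hausdorff2 DAB) _; rewrite ltey.
have sA : A `<=` A `|` B by left.
have sB : B `<=` A `|` B by right.
rewrite -leeBrDr ?fH//; apply: hausdorff2_leP => d d0.
rewrite leeBrDr ?fH// addeC -leeBrDr ?fin//; apply: hausdorff2_leP => d' d'0.
by rewrite leeBrDr ?fin// addeC key.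
Qed.

(** Caratheodory's criterion. [D n] is the part of [X] at distance at least 1 / (n + 1) from [F],
    and the [S k] are the successive shells. Shells whose indices differ by at least 2 are at
    positive distance, so the even ones and the odd ones each have total measure at most [H2 X].
    Hence the tails of the sum tend to 0, and [D n] exhausts [X] outside [F] in measure. *)
Lemma hausdorff2_closed_caratheodory F : closed F -> H2.-caratheodory F.
Proof.
move=> /closed_enormP clF; apply: le_caratheodory_measurable => X.
rewrite /=; have [->|fX] := eqVneq (H2 X) +oo; first exact: leey.
pose D n := [set x | X x /\ forall y, F y -> ((n.+1%:R)^-1 <= enorm (x - y))%R].
have D_S n : D n `<=` D n.+1.
  move=> x [Xx Dx]; split=> // y /Dx; apply: le_trans.
  by rewrite lef_pV2 ?posrE// ler_nat.
have XF_D n : H2 (X `&` F) + H2 (D n) <= H2 X.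
  apply: (@le_trans _ _ (H2 ((X `&` F) `|` D n))); last first.
    by apply: le_outer_measure => x [[]|[]].
  apply: (@hausdorff2_metric _ _ (n.+1%:R)^-1) => [|x y [_ Fx] [_ Dy]].
    by rewrite invr_gt0.
  by rewrite enormBC Dy.
pose S k := D k.+1 `\` D k.
have S_sep k m x y : (k.+2 <= m)%N -> S k x -> S m y ->
    ((k.+2%:R)^-1 - (m.+1%:R)^-1 <= enorm (x - y))%R.
  move=> km [[Xx Dx] _] [[Xy _] nDy].
  have [w Fw yw] : exists2 w, F w & (enorm (y - w) < (m.+1%:R)^-1)%R.
    apply: contrapT => nw; apply: nDy; split=> // w Fw; rewrite leNgt.
    by apply/negP => yw; apply: nw; exists w.
  rewrite lerBlDr; apply: (le_trans (Dx _ Fw)); apply: (le_trans (enormB_le x y w)).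
  by rewrite lerD2l ltW.
have S_sep0 k m : (k.+2 <= m)%N -> (0 < (k.+2%:R)^-1 - (m.+1%:R)^-1 :> R)%R.
  by move=> km; rewrite subr_gt0 ltf_pV2 ?posrE// ltr_nat ltnS.
have part p N : \sum_(0 <= k < N) H2 (S (k.*2 + p)%N) <= H2 X.
  suff : \sum_(0 <= k < N) H2 (S (k.*2 + p)%N) <=
      H2 (\bigcup_(k in `I_N) S (k.*2 + p)%N).
    move/le_trans; apply; apply: le_outer_measure => x [k _].
    by case=> -[].
  elim: N => [|N IH]; first by rewrite big_geq// outer_measure_ge0.
  rewrite big_nat_recr//= (_ : \bigcup_(k in `I_N.+1) _ =
      \bigcup_(k in `I_N) S (k.*2 + p)%N `|` S (N.*2 + p)%N); last first.
    apply/seteqP; split=> [x [k /=]|x [[k /= kN Sx]|Sx]].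
    - rewrite ltnS leq_eqVlt => /orP[/eqP ->|kN] Sx; first by right.
      by left; exists k.
    - by exists k => //=; rewrite (ltn_trans kN).
    - by exists N => /=.
  apply: (le_trans (leeD IH (le_refl _))).
  case: N {IH} => [|N].
    by rewrite (_ : \bigcup_(k in `I_0) _ = set0) ?outer_measure0 ?set0U ?add0e//
      -subset0 => x [].
  apply: (@hausdorff2_metric _ _ ((N.*2 + p).+2%:R^-1 - (N.+1.*2 + p).+1%:R^-1)%R).
    by apply: S_sep0; rewrite doubleS.
  move=> x y [k /= kN Sx] Sy.
  have le2 : ((k.*2 + p).+2 <= N.+1.*2 + p)%N.
    by rewrite -!addSn leq_add2r -doubleS leq_double.
  apply: le_trans (S_sep _ _ _ _ le2 Sx Sy); rewrite lerB// lef_pV2 ?posrE// ler_nat.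
  by rewrite !ltnS leq_add2r leq_double -ltnS.
have sumS : \sum_(0 <= k <oo) H2 (S k) < +oo.
  apply: (@le_lt_trans _ _ (H2 X + H2 X)); last by rewrite lte_add_pinfty// ltey.
  apply: lime_le; first by apply: is_cvg_nneseries => *; exact: outer_measure_ge0.
  apply: nearW => N; apply: (@le_trans _ _ (\sum_(0 <= k < N.*2) H2 (S k))).
    apply: lee_sum_nneg_natr => [i _ _|]; first exact: outer_measure_ge0.
    by rewrite -addnn leq_addr.
  apply: le_trans (leeD (part 0%N N) (part 1%N N)); rewrite -big_split/=.
  elim: N => [|N IH]; first by rewrite !big_geq.
  rewrite doubleS !big_nat_recr//= -addeA addn0 addn1; apply: leeD => //.
have XnF n : X `&` ~` F `<=` D n `|` \bigcup_(k in ~` `I_n) S k.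
  move=> x [Xx nFx].
  have [m Dmx] : exists m, D m x.
    apply: contrapT => nD; apply: nFx; apply: clF => e e0.
    have [m /ltW me] := ltr_add_invr (y := 0%R) (x := e) e0; rewrite add0r in me.
    apply: contrapT => nF; apply: nD; exists m; split=> // y Fy.
    apply: (le_trans me); rewrite leNgt; apply/negP => xy; apply: nF; exists y => //.
    by rewrite enormBC.
  have [Dnx|nDnx] := pselect (D n x); [by left|right].
  have ex : exists m, `[< D m x >] by exists m; apply/asboolP.
  case: (ex_minnP ex) => k /asboolP Dk kmin.
  have nk : (n < k)%N.
    rewrite ltnNge; apply/negP => kn; apply: nDnx.
    rewrite -(subnK kn); elim: (n - k)%N => [//|j Dj]; rewrite addSn; exact: D_S.
  case: k nk Dk kmin => // k nk Dk kmin; exists k; first by apply/negP; rewrite -leqNgt -ltnS.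
  by split=> // Dkx; have := kmin k (introT (asboolP _) Dkx); rewrite ltnn.
have step n : H2 (X `&` F) + H2 (X `&` ~` F) <= H2 X + \sum_(n <= k <oo) H2 (S k).
  apply: le_trans (leeD (XF_D n) (le_refl _)); rewrite -addeA; apply: leeD => //.
  apply: (le_trans (le_outer_measure H2 _ _ (XnF n))).
  apply: (le_trans (outer_measureU2 _ _ _)); apply: leeD => //.
  exact: (outer_measure_sigma_subadditive_tail H2 n S).
have tail0 : \sum_(n <= k <oo) H2 (S k) @[n --> \oo] --> 0.
  by apply: nneseries_tail_cvg => // *; exact: outer_measure_ge0.
have : H2 X + \sum_(n <= k <oo) H2 (S k) @[n --> \oo] --> H2 X + 0.
  apply: cvgeD => //; first exact: fin_num_adde_defl.
  exact: cvg_cst.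
rewrite adde0 => cv; rewrite -(cvg_lim _ cv)//; apply: lime_ge.
  by apply/cvg_ex; eexists; exact: cv.
by apply: nearW => n; exact: step.
Qed.

(** A cover of [Y] is transported to [E]. A relation takes the place of a Lipschitz map because
    later a point of [E] is tied to points of [Y] through some normal, and no selection of normals
    has to be made. *)
Lemma hausdorff2_rel_lip (E Y : set V) (rel : V -> V -> Prop) (L : R) : (0 < L)%R ->
  (forall x, E x -> exists2 y, Y y & rel y x) ->
  (forall y y' x x', rel y x -> rel y' x' -> E x -> E x' ->
    (enorm (x - x') <= L * enorm (y - y'))%R) ->
  H2 E <= (L ^+ 2)%:E * H2 Y.
Proof.
move=> L0 EY relL; apply: hausdorff2_leP => d d0.
have dL : (0 < d / L)%R by rewrite divr_gt0.
have L2 : (0 < L ^+ 2)%R by rewrite exprn_gt0.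
apply: le_trans (lee_wpmul2l _ (hausdorff2_pre_le Y dL)); last by rewrite lee_fin ltW.
rewrite muleC -lee_pdivrMr//; apply: le_ereal_inf_tmp => _ [U [YU Ud] <-].
rewrite lee_pdivrMr// muleC.
pose W i := [set x | E x /\ exists2 y, U i y & rel y x].
have dW i : ediam (W i) <= L%:E * ediam (U i).
  apply: ediam_le => [|x x' [Ex [y Uy yx]] [Ex' [y' Uy' yx']]].
    by rewrite mule_ge0 ?ediam_ge0// lee_fin ltW.
  apply: le_trans (lee_wpmul2l _ (ediam_ge Uy Uy')); last by rewrite lee_fin ltW.
  by rewrite -EFinM lee_fin; exact: relL yx yx' Ex Ex'.
apply: (@le_trans _ _ (\sum_(0 <= i <oo) area (W i))).
  apply: ereal_inf_lbound; exists W => //; split=> [x Ex|i].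
    by have [y Yy yx] := EY _ Ex; have [i _ Uy] := YU _ Yy; exists i => //; split => //; exists y.
  apply: (le_trans (dW i)); have := @lee_wpmul2l _ L%:E _ _ _ (Ud i).
  by rewrite -EFinM mulrC divfK ?gt_eqF//; apply; rewrite lee_fin ltW.
rewrite -nneseriesZl//; last by move=> i _; exact: area_ge0.
apply: lee_nneseries => [j _ _|j _]; first exact: area_ge0.
rewrite /area [leRHS]muleCA; apply: lee_wpmul2l; first by rewrite lee_fin divr_ge0// pi_ge0.
by rewrite !expe2 expr2 EFinM muleACA lee_pmul ?ediam_ge0.
Qed.

End hausdorff_outer_measure.

(** * Caratheodory measurable sets and null sets of an outer measure *)

Section outer_measure_complements.
Context (T : pointedType) {R : realType} (mu : {outer_measure set T -> \bar R}).
Local Open Scope ereal_scope.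

Lemma caratheodory_nonincreasing_cvg (F : (set T)^nat) :
  mu (F 0%N) < +oo -> (forall n, mu.-caratheodory (F n)) ->
  (forall n, F n.+1 `<=` F n) ->
  mu (F n) @[n --> \oo] --> mu (\bigcap_n F n).
Proof.
move=> F0 mF dF.
apply: (@nonincreasing_cvg_mu _ (caratheodory_type mu) R (mu : set (caratheodory_type mu) -> \bar R)).
- exact: F0.
- exact: mF.
- by apply: bigcap_measurable => // n _; exact: mF.
- by apply/nonincreasing_seqP => n; apply/subsetPset; exact: dF.
Qed.

Lemma caratheodory_setUI A B : mu.-caratheodory A ->
  mu (A `|` B) + mu (A `&` B) = mu A + mu B.
Proof.
move=> mA; rewrite (mA (A `|` B)) (mA B) setUK.
rewrite (_ : (A `|` B) `&` ~` A = B `&` ~` A); last first.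
  by rewrite setIUl setICr set0U.
by rewrite -!addeA; congr (_ + _); rewrite addeC setIC.
Qed.

Lemma caratheodory_null A : mu A = 0 -> mu.-caratheodory A.
Proof.
move=> A0; apply: le_caratheodory_measurable => X.
rewrite (_ : mu (X `&` A) = 0) ?add0e; first by apply: le_outer_measure => x [].
apply/eqP; rewrite eq_le outer_measure_ge0 andbT -A0.
by apply: le_outer_measure => x [].
Qed.

Lemma outer_measure_setU_null A B : mu B = 0 -> mu (A `|` B) = mu A.
Proof.
move=> B0; apply/eqP; rewrite eq_le (le_outer_measure mu A (A `|` B) (@subsetUl _ A B)) andbT.
by have := outer_measureU2 mu A B; rewrite B0 adde0.
Qed.

Lemma outer_measure_null_diff A B N : mu N = 0 -> A `<=` B `|` N -> B `<=` A `|` N ->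
  mu A = mu B.
Proof.
move=> N0 AB BA; apply/eqP; rewrite eq_le; apply/andP; split.
  by rewrite -(outer_measure_setU_null B N0); exact: le_outer_measure.
by rewrite -(outer_measure_setU_null A N0); exact: le_outer_measure.
Qed.

End outer_measure_complements.

(** * Hausdorff measure of points and homothetic images; finiteness and positivity *)

Section hausdorff_estimates.
Context {R : realType}.
Local Notation V := 'rV[R]_3.
Local Notation H2 := (@hausdorff2 R).
Implicit Types (x y n : V) (E : set V).
Local Open Scope ereal_scope.

Lemma hausdorff2_set1 x : H2 [set x] = 0.
Proof.
apply/eqP; rewrite eq_le hausdorff2_ge0 andbT; apply: hausdorff2_leP => d d0.
have dx : ediam [set x] = 0.
  apply/eqP; rewrite eq_le ediam_ge0 andbT; apply: ediam_le => // y y' -> ->.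
  by rewrite subrr enorm0.
pose U i : set V := if i == 0%N then [set x] else set0.
apply: (@le_trans _ _ (\sum_(0 <= i <oo) ((pi / 4)%:E * ediam (U i) ^+ 2))).
  apply: ereal_inf_lbound; exists U => //.
  split; first by move=> y ->; exists 0%N.
  by case=> [|i]; rewrite /U /= ?dx ?ediam0 lee_fin ltW.
by rewrite eseries0// => -[|i] _ _; rewrite /U /= ?dx ?ediam0 !mule0.
Qed.

Lemma hausdorff2_homothety E (l : R) (v : V) : (0 < l)%R ->
  H2 [set v + l *: x | x in E]%R = (l ^+ 2)%:E * H2 E.
Proof.
move=> l0; have l20 : (0 < l ^+ 2)%R by rewrite exprn_gt0.
apply/eqP; rewrite eq_le; apply/andP; split.
  apply: (hausdorff2_rel_lip (rel := fun y x => x = v + l *: y)%R) => //.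
    by move=> _ [x Ex <-]; exists x.
  move=> y y' _ _ -> -> _ _.
  rewrite (_ : v + l *: y - (v + l *: y') = l *: (y - y'))%R; last by vring.
  by rewrite enormZ ger0_norm// ltW.
rewrite muleC -lee_pdivlMr// muleC -exprVn.
apply: (hausdorff2_rel_lip (rel := fun y x => y = v + l *: x)%R); first by rewrite invr_gt0.
  by move=> x Ex; exists (v + l *: x)%R => //; exists x.
move=> _ _ x x' -> -> _ _.
rewrite (_ : v + l *: x - (v + l *: x') = l *: (x - x'))%R; last by vring.
by rewrite enormZ (ger0_norm (ltW l0)) mulKf ?gt_eqF.
Qed.

Let square (M : R) : set V :=
  [set x | [/\ x 0 2 = 0, `|x 0 0| <= M & `|x 0 1| <= M]%R].

Let hausdorff2_square_fin M : H2 (square M) < +oo.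
Proof.
wlog M0 : M / (0 < M)%R.
  move=> H; apply: le_lt_trans (H (`|M| + 1)%R _).
    apply: le_hausdorff2 => x [x2 x0 x1]; have := ler_norm M.
    by split => //; move: x0 x1; lra.
  by rewrite ltr_wpDl.
apply: (@le_lt_trans _ _ (16 * pi * M ^+ 2)%:E); last exact: ltry.
apply: hausdorff2_leP => d d0.
(* [N] is so large that grid cells of side [h] have diameter at most [2 * h <= d]. *)
pose N := (Num.trunc (4 * M / d)).+1; pose h : R := (2 * M / N%:R)%R.
have N0 : (0 < N%:R :> R)%R by rewrite ltr0n.
have h0 : (0 < h)%R by rewrite divr_gt0// mulr_gt0.
have hd : (2 * h <= d)%R.
  have : (4 * M / d < N%:R)%R.
    have MD : (0 <= 4 * M / d)%R by rewrite divr_ge0 ?mulr_ge0 ?ltW.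
    by have /andP[] := truncn_itv MD.
  rewrite ltr_pdivrMr// /h mulrA ler_pdivrMr// => /ltW; congr (_ <= _)%R; ring.
(* One index more than [N], because the coordinate [M] itself falls into the cell of index [N]. *)
pose K := N.+1; pose f (r : R) := Num.trunc ((r + M) / h).
pose U i := [set x | [/\ square M x, f (x 0 0)%R = (i %/ K)%N, f (x 0 1)%R = (i %% K)%N & (i < K * K)%N]].
have fP (r : R) : (`|r| <= M)%R -> (f r < K)%N /\
    ((f r)%:R * h <= r + M < (f r).+1%:R * h)%R.
  rewrite ler_norml => /andP[r1 r2].
  have q0 : (0 <= (r + M) / h)%R by rewrite divr_ge0 ?(ltW h0)//; lra.
  have /andP[t1 t2] := truncn_itv q0.
  rewrite -ler_pdivlMr// -ltr_pdivrMr// t1 t2; split=> //.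
  rewrite ltnS -(ler_nat R); apply: (le_trans t1); rewrite ler_pdivrMr// /h.
  by rewrite mulrCA divff ?mulr1 ?gt_eqF//; lra.
have dU i : ediam (U i) <= (2 * h)%:E.
  apply: ediam_le => [|x y [[x2 x0 x1] fx0 fx1 _] [[y2 y0 y1] fy0 fy1 _]].
    by rewrite lee_fin mulr_ge0// ltW.
  have close (r s : R) : (`|r| <= M)%R -> (`|s| <= M)%R -> f r = f s -> (`|r - s| <= h)%R.
    move=> /fP[_ +] /fP[_ +] frs; rewrite frs -natr1 => /andP[? ?] /andP[? ?].
    by rewrite ler_norml; apply/andP; split; lra.
  rewrite lee_fin; apply: enorm_le_max; first exact: ltW.
  move=> i0; rewrite !mxE; case: (ord3P i0) => ->.
  - by apply: close => //; rewrite fx0 fy0.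
  - by apply: close => //; rewrite fx1 fy1.
  - by rewrite x2 y2 subrr normr0 ltW.
have U0 i : (K * K <= i)%N -> U i = set0.
  by move=> iK; rewrite -subset0 => x [_ _ _]; rewrite ltnNge iK.
apply: (@le_trans _ _ (\sum_(0 <= i <oo) ((pi / 4)%:E * ediam (U i) ^+ 2))).
  apply: ereal_inf_lbound; exists U => //; split=> [x sx|i]; last first.
    by apply: (le_trans (dU i)); rewrite lee_fin.
  have [x2 /fP[fx0 _] /fP[fx1 _]] := sx.
  exists (f (x 0 0)%R * K + f (x 0 1)%R)%N => //; split => //.
  - by rewrite divnMDl// divn_small ?addn0.
  - by rewrite modnMDl modn_small.
  - rewrite (@leq_trans ((f (x 0 0)%R).+1 * K)%N)//; first by rewrite mulSnr ltn_add2l.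
    by rewrite leq_mul2r fx0 orbT.
have p4 : (0 <= pi / 4 :> R)%R by rewrite divr_ge0// pi_ge0.
rewrite (nneseries_split 0 (K * K)); last first.
  by move=> i _; rewrite mule_ge0 ?expe_ge0 ?ediam_ge0// lee_fin.
rewrite add0n [X in _ + X]eseries0 ?adde0; last first.
  by move=> i Ki _; rewrite U0// ediam0 expe2 mule0 mule0.
apply: (@le_trans _ _ (\sum_(0 <= i < K * K) (pi * h ^+ 2)%:E)).
  apply: lee_sum => i _.
  apply: (@le_trans _ _ ((pi / 4)%:E * ((2 * h)%:E * (2 * h)%:E))).
    apply: lee_wpmul2l; first by rewrite lee_fin.
    by rewrite expe2; apply: lee_pmul; rewrite ?ediam_ge0.
  by rewrite -!EFinM lee_fin le_eqVlt; apply/orP; left; apply/eqP; field.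
rewrite sumEFin sumr_const_nat subn0 lee_fin.
have KN : (K%:R <= 2 * N%:R :> R)%R by rewrite -natrM ler_nat mul2n -addnn /K -addn1 leq_add2l.
have hN : (h * N%:R = 2 * M)%R by rewrite /h divfK// gt_eqF.
have : (h * K%:R <= 4 * M)%R by move: h0; nra.
move=> hK; rewrite -[leLHS]mulr_natr natrM.
have := mulr_ge0 (ltW h0) (ler0n R K); have := pi_ge0 R.
set a := (h * K%:R)%R in hK *; move=> pi0 a0.
rewrite (_ : pi * h ^+ 2 * _ = pi * a ^+ 2)%R; last by rewrite /a; ring.
rewrite (_ : 16 * pi * M ^+ 2 = pi * (4 * M) ^+ 2)%R; last by ring.
by rewrite ler_wpM2l// ler_pXn2r ?nnegrE ?(le_trans a0).
Qed.

Let mkrow (a b : R) : V := \row_i [:: a; b; 0%R]`_i.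

(** A unit normal has a coordinate of absolute value at least 1 / 2. Among the points sharing this
    coordinate and its sign, the normal inequalities bound the difference in that coordinate by the
    differences in the other two, so these points are a Lipschitz image of a part of a square. *)
Lemma hausdorff2_supported_fin E (M : R) : (forall x, E x -> (enorm x <= M)%R) ->
  (forall x, E x -> exists2 n, enorm n = 1%R & forall y, E y -> (dot n (y - x) <= 0)%R) ->
  H2 E < +oo.
Proof.
move=> EM En.
pose G (i : 'I_3) (sg : R) := [set x | E x /\ exists n,
  [/\ enorm n = 1%R, (1 / 2 <= sg * n 0 i)%R & forall y, E y -> (dot n (y - x) <= 0)%R]].
have finG i j k sg : (`|sg| = 1)%R ->
    (forall u v : V, dot u v = u 0 i * v 0 i + u 0 j * v 0 j + u 0 k * v 0 k)%R ->
    (forall a, [\/ a = i, a = j | a = k]) -> H2 (G i sg) < +oo.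
  move=> sg1 dijk aijk; have sq := hausdorff2_square_fin M.
  apply: (@le_lt_trans _ _ ((8 ^+ 2)%:E * H2 (square M))); last first.
    by rewrite lte_mul_pinfty.
  apply: (hausdorff2_rel_lip (rel := fun y x => y = mkrow (x 0 j)%R (x 0 k)%R)) => //.
    move=> x [Ex _]; exists (mkrow (x 0 j)%R (x 0 k)%R) => //.
    by split; rewrite /mkrow mxE//= (le_trans (coord_le_enorm _ _)) ?EM.
  move=> _ _ x x' -> -> [Ex [n [n1 ni Hn]]] [Ex' [n' [n'1 n'i Hn']]].
  have a1 := coord_le_enorm (mkrow (x 0 j) (x 0 k) - mkrow (x' 0 j) (x' 0 k))%R 0%R.
  have a2 := coord_le_enorm (mkrow (x 0 j) (x 0 k) - mkrow (x' 0 j) (x' 0 k))%R 1%R.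
  set e := enorm (mkrow _ _ - _) in a1 a2 *.
  rewrite !mxE /= in a1 a2.
  have h1 := Hn _ Ex'; have h2 := Hn' _ Ex.
  have bnd (m : V) a : enorm m = 1%R -> (`|m 0 a| <= 1)%R.
    by move=> m1; rewrite -m1 coord_le_enorm.
  have [bj bk bj' bk'] := And4 (bnd n j n1) (bnd n k n1) (bnd n' j n'1) (bnd n' k n'1).
  rewrite !dijk !mxE in h1 h2.
  have di : (`|x 0 i - x' 0 i| <= 4 * e)%R.
    move: a1 a2 bj bk bj' bk' ni n'i h1 h2 sg1.
    move: (x 0 i)%R (x' 0 i)%R (x 0 j)%R (x' 0 j)%R (x 0 k)%R (x' 0 k)%R => xi xi' xj xj' xk xk'.
    move: (n 0 i)%R (n 0 j)%R (n 0 k)%R (n' 0 i)%R (n' 0 j)%R (n' 0 k)%R => ni nj nk ni' nj' nk'.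
    move=> a1 a2 bj bk bj' bk' hi hi' h1 h2 sg1.
    have pr (a b : R) : (`|a| <= 1)%R -> (`|b| <= e)%R -> (- e <= a * b <= e)%R.
      move=> ha hb; rewrite -ler_norml normrM; apply: le_trans hb.
      by rewrite ler_piMl.
    have a1' : (`|xj' - xj| <= e)%R by rewrite distrC.
    have a2' : (`|xk' - xk| <= e)%R by rewrite distrC.
    have /andP[? ?] := pr _ _ bj a1'; have /andP[? ?] := pr _ _ bk a2'.
    have /andP[? ?] := pr _ _ bj' a1; have /andP[? ?] := pr _ _ bk' a2.
    have sgE : sg = 1%R \/ sg = (-1)%R.
      move: sg1; case: (ger0P sg) => _ h; [by left|by right; rewrite -h opprK].
    rewrite ler_norml; case: sgE hi hi' => ->; rewrite ?mul1r ?mulN1r => hi hi'.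
      by apply/andP; split; nra.
    by apply/andP; split; nra.
  have e0 : (0 <= e)%R by exact: enorm_ge0.
  rewrite (_ : 8 = 2 * 4)%R; last by ring.
  rewrite -mulrA; apply: enorm_le_max; first by rewrite mulr_ge0.
  by move=> a; rewrite !mxE; case: (aijk a) => -> //; lra.
have sub : E `<=` (((G 0%R 1%R `|` G 0%R (-1)%R) `|` (G 1%R 1%R `|` G 1%R (-1)%R))
    `|` (G 2%R 1%R `|` G 2%R (-1)%R)).
  move=> x Ex; have [n n1 Hn] := En _ Ex.
  have : exists i, (1 / 2 <= `|n 0 i|)%R.
    apply: contrapT => /forallNP nn; have lt i : (n 0 i ^+ 2 < 1 / 4)%R.
      have /negP := nn i; rewrite -ltNge => h.
      rewrite -real_normK ?num_real// expr2.
      by have := normr_ge0 (n 0 i)%R; nra.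
    have := sqr_enorm n; rewrite n1 expr1n dotE -!expr2.
    by have := lt 0%R; have := lt 1%R; have := lt 2%R; lra.
  move=> [i]; have wit sg : (1 / 2 <= sg * n 0 i)%R -> G i sg x.
    by move=> hs; split => //; exists n.
  case: (ger0P (n 0 i)%R) => _ hi.
    have hi' : (1 / 2 <= 1 * n 0 i)%R by rewrite [leRHS]mul1r.
    case: (ord3P i) => ei; rewrite ei in wit hi'.
    - by left; left; left; exact: wit.
    - by left; right; left; exact: wit.
    - by right; left; exact: wit.
  have hi' : (1 / 2 <= -1 * n 0 i)%R by rewrite [leRHS]mulN1r.
  case: (ord3P i) => ei; rewrite ei in wit hi'.
  - by left; left; right; exact: wit.
  - by left; right; right; exact: wit.
  - by right; right; exact: wit.
apply: (le_lt_trans (le_hausdorff2 sub)).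
have U2 A B : H2 A < +oo -> H2 B < +oo -> H2 (A `|` B) < +oo.
  by move=> hA hB; apply: le_lt_trans (outer_measureU2 H2 A B) _; exact: lte_add_pinfty.
have o3 (P : 'I_3 -> Prop) : P 0%R -> P 1%R -> P 2%R -> forall a, P a.
  by move=> ? ? ? a; case: (ord3P a) => ->.
have finGs i j k : (forall u v : V, dot u v = u 0 i * v 0 i + u 0 j * v 0 j + u 0 k * v 0 k)%R ->
    (forall a, [\/ a = i, a = j | a = k]) -> H2 (G i 1%R `|` G i (-1)%R) < +oo.
  by move=> d c; apply: (U2); apply: (finG i j k) => //; rewrite ?normrN1 ?normr1.
apply: (U2); first apply: (U2).
- apply: (finGs 0%R 1%R 2%R) => [u v|]; first exact: dotE.
  by apply: (o3); [constructor 1|constructor 2|constructor 3].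
- apply: (finGs 1%R 0%R 2%R) => [u v|]; first by rewrite dotE; ring.
  by apply: (o3); [constructor 2|constructor 1|constructor 3].
- apply: (finGs 2%R 0%R 1%R) => [u v|]; first by rewrite dotE; ring.
  by apply: (o3); [constructor 2|constructor 3|constructor 1].
Qed.

(** A cover of [E] by sets of diameter [r i] yields a cover of the unit square by rectangles of
    sides [2 * L * r i]; if [E] were null, their total Lebesgue measure could be less than 1. *)
Lemma hausdorff2_pos E (g1 g2 : V -> R) (L : R) : (0 < L)%R ->
  (forall x y, E x -> E y -> (`|g1 x - g1 y| <= L * enorm (x - y))%R) ->
  (forall x y, E x -> E y -> (`|g2 x - g2 y| <= L * enorm (x - y))%R) ->
  (forall a b, (0 <= a <= 1)%R -> (0 <= b <= 1)%R ->
     exists x, [/\ E x, g1 x = a & g2 x = b]) ->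
  0 < H2 E.
Proof.
move=> L0 lip1 lip2 onto; rewrite lt_neqAle hausdorff2_ge0 andbT eq_sym.
apply/eqP => H0; have pi0 : (0 < pi / 4 :> R)%R by rewrite divr_gt0// pi_gt0.
(* Covers of total cost less than [c] give rectangles of total area less than 1. *)
pose c : R := (pi / 4 / (4 * L ^+ 2))%R.
have c0 : (0 < c)%R by rewrite divr_gt0// mulr_gt0// exprn_gt0.
have : hausdorff2_pre 1 E < c%:E.
  by apply: le_lt_trans (hausdorff2_pre_le E ltr01) _; rewrite H0 lte_fin.
move=> /ereal_inf_lt[_ [U [EU U1] <-]].
pose r i : R := fine (ediam (U i)).
have rE i : ediam (U i) = (r i)%:E.
  by rewrite fineK// ge0_fin_numE ?ediam_ge0// (le_lt_trans (U1 i))// ltry.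
have r0 i : (0 <= r i)%R by rewrite -lee_fin -rE ediam_ge0.
pose W i := U i `&` E.
pose rect i : set (measurableTypeR R * measurableTypeR R) :=
  if pselect (W i !=set0) is left w then
    [set` `[g1 (projT1 (cid w)) - L * r i, g1 (projT1 (cid w)) + L * r i]%R] `*`
    [set` `[g2 (projT1 (cid w)) - L * r i, g2 (projT1 (cid w)) + L * r i]%R]
  else set0.
pose leb := (@lebesgue_measure R \x @lebesgue_measure R)%E.
have mrect i : measurable (rect i).
  by rewrite /rect; case: pselect => // w; apply: measurableX; exact: measurable_itv.
have unit_itv : lebesgue_measure [set` `[0%R, 1%R]] = 1 :> \bar R.
  by rewrite lebesgue_measure_itv /= lte_fin ltr01 oppr0 adde0.
have lebrect i : leb (rect i) <= (4 * L ^+ 2 * r i ^+ 2)%:E.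
  rewrite /rect; case: pselect => [w|?]; last first.
    by rewrite /leb measure0 lee_fin !mulr_ge0 ?exprn_ge0// ltW.
  rewrite /leb product_measure1E; try exact: measurable_itv.
  set x := projT1 _.
  have li (t : R) : lebesgue_measure [set` `[t - L * r i, t + L * r i]%R] <= (2 * L * r i)%:E.
    rewrite lebesgue_measure_itv /= lte_fin; case: ifPn => _; last first.
      by rewrite lee_fin !mulr_ge0// ltW.
    by rewrite -EFinB lee_fin; lra.
  apply: (le_trans (lee_pmul _ _ (li _) (li _))) => //.
  by rewrite -EFinM lee_fin le_eqVlt; apply/orP; left; apply/eqP; ring.
pose sq : set (measurableTypeR R * measurableTypeR R) :=
  [set` `[0%R, 1%R]] `*` [set` `[0%R, 1%R]].
have cover : sq `<=` \bigcup_i rect i.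
  move=> [a b] [/=]; rewrite !in_itv /= => a01 b01.
  have [x [Ex g1x g2x]] := onto a b a01 b01.
  have [i _ Ux] := EU _ Ex; exists i => //; rewrite /rect.
  case: pselect => [w|[]]; last by exists x.
  have [Uy Ey] := projT2 (cid w); set y := projT1 (cid w) in Uy Ey *.
  have xy : (enorm (x - y) <= r i)%R by rewrite -lee_fin -rE ediam_ge.
  have := lip1 _ _ Ex Ey; have := lip2 _ _ Ex Ey.
  rewrite g1x g2x !ler_norml => /andP[? ?] /andP[? ?].
  have : (L * enorm (x - y) <= L * r i)%R by rewrite ler_pM2l.
  by move=> ?; split; rewrite /= in_itv /=; apply/andP; split; lra.
have mA : measurable sq by apply: measurableX; exact: measurable_itv.
have lsq : leb sq = 1.
  rewrite /leb /sq product_measure1E; try exact: measurable_itv.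
  by rewrite /= !unit_itv mule1.
have le1 : 1 <= \sum_(0 <= i <oo) leb (rect i).
  by rewrite -lsq; exact: measure_sigma_subadditive.
suff : \sum_(0 <= i <oo) leb (rect i) <= (4 * L ^+ 2 / (pi / 4))%:E *
    \sum_(0 <= i <oo) ((pi / 4)%:E * ediam (U i) ^+ 2).
  move=> /(le_trans le1) le2 sc.
  have : (1 : \bar R) < (4 * L ^+ 2 / (pi / 4))%:E * c%:E.
    apply: (le_lt_trans le2); have k0 : (0 < 4 * L ^+ 2 / (pi / 4))%R.
      by rewrite divr_gt0// mulr_gt0// exprn_gt0.
    by rewrite lte_pmul2l ?lte_fin ?fin_numE//; exact: sc.
  have L20 : (0 < 4 * L ^+ 2)%R by rewrite mulr_gt0// exprn_gt0.
  by rewrite -EFinM /c mulrA divfK ?gt_eqF// divff ?gt_eqF// ltxx.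
rewrite -nneseriesZl; last first.
  by move=> i _; rewrite mule_ge0 ?expe_ge0 ?ediam_ge0// lee_fin ltW.
apply: lee_nneseries => [i _ _//|i _].
apply: (le_trans (lebrect i)); rewrite rE -EFin_expe -!EFinM lee_fin.
by rewrite mulrA divfK ?gt_eqF.
Qed.

End hausdorff_estimates.

(** * Normals of a convex body; its singular points *)

Section normal_pairs.
Context {R : realType}.
Local Notation V := 'rV[R]_3.
Local Notation H2 := (@hausdorff2 R).
Implicit Types (x y n m : V) (A C D : set V).

Definition normal_preimage C A := [set x | exists2 n, A n & normal C x n].

(** The tolerance [eta] makes room for the normals of bodies close to [C]; [eta = 0] gives the graph
    of the normal correspondence over [A]. *)
Definition near_normal_pairs C A (eta : R) : set (V * V) :=
  [set p | A p.2 /\ [/\ C p.1, enorm p.2 = 1 & forall y, C y -> dot p.2 (y - p.1) <= eta]].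

Definition normal_pairs C A := near_normal_pairs C A 0.

Lemma near_normal_pairs_compact C A eta : convex_body C -> closed A ->
  compact (near_normal_pairs C A eta).
Proof.
move=> hC cA; have [_ kC _] := hC.
apply: (@subclosed_compact _ _ (C `*` [set n : V | enorm n = 1])); last 2 first.
- by apply: compact_setX => //; exact: sphere_compact.
- by move=> [x n] [/= _ [Cx n1 _]].
have c1 (f : V * V -> V) : continuous f -> continuous (fun p => enorm (f p)).
  by move=> cf p; apply: (@continuous_comp _ _ _ f (@enorm R)); [exact: cf|exact: continuous_enorm].
rewrite (_ : near_normal_pairs C A eta = [set p | A p.2] `&` [set p | C p.1] `&`
   [set p | enorm p.2 = 1] `&` \bigcap_(y in C) [set p | dot p.2 (y - p.1) <= eta]); last first.
  apply/seteqP; split=> [[x n] [/= An [Cx n1 H]]|[x n] [[[/= An Cx] n1] H]]; split=> //.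
have c2 : continuous (snd : V * V -> V) by move=> p; exact: cvg_snd.
have cf : continuous (fst : V * V -> V) by move=> p; exact: cvg_fst.
apply: closedI; [apply: closedI; [apply: closedI|]|].
- by apply: (@closed_comp _ _ snd) => // p _; exact: c2.
- by apply: (@closed_comp _ _ fst) => [p _|]; [exact: cf|exact: body_closed].
- apply: (@closed_comp _ _ (fun p : V * V => enorm p.2) [set 1]) => [p _|].
    exact: (c1 snd).
  exact: closed_eq.
- apply: closed_bigI => y Cy.
  apply: (@closed_comp _ _ (fun p : V * V => dot p.2 (y - p.1)) [set r | r <= eta]) => [p _|].
    apply: continuous_dot; first exact: c2.
    by apply: (@cvgB _ _ _ (nbhs p)); [exact: cvg_cst|exact: cf].
  exact: closed_le.
Qed.

Lemma normal_pairs_image_compact C A (f : V * V -> V) : convex_body C -> closed A ->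
  continuous f -> compact (f @` normal_pairs C A).
Proof.
move=> hC cA cf; apply: continuous_compact; last exact: near_normal_pairs_compact.
by apply: continuous_subspaceT.
Qed.

Lemma normal_preimage_compact C A : convex_body C -> closed A ->
  compact (normal_preimage C A).
Proof.
move=> hC cA; rewrite (_ : normal_preimage C A = fst @` normal_pairs C A).
  by apply: normal_pairs_image_compact => // p; exact: cvg_fst.
apply/seteqP; split=> [x [n An nn]|_ [[x n] [/= An nn] <-]]; last by exists n.
by exists (x, n).
Qed.

Lemma compact_caratheodory A : compact A -> H2.-caratheodory A.
Proof. by move=> /compact_is_closed; exact: hausdorff2_closed_caratheodory. Qed.

Lemma normal_preimage_boundary C A : convex_body C -> normal_preimage C A `<=` boundary C.
Proof. by move=> hC x [n _ nn]; apply/boundary_bodyP => //; exists n. Qed.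

Lemma normal_preimageT C : convex_body C -> normal_preimage C setT = boundary C.
Proof.
move=> hC; apply/seteqP; split; first exact: normal_preimage_boundary.
by move=> x /(boundary_bodyP _ hC)[n nn]; exists n.
Qed.

Lemma boundary_fin C : convex_body C -> (H2 (boundary C) < +oo)%E.
Proof.
move=> hC; have [M M0 bM] := body_bounded hC.
apply: (@hausdorff2_supported_fin _ _ M) => x.
  by move=> /(boundary_bodyP _ hC)[n [Cx _ _]]; exact: bM.
move=> /(boundary_bodyP _ hC)[n [Cx n1 H]]; exists n => // y.
by move=> /(boundary_bodyP _ hC)[m [Cy _ _]]; exact: H.
Qed.

Lemma normal_preimage_fin C A : convex_body C -> (H2 (normal_preimage C A) < +oo)%E.
Proof.
move=> hC; apply: le_lt_trans (boundary_fin hC).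
by apply: le_hausdorff2; exact: normal_preimage_boundary.
Qed.

(** The point of [C] nearest to [x + a *: n] is [x], and projection onto a convex set does not
    increase distances. *)
Lemma normal_monotone C x y n m (a b : R) : 0 <= a -> 0 <= b ->
  normal C x n -> normal C y m ->
  enorm (x - y) <= enorm (x + a *: n - (y + b *: m)).
Proof.
move=> a0 b0 [Cx n1 Hn] [Cy m1 Hm]; rewrite enorm_le_dot.
have := mulr_ge0_le0 a0 (Hn _ Cy); have := mulr_ge0_le0 b0 (Hm _ Cx).
set w := a *: n - b *: m; have -> : x + a *: n - (y + b *: m) = (x - y) + w.
  by rewrite /w; vring.
have := dot_ge0 w.
have -> : dot (x - y + w) (x - y + w) = dot (x - y) (x - y) + dot w w
   - (a * dot n (y - x) + b * dot m (x - y)) *+ 2.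
  by rewrite /w !dotE !mxE; ring.
lra.
Qed.

Definition singular C := [set x | exists n m, [/\ normal C x n, normal C x m & n != m]].

(** An interior point [z] has [dot u (z - x) < 0] for every normal [u] at [x], so the segment
    joining two normals avoids 0 and can be normalized. *)
Lemma normal_segment C x n m (t : R) : convex_body C -> normal C x n -> normal C x m ->
  0 <= t -> t <= 1 ->
  n + t *: (m - n) != 0 /\
  normal C x ((enorm (n + t *: (m - n)))^-1 *: (n + t *: (m - n))).
Proof.
move=> hC [Cx n1 Hn] [_ m1 Hm] t0 t1; have [z [r [r0 br]]] := body_ball hC.
have Cz : C z by apply: br; rewrite subrr enorm0 ltW.
have lin u : dot (n + t *: (m - n)) u = (1 - t) * dot n u + t * dot m u.
  by rewrite !dotE !mxE; ring.
have nz u : normal C x u -> dot u (z - x) < 0.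
  move=> nu; have := normal_supp hC nu; have [_ u1 _] := nu.
  have := supp_ball u hC r0 br; rewrite u1 mulr1 dotDr dotNr; lra.
have w0 : n + t *: (m - n) != 0.
  apply/eqP => w0; have := lin (z - x); rewrite w0 dot0l.
  have := nz n (And3 Cx n1 Hn); have := nz m (And3 Cx m1 Hm).
  move: (dot n _) (dot m _) => c d c0 d0 e.
  have [cd|dc] := leP c d.
    have : 0 <= (1 - t) * (d - c) by apply: mulr_ge0; lra.
    by lra.
  have : 0 <= t * (c - d) by apply: mulr_ge0; lra.
  by lra.
split=> //; split=> //; first exact: enorm_normalize.
move=> y Cy; rewrite dotZl lin mulr_ge0_le0 ?invr_ge0 ?enorm_ge0//.
have t1' : 0 <= 1 - t by lra.
by have := lerD (mulr_ge0_le0 t1' (Hn _ Cy)) (mulr_ge0_le0 t0 (Hm _ Cy)); rewrite addr0.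
Qed.

Local Open Scope ereal_scope.

Let between C (i : 'I_3) (a b : R) := [set x | exists n m,
  [/\ normal C x n, normal C x m, (n 0 i <= a)%R & (b <= m 0 i)%R]].

(* The sets [{x + n : n normal at x, n_i = c}] are disjoint for distinct [c],
   lie on a set of finite area, and each of them projects onto [between]. *)
Let between_null C i (a b : R) : convex_body C -> (a < b)%R -> H2 (between C i a b) = 0.
Proof.
move=> hC ab; have [M M0 bM] := body_bounded hC.
pose Y (c : R) := (fun p : V * V => p.1 + p.2)%R @` normal_pairs C [set n : V | n 0 i = c]%R.
pose Z := (fun p : V * V => p.1 + p.2)%R @` normal_pairs C setT.
have YP (c : R) : compact (Y c).
  apply: normal_pairs_image_compact => //.
    apply: (@closed_comp _ _ (fun u : V => u 0 i)%R [set c]) => [u _|]; last exact: closed_eq.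
    exact: continuous_coord.
  move=> p; apply: (@cvgD _ _ _ (nbhs p)); [exact: cvg_fst|exact: cvg_snd].
have finZ : H2 Z < +oo.
  apply: (@hausdorff2_supported_fin _ _ (M + 1)%R).
    move=> _ [[x n] [_ /= [Cx n1 _]] <-]; apply: (le_trans (enormD _ _)).
    by rewrite n1 lerD2r bM.
  move=> _ [[x n] [_ /= [Cx n1 Hn]] <-]; exists n => // _ [[y m] [_ /= [Cy m1 _]] <-].
  have -> : dot n (y + m - (x + n)) = (dot n (y - x) + (dot n m - enorm n ^+ 2))%R.
    by rewrite sqr_enorm !dotE !mxE; ring.
  have := Hn _ Cy; have := dot_le n m; rewrite n1 m1; lra.
have subY (c : R) : (a <= c <= b)%R -> H2 (between C i a b) <= H2 (Y c).
  move=> /andP[ac cb]; rewrite -[leRHS]mul1e -(expr1n _ 2).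
  apply: (hausdorff2_rel_lip (rel := fun y x => exists2 n, normal C x n & y = x + n)%R) => //.
    move=> x [n [m [nn nm na mb]]].
    (* Once normalized, this segment is a path of normals at [x], whose [i]-th coordinate goes from
       at most [c] to at least [c]. *)
    pose w (t : R) := (n + t *: (m - n))%R.
    have wP (t : R) (t0 : (0 <= t)%R) (t1 : (t <= 1)%R) := normal_segment hC nn nm t0 t1.
    pose f (t : R) := (w t 0 i / enorm (w t))%R.
    have cf : {within `[0%R, 1%R], continuous f}.
      apply: continuous_in_subspaceT => t; rewrite inE /= in_itv /= => /andP[t0 t1].
      have cw : {for t, continuous w}.
        apply: (@cvgD _ _ _ (nbhs t)); first exact: cvg_cst.
        by apply: (cvgZ (s := idfun) (f := fun=> (m - n)%R)); [exact: cvg_id|exact: cvg_cst].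
      apply: (@cvgM _ _ (nbhs t)).
        apply: (@continuous_comp _ _ _ w (fun u : V => u 0 i)%R) => //.
        exact: continuous_coord.
      apply: (@cvgV _ _ (nbhs t)); first by rewrite enorm_eq0; have [] := wP t t0 t1.
      apply: (@continuous_comp _ _ _ w (@enorm R)) => //; exact: continuous_enorm.
    have f0 : f 0%R = n 0%R i.
      by rewrite /f /w scale0r addr0; have [_ -> _] := nn; rewrite divr1.
    have f1 : f 1%R = m 0%R i.
      by rewrite /f /w scale1r addrCA subrr addr0; have [_ -> _] := nm; rewrite divr1.
    have [|t] := @IVT R f 0%R 1%R c ler01 cf.
      rewrite f0 f1 ge_min le_max; apply/andP; split.
        by rewrite (le_trans na ac).
      by rewrite (le_trans cb mb) orbT.
    rewrite in_itv /= => /andP[t0 t1] ft; have [w0 nw] := wP t t0 t1.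
    set u := (_ *: _)%R in nw; exists (x + u)%R; last by exists u.
    exists (x, u) => //; split => //=; rewrite -ft /f /u mxE mulrC.
    by [].
  move=> _ _ x x' [n nn ->] [m nm ->] _ _; rewrite mul1r.
  by have := normal_monotone ler01 ler01 nn nm; rewrite !scale1r.
have disj (c c' : R) y : Y c y -> Y c' y -> c = c'.
  move=> [[x n] [/= nc nn] <-] [[x' n'] [/= nc' nn']] e.
  have := normal_monotone ler01 ler01 nn nn'; rewrite !scale1r e subrr enorm0.
  rewrite le_eqVlt ltNge enorm_ge0 orbF enorm_eq0 subr_eq0 => /eqP xx.
  by move: e; rewrite xx => /addrI en; rewrite -nc -nc' en.
pose c (m j : nat) : R := (a + (b - a) * (j%:R / m.+1%:R))%R.
have cab (m j : nat) : (j <= m)%N -> (a <= c m j <= b)%R.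
  move=> jm; have [q0 q1] : (0 <= j%:R / m.+1%:R :> R)%R /\ (j%:R / m.+1%:R <= 1 :> R)%R.
    by rewrite divr_ge0// ler_pdivrMr// mul1r ler_nat leqW.
  have ba : (0 <= b - a)%R by rewrite subr_ge0 ltW.
  rewrite /c; move: (_ / _)%R q0 q1 => q q0 q1.
  have := mulr_ge0 ba q0; have : (0 <= (b - a) * (1 - q))%R by rewrite mulr_ge0// subr_ge0.
  by move=> h1 h2; apply/andP; split; lra.
have bound (m : nat) : \sum_(j < m) H2 (between C i a b) <= H2 Z.
  apply: (@le_trans _ _ (\sum_(j < m) H2 (Y (c m j)))).
    by apply: lee_sum => j _; apply: subY; rewrite cab// ltnW.
  have Yd : trivIset setT (fun j => Y (c m j)).
    apply/trivIsetP => j k _ _ jk; rewrite -subset0 => y [/disj h /h].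
    move=> /addrI /mulfI; rewrite subr_eq0 gt_eqF// => /(_ isT) /divIf.
    by rewrite pnatr_eq0 => /(_ isT) /eqP; rewrite eqr_nat (negbTE jk).
  have := caratheodory_additive (mu := H2) (fun j => compact_caratheodory (YP (c m j))) Yd m setT.
  rewrite setTI (eq_bigr (fun j : 'I_m => H2 (Y (c m j)))).
  2: by move=> j _; rewrite setTI.
  move=> <-; apply: le_outer_measure; rewrite -(bigcup_mkord m (fun j => Y (c m j))) => y [j _ [p [_ np] <-]].
  by exists p.
apply/eqP; rewrite eq_le hausdorff2_ge0 andbT leNgt; apply/negP => s0.
have sfin : H2 (between C i a b) \is a fin_num.
  rewrite ge0_fin_numE ?hausdorff2_ge0//; apply: le_lt_trans finZ.
  by have := bound 1%N; rewrite big_ord_recl big_ord0 adde0.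
have zfin : H2 Z \is a fin_num by rewrite ge0_fin_numE ?hausdorff2_ge0.
move: s0 bound; rewrite -(fineK sfin) -(fineK zfin) lte_fin.
move: (fine _) (fine _) => h s s0 bound.
have := bound (Num.trunc (h / s)).+1.
rewrite sumEFin lee_fin sumr_const card_ord => bnd.
have h0 : (0 <= h)%R by apply: (le_trans _ bnd); rewrite mulrn_wge0// ltW.
have /andP[_] := truncn_itv (divr_ge0 h0 (ltW s0)).
by rewrite ltr_pdivrMr// mulr_natl ltNge bnd.
Qed.

(** Two distinct normals at a point differ in some coordinate, and two rationals fit between its
    values; so countably many null sets [between] cover the singular points. *)
Lemma hausdorff2_singular C : convex_body C -> H2 (singular C) = 0.
Proof.
move=> hC; pose F k := if unpickle k is Some (i, a, b) then
  (if ratr a < ratr b :> R then between C i (ratr a) (ratr b) else set0)%R else set0.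
apply/eqP; rewrite eq_le hausdorff2_ge0 andbT.
apply: (@le_trans _ _ (H2 (\bigcup_k F k))).
  apply: le_hausdorff2 => x [n [m [nn nm nm0]]].
  have [i im] : exists i, n 0%R i != m 0%R i.
    apply: contrapT => /forallNP h; move/eqP: nm0; apply; apply/rowP => i.
    by apply/eqP; apply: contrapT => /negP; exact: h.
  wlog lt : n m nn nm nm0 im / (n 0 i < m 0 i)%R.
    move=> H; case: (ltgtP (n 0%R i) (m 0%R i)) im => // lt _.
      by apply: (H n m) => //; rewrite lt_eqF.
    by apply: (H m n) => //; rewrite ?lt_eqF// eq_sym.
  have [a] := rat_in_itvoo lt; rewrite in_itv /= => /andP[na am].
  have [b] := rat_in_itvoo am; rewrite in_itv /= => /andP[ab bm].
  exists (pickle (i, a, b)) => //; rewrite /F pickleK ab.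
  by exists n, m; split => //; exact: ltW.
apply: (le_trans (outer_measure_sigma_subadditive H2 F)).
rewrite eseries0// => k _ _; rewrite /F; case: unpickle => [[[i a] b]|]; last exact: outer_measure0.
by case: ifPn => ab; [exact: between_null|exact: outer_measure0].
Qed.

End normal_pairs.

(** * The surface measure as a finite Borel measure on the sphere *)

Section surface_measure_theory.
Context {R : realType}.
Local Notation V := 'rV[R]_3.
Local Notation H2 := (@hausdorff2 R).
Implicit Types (x y n m : V) (C D : set V) (A : set (S2 R)).

Definition unit_S2 n (n1 : enorm n = 1) : S2 R :=
  exist (fun n => n \in sphere R) n (mem_set n1).

Lemma S2_unit (n : S2 R) : enorm (set_val n : V) = 1.
Proof. by have := set_valP n. Qed.

Lemma normal_outer C x (n : S2 R) : C x ->
  normal C x (set_val n) <-> outer_unit_normal C x n.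
Proof.
by move=> Cx; split=> [[_ _ H]//|H]; split=> //; exact: S2_unit.
Qed.

Definition regular_preimage C A := [set xi | regular_point C xi /\
  exists2 n, outer_unit_normal C xi n & A n].

Lemma regular_preimageE C A : convex_body C ->
  regular_preimage C A = normal_preimage C (set_val @` A) `\` singular C.
Proof.
move=> hC; have bC x : boundary C x -> C x by case=> /(body_closed hC).
apply/seteqP; split=> [x [[bx [n [_ nu]]] [m mx Am]]|x [[_ [n An <-]] nx] ns].
  have Cx := bC _ bx; split; first by exists (set_val m); [exists m|apply/normal_outer].
  move=> [u [w [ux wx /eqP]]]; apply.
  have [_ u1 _] := ux; have [_ w1 _] := wx.
  have eu := nu (unit_S2 u1) ((normal_outer (unit_S2 u1) Cx).1 ux).
  have ew := nu (unit_S2 w1) ((normal_outer (unit_S2 w1) Cx).1 wx).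
  by rewrite -[u]/(set_val (unit_S2 u1)) -[w]/(set_val (unit_S2 w1)) -eu -ew.
have [Cx _ _] := nx; have nn := (normal_outer n Cx).1 nx.
split; last by exists n.
split; first by apply/boundary_bodyP => //; exists (set_val n).
exists n; split=> // m /(normal_outer m Cx) mx; apply/val_inj.
by apply/eqP; apply: contrapT => /negP nm; apply: ns; exists (set_val n), (set_val m).
Qed.

(** Passing from regular points to all boundary points adds singular points only, a null set; in
    exchange, closed sets of normals get compact preimages. *)
Lemma surface_measureE C A : convex_body C ->
  surface_measure C A = H2 (normal_preimage C (set_val @` A)).
Proof.
move=> hC; rewrite /surface_measure -/(regular_preimage C A) regular_preimageE//.
apply: (outer_measure_null_diff (hausdorff2_singular hC)) => x; first by case=> ?; left.
by move=> Ax; have [|] := pselect (singular C x); [right|left].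
Qed.

Lemma normal_preimage_S2 C D :
  normal_preimage C (set_val @` ((@set_val _ (sphere R)) @^-1` D)) = normal_preimage C D.
Proof.
apply/seteqP; split=> x; first by move=> [_ [n Dn <-] nx]; exists (set_val n).
move=> [n Dn nx]; have [_ n1 _] := nx; exists n => //.
by exists (unit_S2 n1).
Qed.

Lemma surface_measure_fin C A : convex_body C -> (surface_measure C A < +oo)%E.
Proof. by move=> hC; rewrite surface_measureE// normal_preimage_fin. Qed.

Lemma surface_measure_fin_num C A : convex_body C -> surface_measure C A \is a fin_num.
Proof.
by move=> hC; rewrite ge0_fin_numE ?surface_measure_fin// hausdorff2_ge0.
Qed.

(** The sets with measurable preimage form a sigma-algebra containing the closed sets. Regular
    points have a unique normal, so their preimages commute with complements, which those of
    [normal_preimage] do not. *)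
Lemma regular_preimage_caratheodory C A : convex_body C -> measurable A ->
  H2.-caratheodory (regular_preimage C A).
Proof.
move=> hC; have cs : H2.-caratheodory (singular C).
  by apply: caratheodory_null; exact: hausdorff2_singular.
have clo D : closed D -> H2.-caratheodory (regular_preimage C (set_val @^-1` D)).
  move=> cD; rewrite regular_preimageE// normal_preimage_S2.
  by apply: caratheodory_measurable_setD => //; apply: compact_caratheodory; exact: normal_preimage_compact.
have preC B : regular_preimage C (~` B) = regular_preimage C setT `\` regular_preimage C B.
  apply/seteqP; split=> x.
    move=> [rx [n nx Bn]]; split; first by split=> //; exists n.
    move=> [_ [m mx Bm]]; case: rx => _ [u [_ uu]]; apply: Bn.
    by rewrite -(uu _ nx) (uu _ mx).
  move=> [[rx [n nx _]] nB]; split=> //; exists n => // Bn.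
  by apply: nB; split=> //; exists n.
have cT : H2.-caratheodory (regular_preimage C setT).
  by rewrite -(preimage_setT (@set_val _ (sphere R))); exact/clo/closedT.
rewrite /measurable /=; apply: (@smallest_sub _ _ _
   [set B : set (S2 R) | H2.-caratheodory (regular_preimage C B)]).
  split=> [|B cB|F cF].
  - rewrite /= (_ : regular_preimage C set0 = set0); first exact: caratheodory_measurable_set0.
    by rewrite -subset0 => x [_ []].
  - by rewrite setTD /= preC; exact: caratheodory_measurable_setD.
  - rewrite /= (_ : regular_preimage C _ = \bigcup_k regular_preimage C (F k)).
      exact: caratheodory_measurable_bigcup.
    apply/seteqP; split=> x [].
      by move=> rx [n nx [k _ Fn]]; exists k => //; split=> //; exists n.
    by move=> k _ [rx [n nx Fn]]; split=> //; exists n => //; exists k.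
move=> U [W oW <-] /=.
rewrite -[W]setCK -preimage_setC preC; apply: caratheodory_measurable_setD => //.
by apply: clo; exact: open_closedC.
Qed.

(** The convexity proof is an argument so that the measure structures, which depend on it, can be
    attached to this function. *)
Definition surface_fmeasure C (hC : convex_body C) : set (S2 R) -> \bar R := surface_measure C.

Section surface_fmeasure.
Context C (hC : convex_body C).
Local Notation mu := (surface_fmeasure hC).

Let mu0 : mu set0 = 0%E.
Proof.
rewrite /surface_fmeasure surface_measureE// image_set0.
rewrite (_ : normal_preimage C set0 = set0) ?outer_measure0//.
by rewrite -subset0 => x [].
Qed.

Let mu_ge0 A : (0 <= mu A)%E.
Proof. exact: hausdorff2_ge0. Qed.

Let mu_sigma_additive : semi_sigma_additive mu.
Proof.
move=> F mF tF mUF.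
have tP : trivIset setT (fun k => regular_preimage C (F k)).
  apply/trivIsetP => i j _ _ ij; rewrite -subset0 => x [[[_ [u [_ uu]]] [n nx Fn]] [_ [m mx Fm]]].
  have /trivIsetP/(_ i j I I ij) := tF; rewrite -subset0; apply; split; first exact: Fn.
  by rewrite -(uu _ nx) (uu _ mx).
have := @caratheodory_measure_sigma_additive R V H2 (fun k => regular_preimage C (F k))
  (fun k => regular_preimage_caratheodory hC (mF k)) tP.
have -> : \bigcup_n regular_preimage C (F n) = regular_preimage C (\bigcup_n F n).
  apply/seteqP; split=> x; first by move=> [k _ [rx [n nx Fn]]]; split=> //; exists n => //; exists k.
  by move=> [rx [n nx [k _ Fn]]]; exists k => //; split=> //; exists n.
by apply; exact: regular_preimage_caratheodory.
Qed.

HB.instance Definition _ := isMeasure.Build _ (S2 R) R mu mu0 mu_ge0 mu_sigma_additive.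

Let mu_fin : fin_num_fun mu.
Proof. by move=> A mA; exact: surface_measure_fin_num. Qed.

HB.instance Definition _ := Measure_isFinite.Build _ (S2 R) R mu mu_fin.

End surface_fmeasure.

Lemma open_S2_measurable (U : set (sphere R)) : open U -> measurable (U : set (S2 R)).
Proof. by move=> oU; apply: sub_sigma_algebra. Qed.

Lemma measurable_S2_preimage_closed D : closed D ->
  measurable (set_val @^-1` D : set (S2 R)).
Proof.
move=> cD; rewrite -[D]setCK -preimage_setC; apply: measurableC.
by apply: open_S2_measurable; exists (~` D) => //; exact: closed_openC.
Qed.

Local Open Scope ereal_scope.

(** Finite measures that agree on closed sets agree on open sets by taking complements, and the open
    sets are a generating family stable under intersection. *)
Lemma surface_measure_affine C C1 C2 (a b : R) : convex_body C -> convex_body C1 ->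
  convex_body C2 -> (0 <= a)%R -> (0 <= b)%R ->
  (forall D, closed D -> H2 (normal_preimage C D) =
     a%:E * H2 (normal_preimage C1 D) + b%:E * H2 (normal_preimage C2 D)) ->
  forall A, measurable A -> surface_measure C A =
    a%:E * surface_measure C1 A + b%:E * surface_measure C2 A.
Proof.
move=> hC h1 h2 a0 b0 H A mA.
pose m2 := measure_add (mscale (NngNum a0) (surface_fmeasure h1))
  (mscale (NngNum b0) (surface_fmeasure h2)).
have m2E B : m2 B = a%:E * surface_measure C1 B + b%:E * surface_measure C2 B.
  by rewrite /m2 measure_addE.
rewrite -m2E -[LHS]/(surface_fmeasure hC A).
have clE D : closed D -> surface_fmeasure hC (set_val @^-1` D) = m2 (set_val @^-1` D).
  by move=> cD; rewrite m2E /surface_fmeasure !surface_measureE// !normal_preimage_S2 H.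
have TE : surface_fmeasure hC setT = m2 setT.
  by rewrite -(preimage_setT (@set_val _ (sphere R))); exact/clE/closedT.
apply: (@g_sigma_algebra_measure_unique _ R (S2 R) (open : set (set (sphere R)))
   _ (fun=> setT) _ _ (surface_fmeasure hC) m2) => //.
- by move=> U oU; exact: open_S2_measurable.
- by move=> _; exact: openT.
- by rewrite bigcup_const.
- by move=> U W oU oW; exact: openI.
- move=> U [W oW <-].
  have mW : measurable (set_val @^-1` (~` W) : set (S2 R)).
    by apply: measurable_S2_preimage_closed; exact: open_closedC.
  have -> : set_val @^-1` W = setT `\` (set_val @^-1` (~` W)) :> set (S2 R).
    by rewrite setTD preimage_setC setCK.
  rewrite [LHS]measureD// ?setTI//; last exact: surface_measure_fin.
  rewrite [RHS]measureD// ?setTI//.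
  + congr (_ - _); first exact: TE.
    exact: (clE _ (open_closedC oW)).
  + by move: (surface_measure_fin setT hC); rewrite -[X in X < _]/(surface_fmeasure hC setT) TE.
- by move=> _; exact: surface_measure_fin.
Qed.

End surface_measure_theory.

(** * Stretching a convex body from a point *)

Section stretch.
Context {R : realType}.
Local Notation V := 'rV[R]_3.
Local Notation H2 := (@hausdorff2 R).
Implicit Types (x y n m Q : V) (C E A F : set V) (r l : R).

(* The boundary of [stretch Q r E] consists of the part of that of [E] which is not
   visible from [Q], of the homothetic image with ratio [r] of the visible part, and of
   segments of rays from [Q]; [stretch Q 0 E] is the convex hull of [E] and [Q]. *)
Definition stretch Q r E := [set y | exists l x,
  [/\ r <= l, l <= 1, E x & y = Q + l *: (x - Q)]].

Lemma stretchE Q r E : stretch Q r E =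
  (fun p : R * V => Q + p.1 *: (p.2 - Q)) @` ([set` `[r, 1]] `*` E).
Proof.
apply/seteqP; split=> [y [l [x [rl l1 Ex ->]]]|_ [[l x] [/= + Ex] <-]].
  by exists (l, x) => //; split => //=; rewrite in_itv /= rl.
by rewrite in_itv /= => /andP[? ?]; exists l, x.
Qed.

Lemma stretch_compact Q r E : compact E -> compact (stretch Q r E).
Proof.
move=> kE; rewrite stretchE; apply: continuous_compact.
  apply: continuous_subspaceT => p.
  apply: (@cvgD _ _ _ (nbhs p)); first exact: cvg_cst.
  apply: (cvgZ (s := fst) (f := fun p : R * V => p.2 - Q)); first exact: cvg_fst.
  by apply: (@cvgB _ _ _ (nbhs p)); [exact: cvg_snd|exact: cvg_cst].
by apply: compact_setX => //; exact: segment_compact.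
Qed.

Lemma sub_stretch Q r E : r <= 1 -> E `<=` stretch Q r E.
Proof.
by move=> r1 x Ex; exists 1, x; split=> //; rewrite scale1r addrCA subrr addr0.
Qed.

Lemma stretch_body Q r E : 0 <= r -> r <= 1 -> convex_body E -> convex_body (stretch Q r E).
Proof.
move=> r0 r1 hE; have [_ kE [z iz]] := hE; split; last first.
  by exists z; apply: interiorS iz; exact: sub_stretch.
  exact: stretch_compact.
apply/convex_setP => _ _ t t0 t1 [l [x [rl l1 Ex ->]]] [k [y [rk k1 Ey ->]]].
pose j := l + t * (k - l).
have rj : r <= j by rewrite /j; nra.
have j1 : j <= 1 by rewrite /j; nra.
have l0 : 0 <= l by exact: le_trans rl.
have k0 : 0 <= k by exact: le_trans rk.
have tk : 0 <= t * k by exact: mulr_ge0.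
have tl : 0 <= (1 - t) * l by apply: mulr_ge0 => //; lra.
(* [j] can vanish only if both weighted ratios [(1 - t) * l] and [t * k] do, and the combination is
   then [Q]. Otherwise it has ratio [j] and a base point on the segment from [x] to [y]. *)
have [j0|j0] := leP j 0.
  have tk0 : t * k = 0 by rewrite /j in j0; lra.
  have tl0 : (1 - t) * l = 0 by rewrite /j in j0; lra.
  exists j, x; split=> //; apply/rowP => i; rewrite !mxE /j.
  transitivity (Q 0 i + ((1 - t) * l) * (x 0 i - Q 0 i) + (t * k) * (y 0 i - Q 0 i)).
    by ring.
  rewrite (_ : l + t * (k - l) = (1 - t) * l + t * k); last by ring.
  by rewrite tk0 tl0; ring.
exists j, (x + (t * k / j) *: (y - x)); split=> //.
  apply: body_convex => //; first by rewrite divr_ge0// ltW.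
  by rewrite ler_pdivrMr// mul1r /j; lra.
apply/rowP => i; rewrite !mxE.
have -> : j * (x 0 i + t * k / j * (y 0 i - x 0 i) - Q 0 i) =
    j * (x 0 i - Q 0 i) + t * k * (y 0 i - x 0 i) by field; rewrite gt_eqF.
by rewrite /j; ring.
Qed.

(** The maximum of [l * (supp E n - dot n Q)] over [l] in [r, 1] is at an end, determined by the
    sign of the second factor. *)
Lemma supp_stretch Q r E n : 0 <= r -> r <= 1 -> convex_body E ->
  supp (stretch Q r E) n =
  dot n Q + Num.max (supp E n - dot n Q) (r * (supp E n - dot n Q)).
Proof.
move=> r0 r1 hE; have hS := stretch_body Q r0 r1 hE.
apply/eqP; rewrite eq_le; apply/andP; split.
  apply: supp_le => // _ [l [x [rl l1 Ex ->]]].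
  have := supp_ub n hE Ex; rewrite !dotX -lerBlDl => h.
  rewrite (_ : _ - _ = l * (dot n x - dot n Q)); last by ring.
  have l0 : 0 <= l by exact: le_trans rl.
  apply: (@le_trans _ _ (l * (supp E n - dot n Q))); first by rewrite ler_wpM2l// lerD2r.
  rewrite le_max; have [q0|q0] := leP 0 (supp E n - dot n Q).
    by rewrite ler_piMl.
  by rewrite orbC ler_wnM2r// ltW.
have [x Ex xs] := supp_att n hE; rewrite -lerBrDl ge_max; apply/andP; split.
  by rewrite lerD2r -xs supp_ub//; exact: sub_stretch.
have : stretch Q r E (Q + r *: (x - Q)) by exists r, x.
by move=> /(supp_ub n hS); rewrite !dotX xs => h; lra.
Qed.

Lemma normalP C x n : convex_body C ->
  normal C x n <-> [/\ C x, enorm n = 1 & dot n x = supp C n].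
Proof.
move=> hC; split=> [nx|[]]; last exact: supp_normal.
by have [Cx n1 _] := nx; split=> //; exact: normal_supp.
Qed.

Section normals_of_stretch.
Variables (Q : V) (r : R) (E : set V).
Hypotheses (r0 : 0 <= r) (r1 : r <= 1) (hE : convex_body E).
Let hS := stretch_body Q r0 r1 hE.

(** Here [Q] lies strictly on the side of [E], so a ratio less than 1 moves points off the plane of
    support. *)
Lemma normal_stretch_pos y n : 0 < supp E n - dot n Q ->
  normal (stretch Q r E) y n <-> normal E y n.
Proof.
move=> q0; have sS : supp (stretch Q r E) n = supp E n.
  rewrite supp_stretch// max_l; first by rewrite addrC subrK.
  by rewrite ler_piMl// ltW.
rewrite !normalP// sS; split=> [[[l [x [rl l1 Ex ->]]] n1 e]|[Ey n1 e]]; last first.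
  by split=> //; exact: sub_stretch.
suff l1' : l = 1 by move: e; rewrite l1' scale1r addrCA subrr addr0.
have := supp_ub n hE Ex; move: e; rewrite !dotX => e le; apply/eqP.
rewrite eq_le l1 leNgt /=; apply/negP => l1'; have l0 : 0 <= l by exact: le_trans rl.
have : l * (dot n x - dot n Q) <= l * (supp E n - dot n Q) by rewrite ler_wpM2l// lerD2r.
have : l * (supp E n - dot n Q) < 1 * (supp E n - dot n Q) by rewrite ltr_pM2r.
lra.
Qed.

(** Here the plane of support separates [Q] from [E], and the smallest ratio leads farthest in
    direction [n]. *)
Lemma normal_stretch_neg y n : supp E n - dot n Q < 0 ->
  normal (stretch Q r E) y n <-> exists2 x, normal E x n & y = Q + r *: (x - Q).
Proof.
move=> q0; have sS : supp (stretch Q r E) n = dot n Q + r * (supp E n - dot n Q).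
  rewrite supp_stretch// max_r// -subr_ge0.
  rewrite (_ : _ - _ = (1 - r) * - (supp E n - dot n Q)); last by ring.
  by apply: mulr_ge0; rewrite ?subr_ge0// oppr_ge0 subr_le0 -subr_le0 ltW.
rewrite normalP//; split=> [[[l [x [rl l1 Ex ->]]] n1 e]|[x nx ->]]; last first.
  have [Ex n1 _] := nx; have e := normal_supp hE nx.
  by split=> //; [exists r, x|rewrite sS !dotX e; ring].
have := supp_ub n hE Ex; move: e; rewrite sS !dotX => e le.
have e' : l * (dot n x - dot n Q) = r * (supp E n - dot n Q) by lra.
have rl' : l = r.
  apply/eqP; rewrite eq_le rl andbT leNgt; apply/negP => lt.
  have l0 : 0 < l by exact: le_lt_trans lt.
  have : l * (dot n x - dot n Q) <= l * (supp E n - dot n Q) by rewrite ler_pM2l// lerD2r.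
  have : l * (supp E n - dot n Q) < r * (supp E n - dot n Q) by rewrite ltr_nM2r.
  by rewrite e'; lra.
(* For [r = 0] the contact point is [Q], and any point of the face of [E] is a witness. *)
have [r00|rn0] := eqVneq r 0.
  have [x' Ex' e2] := supp_att n hE; exists x'; first exact/normalP.
  by rewrite rl' r00 !scale0r.
exists x; last by rewrite rl'.
apply/normalP => //; split=> //.
by move: e'; rewrite rl' => /(mulfI rn0) /addIr.
Qed.

(** Here the plane of support contains [Q], so homotheties with center [Q] preserve it and every
    ratio occurs. *)
Lemma normal_stretch0 y n : supp E n - dot n Q = 0 ->
  normal (stretch Q r E) y n <->
  exists l x, [/\ r <= l, l <= 1, normal E x n & y = Q + l *: (x - Q)].
Proof.
move=> q0; have sS : supp (stretch Q r E) n = dot n Q.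
  by rewrite supp_stretch// q0 mulr0 maxxx addr0.
rewrite normalP//; split=> [[[l [x [rl l1 Ex ->]]] n1 e]|[l [x [rl l1 nx ->]]]]; last first.
  have [Ex n1 _] := nx; have e := normal_supp hE nx.
  split=> //; first by exists l, x.
  by rewrite sS !dotX e q0 mulr0 addr0.
have [l00|ln0] := eqVneq l 0.
  have [x' Ex' e2] := supp_att n hE; exists l, x'; split=> //; first exact/normalP.
  by rewrite l00 !scale0r.
exists l, x; split=> //; apply/normalP => //; split=> //.
move: e; rewrite sS !dotX => e.
have /(mulfI ln0) : l * (dot n x - dot n Q) = l * 0 by lra.
by lra.
Qed.

End normals_of_stretch.

Local Open Scope ereal_scope.

(** A point with a normal in each of the two sets has two distinct normals, so the overlap is
    singular and hence null. *)
Lemma normal_preimage_additive C A0 A1 : convex_body C -> closed A0 ->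
  A0 `&` A1 = set0 ->
  H2 (normal_preimage C (A0 `|` A1)) = H2 (normal_preimage C A0) + H2 (normal_preimage C A1).
Proof.
move=> hC cA0 A01; have := caratheodory_setUI (mu := H2) (normal_preimage C A1)
  (compact_caratheodory (normal_preimage_compact hC cA0)).
move=> /= <-; rewrite (_ : H2 (_ `&` _) = 0) ?adde0.
  congr H2; apply/seteqP; split=> x.
    by move=> [n [An|An] nx]; [left|right]; exists n.
  by move=> [[n An nx]|[n An nx]]; exists n => //; [left|right].
apply/eqP; rewrite eq_le hausdorff2_ge0 andbT -(hausdorff2_singular hC).
apply: le_hausdorff2 => x [[n An nx] [m Am mx]]; exists n, m; split=> //.
by apply/eqP => e; move: A01; rewrite -subset0 => /(_ n); apply; split=> //; rewrite e.
Qed.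

Lemma ge0_fin_real (a : \bar R) : 0 <= a -> a < +oo -> exists2 s : R, (0 <= s)%R & a = s%:E.
Proof.
move=> a0 aoo; exists (fine a); first exact: fine_ge0.
by rewrite fineK// ge0_fin_numE.
Qed.

(** The normals are split by the sign of [q]. Where [q > 0] all three bodies have the same points;
    where [q < 0] the piece of [E] is scaled by [r], and shrinks to [Q] in the hull; where [q = 0]
    the pieces lie on a cone with apex [Q], whose self-similarity [UU] relates their areas. *)
Lemma hausdorff2_stretch Q r E A : (0 <= r)%R -> (r <= 1)%R -> convex_body E -> closed A ->
  H2 (normal_preimage (stretch Q r E) A) =
  (r ^+ 2)%:E * H2 (normal_preimage E A) +
  (1 - r ^+ 2)%:E * H2 (normal_preimage (stretch Q 0 E) A).
Proof.
move=> r0 r1 hE cA.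
have [->|rn0] := eqVneq r 0%R; first by rewrite expr0n mul0e add0e subr0 mul1e.
have rp : (0 < r)%R by rewrite lt_neqAle eq_sym rn0.
pose q n := (supp E n - dot n Q)%R.
have cq : continuous q.
  move=> n; apply: (@cvgB _ _ _ (nbhs n) _ (supp E) (fun n => dot n Q)).
    exact: continuous_supp.
  by apply: (@continuous_dot _ _ idfun (fun=> Q)); [exact: cvg_id|exact: cst_continuous].
pose Ap := A `&` [set n | 0 < q n]%R.
pose A0 := A `&` [set n | q n = 0]%R.
pose An := A `&` [set n | q n < 0]%R.
have cA0 : closed A0.
  by apply: closedI => //; apply: (@closed_comp _ _ q [set 0%R]) => [n _|]; [exact: cq|exact: closed_eq].
have cAp : closed (A `&` [set n | 0 <= q n]%R).
  apply: closedI => //; apply: (@closed_comp _ _ q [set s | 0 <= s]%R) => [n _|]; [exact: cq|exact: closed_ge].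
have split3 C : convex_body C -> H2 (normal_preimage C A) =
    H2 (normal_preimage C A0) + H2 (normal_preimage C Ap) + H2 (normal_preimage C An).
  move=> hC; rewrite -normal_preimage_additive//; last first.
    by rewrite -subset0 => n [[_ /= e] [_ /=]]; rewrite e ltxx.
  rewrite (_ : A0 `|` Ap = A `&` [set n | 0 <= q n]%R); last first.
    apply/seteqP; split=> n.
      by move=> [[An' /= e]|[An' /= /ltW]]; split=> //=; rewrite e.
    by move=> [An' /=]; rewrite le_eqVlt => /orP[/eqP e|lt]; [left|right].
  rewrite -normal_preimage_additive//; last first.
    by rewrite -subset0 => n [[_ /= h] [_ /=]]; rewrite ltNge h.
  congr (H2 (normal_preimage C _)); apply/seteqP; split=> n; last by move=> [[]|[]].
  by move=> An'; have [h|h] := leP 0%R (q n); [left|right].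
have h0 := stretch_body Q (lexx 0%R) ler01 hE.
have hr := stretch_body Q r0 r1 hE.
have pos k (k0 : (0 <= k)%R) (k1 : (k <= 1)%R) :
    normal_preimage (stretch Q k E) Ap = normal_preimage E Ap.
  by apply/seteqP; split=> x [n [An' nq] nx]; exists n => //; move: nx;
    rewrite normal_stretch_pos.
have negr : H2 (normal_preimage (stretch Q r E) An) =
    (r ^+ 2)%:E * H2 (normal_preimage E An).
  rewrite -(hausdorff2_homothety _ (Q - r *: Q)%R rp); congr H2; apply/seteqP; split=> x.
    move=> [n [An' nq]] /(normal_stretch_neg r0 r1 hE _ nq)[y ny ->].
    by exists y; [exists n|vring].
  move=> [y [n [An' nq] ny] <-]; exists n => //.
  by apply/(normal_stretch_neg r0 r1 hE _ nq); exists y => //; vring.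
have neg0 : H2 (normal_preimage (stretch Q 0 E) An) = 0.
  apply/eqP; rewrite eq_le hausdorff2_ge0 andbT -(hausdorff2_set1 Q).
  apply: le_hausdorff2 => x [n [_ nq]] /(normal_stretch_neg (lexx 0%R) ler01 hE _ nq)[y _ ->].
  by rewrite /= scale0r addr0.
pose F := normal_preimage E A0.
(* The cone over [F] without its apex. It is the union of its part with ratios in [r, 1] and of its
   own image under the homothety of ratio [r]; the two meet in the image of [F]. *)
pose U := [set y | exists l x, [/\ (0 < l)%R, (l <= 1)%R, F x & y = Q + l *: (x - Q)]]%R.
have zeroE k (k0 : (0 <= k)%R) (k1 : (k <= 1)%R) :
    normal_preimage (stretch Q k E) A0 = stretch Q k F.
  apply/seteqP; split=> y.
    move=> [n [An' nq]] /(normal_stretch0 k0 k1 hE _ nq)[l [x [kl l1 nx ->]]].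
    by exists l, x; split=> //; exists n.
  move=> [l [x [kl l1 [n [An' nq] nx] ->]]]; exists n => //.
  by apply/(normal_stretch0 k0 k1 hE _ nq); exists l, x.
have zero0 : H2 (normal_preimage (stretch Q 0 E) A0) = H2 U.
  rewrite zeroE//; apply: (outer_measure_null_diff (hausdorff2_set1 Q)) => y.
    move=> [l [x [l0 l1 Fx ->]]]; move: l0; rewrite le_eqVlt => /orP[/eqP <-|l0].
      by right; rewrite scale0r addr0.
    by left; exists l, x.
  by move=> [l [x [/ltW l0 l1 Fx ->]]]; left; exists l, x.
have scal (D : set V) : H2 [set Q + r *: (x - Q) | x in D]%R = (r ^+ 2)%:E * H2 D.
  rewrite -(hausdorff2_homothety D (Q - r *: Q)%R rp); congr H2.
  by apply/seteqP; split=> _ [x Dx <-]; exists x => //; vring.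
have UU : U = stretch Q r F `|` [set Q + r *: (x - Q) | x in U]%R.
  apply/seteqP; split=> y.
    move=> [l [x [l0 l1 Fx ->]]]; have [rl|lr] := leP r l.
      by left; exists l, x.
    right; exists (Q + (l / r) *: (x - Q))%R.
      by exists (l / r)%R, x; split=> //; rewrite ?divr_gt0// ler_pdivrMr// mul1r ltW.
    by apply/rowP => i; rewrite !mxE; field.
  move=> [[l [x [rl l1 Fx ->]]]|[_ [l [x [l0 l1 Fx ->]]] <-]].
    by exists l, x; split=> //; exact: lt_le_trans rl.
  exists (r * l)%R, x; split=> //; first exact: mulr_gt0.
    by rewrite mulr_ile1// ltW.
  by vring.
have UI : stretch Q r F `&` [set Q + r *: (x - Q) | x in U]%R =
    [set Q + r *: (x - Q) | x in F]%R.
  apply/seteqP; split=> y; last first.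
    move=> [x Fx <-]; split; first by exists r, x.
    by exists x => //; exists 1%R, x; split=> //; rewrite scale1r addrCA subrr addr0.
  move=> [[l [x [rl l1 [n [An' nq] nx] ->]]] [_ [k [x' [k0 k1 [n' _ nx'] ->]]] e]].
  have lp : (0 < l)%R by exact: lt_le_trans rl.
  (* [x'] also lies on the face of [E] with normal [n]. *)
  have e2 : ((r * k) *: (x' - Q) = l *: (x - Q))%R.
    by apply: (@addrI _ Q); rewrite -e; vring.
  have rk : (0 < r * k)%R by exact: mulr_gt0.
  have dx : dot n (x - Q) = 0%R by rewrite !dotX (normal_supp hE nx).
  have dx' : dot n (x' - Q) = 0%R.
    have := congr1 (dot n) e2; rewrite !dotZr dx mulr0 => /eqP.
    by rewrite mulf_eq0 gt_eqF//= => /eqP.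
  have [Ex n1 _] := nx; have [Ex' _ _] := nx'.
  have nn : normal E x' n.
    by apply/normalP => //; split=> //; move: dx' nq; rewrite /= /q !dotX; lra.
  have xw : x' = (Q + (l / (r * k)) *: (x - Q))%R.
    have -> : ((l / (r * k)) *: (x - Q) = x' - Q)%R.
      by rewrite mulrC -scalerA -e2 scalerA mulVf ?scale1r// gt_eqF.
    by rewrite addrCA subrr addr0.
  pose w := (Q + (l / r) *: (x - Q))%R.
  exists w; last by rewrite /w; apply/rowP => i; rewrite !mxE; field.
  exists n => //; apply/normalP => //; split=> //; last first.
    by rewrite /w dotDr dotZr dx mulr0 addr0; move: nq; rewrite /= /q; lra.
  (* As [k <= 1], also [l / r <= l / (r * k)], so [w] lies on the segment from [x] to [x']. *)
  have lr1 : (1 <= l / r)%R by rewrite ler_pdivlMr// mul1r.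
  have [lk|lk] := leP (l / (r * k))%R 1%R.
    have lk2 : (l / r <= l / (r * k))%R.
      by rewrite ler_pM2l// lef_pV2 ?posrE// ger_pMr// .
    have E1 : (l / r = 1)%R by apply/eqP; rewrite eq_le lr1 andbT (le_trans lk2).
    by rewrite /w E1 scale1r addrCA subrr addr0.
  rewrite (_ : w = x + ((l / r - 1) / (l / (r * k) - 1)) *: (x' - x))%R; last first.
    rewrite xw /w; apply/rowP => i; rewrite !mxE.
    set a := (l / r)%R; set b := (l / (r * k))%R in lk *.
    by field; rewrite subr_eq0 gt_eqF.
  have bk : (0 < l / (r * k) - 1)%R by rewrite subr_gt0.
  apply: body_convex => //; first by rewrite divr_ge0// ?subr_ge0// ltW.
  rewrite ler_pdivrMr// mul1r lerD2r ler_pM2l// lef_pV2 ?posrE// ger_pMr//.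
have kF : compact F by exact: normal_preimage_compact.
have := caratheodory_setUI (mu := H2) [set Q + r *: (x - Q) | x in U]%R
  (compact_caratheodory (@stretch_compact Q r F kF)).
rewrite /= -UU UI !scal => key.
rewrite !split3// !pos// negr neg0 zero0 zeroE// -/F.
have fn C D : convex_body C -> exists2 s : R, (0 <= s)%R & H2 (normal_preimage C D) = s%:E.
  by move=> hC; apply: ge0_fin_real; [exact: hausdorff2_ge0|exact: normal_preimage_fin].
have [u u0 uE] := fn _ A0 h0; rewrite zero0 in uE.
have [v v0 vE] := fn _ A0 hr; rewrite zeroE// in vE.
have [f f0 fE] := fn _ A0 hE; rewrite -/F in fE.
have [p p0 pE] := fn _ Ap hE; have [a a0 aE] := fn _ An hE.
move: key; rewrite uE vE fE pE aE -!EFinM -!EFinD => -[key].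
by congr EFin; lra.
Qed.

End stretch.

(** * Weak continuity of the surface measure *)

Section weak_continuity.
Context {R : realType}.
Local Notation V := 'rV[R]_3.
Local Notation H2 := (@hausdorff2 R).
Implicit Types (x y z n m : V) (C P A D U : set V) (eps eta : R).

Definition nu C D : R := fine (H2 (normal_preimage C D)).

Lemma nuE C D : convex_body C -> H2 (normal_preimage C D) = (nu C D)%:E.
Proof.
by move=> hC; rewrite /nu fineK// ge0_fin_numE ?normal_preimage_fin// hausdorff2_ge0.
Qed.

Lemma nu_ge0 C D : 0 <= nu C D.
Proof. exact/fine_ge0/hausdorff2_ge0. Qed.

Lemma le_nu C D D' : convex_body C -> D `<=` D' -> nu C D <= nu C D'.
Proof.
move=> hC DD; rewrite -lee_fin -!nuE//; apply: le_hausdorff2 => x [n Dn nx].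
by exists n => //; exact: DD.
Qed.

Lemma nu_additive C A0 A1 : convex_body C -> closed A0 -> A0 `&` A1 = set0 ->
  nu C (A0 `|` A1) = nu C A0 + nu C A1.
Proof.
move=> hC cA A01; apply: EFin_inj; rewrite EFinD -!nuE//.
exact: normal_preimage_additive.
Qed.

Lemma ray_exit C x v : convex_body C -> C x -> enorm v = 1 ->
  exists2 l, 0 <= l & boundary C (x + l *: v).
Proof.
move=> hC Cx v1; have [M M0 bM] := body_bounded hC.
have [|t [t0 t1 bt]] := crossing (q := x + (2 * M + 1) *: v) (body_closed hC) Cx.
  move=> /bM h; have := bM _ Cx.
  have := enormB_le (x + (2 * M + 1) *: v) 0 x.
  rewrite addrAC subrr add0r enormZ v1 mulr1 subr0 sub0r enormN ger0_norm; lra.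
exists (t * (2 * M + 1)); first by rewrite mulr_ge0//; lra.
by move: bt; rewrite addrAC subrr add0r scalerA.
Qed.

(** Closeness is expressed by homotheties because they change areas by an explicit factor. *)
Definition sandwich z eps C P :=
  (forall u, C u -> P (z + (1 - eps) *: (u - z))) /\
  (forall xi, P xi -> exists2 u, C u & xi = z + (1 + eps) *: (u - z)).

Let near_preimage C A eta := [set x | boundary C x /\ exists n,
  [/\ A n, enorm n = 1 & forall y, C y -> dot n (y - x) <= eta]].

Let near_preimage_caratheodory C A eta : convex_body C -> closed A ->
  H2.-caratheodory (near_preimage C A eta).
Proof.
move=> hC cA; rewrite (_ : near_preimage C A eta =
    boundary C `&` fst @` near_normal_pairs C A eta).
  apply: caratheodory_measurable_setI; apply: compact_caratheodory.
    by rewrite -normal_preimageT//; apply: normal_preimage_compact => //; exact: closedT.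
  apply: continuous_compact; last exact: near_normal_pairs_compact.
  by apply: continuous_subspaceT => p; exact: cvg_fst.
apply/seteqP; split=> x [bx].
  move=> [n [An n1 H]]; split=> //; exists (x, n) => //; split=> //; split=> //=.
  by have /(boundary_bodyP _ hC)[m []] := bx.
move=> [[x' n] [/= An [Cx n1 H]] /= e]; move: bx; rewrite -e => bx.
by split=> //; exists n.
Qed.

(** From [xi] in [P] with normal [n], pass to the corresponding point [x0] of [C] and follow [n] to
    a boundary point [x]. Then [n] is a normal of [C] at [x] up to [2 * eps * M], and [xi] is the
    projection onto [P] of the dilated point [x]. *)
Lemma nu_sandwich_le C P A z eps M : convex_body C -> convex_body P ->
  0 <= eps -> (forall x, C x -> enorm (x - z) <= M) -> sandwich z eps C P ->
  ((nu P A)%:E <= ((1 + eps) ^+ 2)%:E * H2 (near_preimage C A (2 * eps * M)))%E.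
Proof.
move=> hC hP e0 bM [inn out]; rewrite -nuE//.
have e1 : 0 < 1 + eps by lra.
apply: (hausdorff2_rel_lip (rel := fun x xi => exists n l,
  [/\ normal P xi n, 0 <= l & z + (1 + eps) *: (x - z) = xi + l *: n])) => //.
  move=> xi [n An nxi]; have [Pxi n1 Hn] := nxi.
  have [x0 Cx0 xi0] := out _ Pxi.
  have [l l0 bl] := ray_exit hC Cx0 n1.
  set x := x0 + l *: n in bl.
  have xe : z + (1 + eps) *: (x - z) = xi + ((1 + eps) * l) *: n.
    by rewrite xi0 /x; vring.
  exists x; last by exists n, ((1 + eps) * l); split=> //; rewrite mulr_ge0// ltW.
  have Cx : C x by have /(boundary_bodyP _ hC)[? []] := bl.
  split=> //; exists n; split=> // u Cu.
  have := Hn _ (inn _ Cu).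
  have -> : xi = z + (1 + eps) *: (x - z) - ((1 + eps) * l) *: n.
    by rewrite xe addrK.
  have nn : dot n n = 1 by rewrite -sqr_enorm n1 expr1n.
  have -> : dot n (z + (1 - eps) *: (u - z) - (z + (1 + eps) *: (x - z) - ((1 + eps) * l) *: n)) =
     dot n (u - x) - eps * dot n (u - z) - eps * dot n (x - z) + (1 + eps) * l * dot n n.
    by rewrite !dotE !mxE; ring.
  rewrite nn mulr1.
  have := dot_unit_le (u - z) n1; have := dot_unit_le (x - z) n1.
  rewrite !ler_norml => /andP[_ h1] /andP[_ h2].
  have h3 : eps * dot n (x - z) <= eps * M by rewrite ler_wpM2l// (le_trans h1)// bM.
  have h4 : eps * dot n (u - z) <= eps * M by rewrite ler_wpM2l// (le_trans h2)// bM.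
  have : 0 <= (1 + eps) * l by rewrite mulr_ge0// ltW.
  by lra.
move=> x x' xi xi' [n [l [nn l0 e]]] [n' [l' [nn' l0' e']]] _ _.
apply: (le_trans (normal_monotone l0 l0' nn nn')); rewrite -e -e'.
rewrite (_ : _ - _ = (1 + eps) *: (x - x')); last by vring.
by rewrite enormZ ger0_norm// ltW.
Qed.

(** Conversely, the boundary of [P] is projected onto the contracted copy of [C]. *)
Lemma nuT_sandwich_ge C P z eps : convex_body C -> convex_body P ->
  eps < 1 -> sandwich z eps C P -> (1 - eps) ^+ 2 * nu C setT <= nu P setT.
Proof.
move=> hC hP e1 [inn _]; have e0 : 0 < 1 - eps by lra.
rewrite mulrC -ler_pdivlMr ?exprn_gt0// mulrC -exprVn -lee_fin EFinM -!nuE//.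
apply: (hausdorff2_rel_lip (rel := fun y x => exists n l,
  [/\ normal C x n, 0 <= l & y = z + (1 - eps) *: (x + l *: n - z)])).
- by rewrite invr_gt0.
- move=> x [n _ nx]; have [Cx n1 _] := nx.
  have [l l0 bl] := ray_exit hP (inn _ Cx) n1.
  have /(boundary_bodyP _ hP)[m mP] := bl.
  exists (z + (1 - eps) *: (x - z) + l *: n); first by exists m.
  exists n, (l / (1 - eps)); split=> //; first by rewrite divr_ge0// ltW.
  by apply/rowP => i; rewrite !mxE; field; rewrite gt_eqF.
- move=> _ _ x x' [n [l [nn l0 ->]]] [n' [l' [nn' l0' ->]]] _ _.
  have -> : z + (1 - eps) *: (x + l *: n - z) - (z + (1 - eps) *: (x' + l' *: n' - z)) =
    (1 - eps) *: (x + l *: n - (x' + l' *: n')) by vring.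
  rewrite enormZ (ger0_norm (ltW e0)) mulKf ?gt_eqF//.
  exact: (normal_monotone l0 l0' nn nn').
Qed.

(** At a nonsingular point the normals furnished by the various [D k] coincide, so the two
    intersections differ in singular points only. *)
Lemma nu_nonincreasing_cvg C (D : nat -> set V) A : convex_body C ->
  (forall k, closed (D k)) -> (forall k, D k.+1 `<=` D k) -> \bigcap_k D k = A ->
  nu C (D k) @[k --> \oo] --> nu C A.
Proof.
move=> hC cD dD DA.
suff cv : (H2 (normal_preimage C (D k)) @[k --> \oo] --> (nu C A)%:E)%E by exact: (fine_cvg cv).
rewrite -nuE//.
have := @caratheodory_nonincreasing_cvg V R H2 (fun k => normal_preimage C (D k))
   (normal_preimage_fin _ hC) (fun k => compact_caratheodory (normal_preimage_compact hC (cD k))).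
rewrite /= (_ : H2 (\bigcap_k _) = H2 (normal_preimage C A)).
  apply=> k x [n Dn nx]; exists n => //; exact: dD.
apply: (outer_measure_null_diff (hausdorff2_singular hC)) => x.
  move=> xD; have [n0 D0 nx0] := xD 0%N I.
  have [sx|nsx] := pselect (singular C x); [by right|left].
  exists n0 => //; rewrite -DA => k _; have [n Dn nx] := xD k I.
  suff -> : n0 = n by [].
  by apply/eqP; apply: contrapT => /negP nn; apply: nsx; exists n0, n.
by move=> [n An nx]; left => k _; exists n => //; move: An; rewrite -DA; apply.
Qed.

(** A point with near normals in [A] for every tolerance has an exact one, since
    [supp C n - dot n x] attains its minimum over the unit vectors of [A]. *)
Lemma near_preimage_cvg C A : convex_body C -> closed A ->
  (H2 (near_preimage C A (k.+1%:R^-1)) @[k --> \oo] --> (nu C A)%:E)%E.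
Proof.
move=> hC cA; rewrite -nuE//.
have := @caratheodory_nonincreasing_cvg V R H2 (fun k => near_preimage C A k.+1%:R^-1) _
   (fun k => near_preimage_caratheodory _ hC cA).
rewrite /= (_ : \bigcap_k _ = normal_preimage C A).
  apply; first by apply: le_lt_trans (boundary_fin hC); apply: le_hausdorff2 => x [].
  move=> k x [bx [n [An n1 H]]]; split=> //; exists n; split=> // y /H h.
  by apply: (le_trans h); rewrite lef_pV2 ?posrE// ler_nat.
apply/seteqP; split=> x; last first.
  move=> [n An nx] k _; split; first by apply: (@normal_preimage_boundary _ C A) => //; exists n.
  exists n; have [_ n1 H] := nx; split=> // y /H h; apply: (le_trans h).
  by rewrite invr_ge0.
move=> xN; have [bx [n0 [An0 n01 _]]] := xN 0%N I.
have Cx : C x by have /(boundary_bodyP _ hC)[? []] := bx.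
have [|||n /set_mem[An n1] nm] := @EVT_min_rV R 3 (fun n => supp C n - dot n x)
    (A `&` [set n | enorm n = 1]).
- by exists n0.
- by rewrite setIC; apply: compact_closedI => //; exact: sphere_compact.
- apply: continuous_subspaceT => n; apply: (@cvgB _ _ _ (nbhs n) _ (supp C) (fun n => dot n x)).
    exact: continuous_supp.
  by apply: (@continuous_dot _ _ idfun (fun=> x)); [exact: cvg_id|exact: cst_continuous].
exists n => //; apply: supp_normal => //; apply/eqP; rewrite eq_le supp_ub//=.
rewrite -subr_le0 leNgt; apply/negP => d0.
have [k] := ltr_add_invr d0; rewrite add0r => kd.
have [_ [m [Am m1 Hm]]] := xN k I.
have := nm m (mem_set (conj Am m1)).
have : supp C m - dot m x <= k.+1%:R^-1.
  by rewrite lerBlDr; apply: supp_le => // y /Hm; rewrite dotDr dotNr lerBlDr.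
by move=> h1 h2; have := lt_le_trans kd (le_trans h2 h1); rewrite ltxx.
Qed.

Lemma nu_upper_semicontinuous C A z (e : R) : convex_body C -> closed A -> 0 < e ->
  exists2 d, 0 < d & forall eps P, convex_body P -> 0 <= eps -> eps < d ->
    sandwich z eps C P -> nu P A <= nu C A + e.
Proof.
move=> hC cA e0; have [M0 M00 bM0] := body_bounded hC.
pose M := M0 + enorm z + 1.
have M1 : 0 < M by rewrite /M; have := enorm_ge0 z; lra.
have bM x : C x -> enorm (x - z) <= M.
  move=> Cx; have := enormD x (- z); rewrite enormN; have := bM0 _ Cx; rewrite /M; lra.
have e20 : 0 < e / 2 by rewrite divr_gt0.
have := near_preimage_cvg hC cA.
move=> /fine_cvg /(@cvgrPdist_lt _ _ _ (nbhs \oo))/(_ _ e20)[k _ /(_ k (leqnn k)) /= hk].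
pose h := fine (H2 (near_preimage C A k.+1%:R^-1)).
have hE : H2 (near_preimage C A k.+1%:R^-1) = h%:E.
  rewrite fineK// ge0_fin_numE ?hausdorff2_ge0//.
  by apply: le_lt_trans (boundary_fin hC); apply: le_hausdorff2 => x [].
have hlt : h < nu C A + e / 2.
  by move: hk; rewrite -/h ltr_norml => /andP[+ _]; rewrite /nu; lra.
have h0 : 0 <= h by rewrite -lee_fin -hE hausdorff2_ge0.
pose b := nu C A + e.
have b0 : 0 < b by rewrite /b; have := nu_ge0 C A; lra.
(* The bounds serve, in this order, [(1 + eps) ^+ 2 <= 1 + 3 * eps], the inclusion of the near
   preimages, and an error [3 * eps * b] below [e / 2]. *)
exists (Num.min 1 (Num.min (k.+1%:R^-1 / (2 * M)) (e / 2 / (3 * b)))).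
  by rewrite !lt_min ltr01 !divr_gt0 ?invr_gt0 ?mulr_gt0.
move=> eps P hP eps0; rewrite !lt_min => /and3P[eps1 epsM epsb] sw.
have := nu_sandwich_le A hC hP eps0 bM sw.
have sub : near_preimage C A (2 * eps * M) `<=` near_preimage C A k.+1%:R^-1.
  move=> x [bx [n [An n1 H]]]; split=> //; exists n; split=> // y /H hy.
  apply: (le_trans hy); move: epsM; rewrite ltr_pdivlMr ?mulr_gt0// => /ltW.
  by rewrite mulrCA mulrA.
have q0 : 0 <= (1 + eps) ^+ 2 by exact: sqr_ge0.
move=> /le_trans/(_ (lee_wpmul2l _ (le_hausdorff2 sub))).
rewrite lee_fin => /(_ q0); rewrite hE -EFinM lee_fin => le1.
apply: (le_trans le1).
move: epsb; rewrite ltr_pdivlMr ?mulr_gt0// => epsb.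
have : (1 + eps) ^+ 2 * h <= (1 + 3 * eps) * (nu C A + e / 2).
  by apply: ler_pM => //; [nra|exact: ltW].
rewrite /b in epsb; nra.
Qed.

Lemma nuT_lower_semicontinuous C z (e : R) : convex_body C -> 0 < e ->
  exists2 d, 0 < d & forall eps P, convex_body P -> 0 <= eps -> eps < d ->
    sandwich z eps C P -> nu C setT - e <= nu P setT.
Proof.
move=> hC e0; pose b := nu C setT + 1.
have b0 : 0 < b by rewrite /b; have := nu_ge0 C setT; lra.
exists (Num.min 1 (e / (2 * b))); first by rewrite lt_min ltr01 divr_gt0// mulr_gt0.
move=> eps P hP eps0; rewrite lt_min ltr_pdivlMr ?mulr_gt0// => /andP[eps1 epsb] sw.
apply: le_trans (nuT_sandwich_ge hC hP eps1 sw).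
rewrite /b in epsb; have := nu_ge0 C setT; nra.
Qed.

(** The total mass is lower semicontinuous, and the mass of the closed complement is upper
    semicontinuous. *)
Lemma nu_lower_semicontinuous C U z (e : R) : convex_body C -> open U -> 0 < e ->
  exists2 d, 0 < d & forall eps P, convex_body P -> 0 <= eps -> eps < d ->
    sandwich z eps C P -> nu C U - e <= nu P U.
Proof.
move=> hC oU e0; have e20 : 0 < e / 2 by rewrite divr_gt0.
have cU : closed (~` U) by exact: open_closedC.
have [d1 d10 H1] := nu_upper_semicontinuous z hC cU e20.
have [d2 d20 H2'] := nuT_lower_semicontinuous z hC e20.
exists (Num.min d1 d2); first by rewrite lt_min d10.
move=> eps P hP eps0; rewrite lt_min => /andP[eps1 eps2] sw.
have := H1 _ _ hP eps0 eps1 sw; have := H2' _ _ hP eps0 eps2 sw.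
have split D : convex_body D -> nu D setT = nu D (~` U) + nu D U.
  by move=> hD; rewrite -nu_additive// ?setICl// setUC setUv.
by rewrite !split//; lra.
Qed.

(** [D] is approximated by open neighborhoods [U k]. The masses of the approximating bodies are
    bounded below on [U k] and above on its closure, and for [C], [C1], [C2] both sets have nearly
    the mass of [D]. *)
Lemma nu_affine_limit C C1 C2 z z1 z2 (a b : R) :
  convex_body C -> convex_body C1 -> convex_body C2 -> 0 <= a -> 0 <= b ->
  (forall d, 0 < d -> exists eps P P1 P2,
    [/\ 0 <= eps, eps < d,
        [/\ convex_body P, convex_body P1 & convex_body P2],
        [/\ sandwich z eps C P, sandwich z1 eps C1 P1 & sandwich z2 eps C2 P2] &
        forall D, closed D -> nu P D = a * nu P1 D + b * nu P2 D]) ->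
  forall D, closed D -> nu C D = a * nu C1 D + b * nu C2 D.
Proof.
move=> hC h1 h2 a0 b0 approx D cD.
pose U k := [set n | exists2 m, D m & enorm (n - m) < k.+1%:R^-1].
have oU k : open (U k).
  rewrite openE => n [m Dm nm]; apply/nbhs_enormP.
  exists (k.+1%:R^-1 - enorm (n - m)) => [|y yn]; first by rewrite subr_gt0.
  exists m => //; apply: (le_lt_trans (enormB_le y n m)); rewrite -ltrBrDr.
  exact: yn.
have DU k : D `<=` U k by move=> n Dn; exists n => //; rewrite subrr enorm0 invr_gt0.
have clU k n : closure (U k) n -> exists2 m, D m & enorm (n - m) < k.+1%:R^-1 + k.+1%:R^-1.
  move=> clx; have k0 : 0 < k.+1%:R^-1 :> R by rewrite invr_gt0.
  have [|y [[m Dm ym] yn]] := clx [set y | enorm (y - n) < k.+1%:R^-1].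
    by apply/nbhs_enormP; exists k.+1%:R^-1.
  exists m => //; apply: (le_lt_trans (enormB_le n y m)); rewrite enormBC.
  by rewrite ltrD.
have capU : \bigcap_k closure (U k) = D.
  apply/seteqP; split=> n; last by move=> Dn k _; apply: subset_closure; exact: DU.
  move=> nU; move/closed_enormP: cD; apply => e e0.
  have e20 : 0 < e / 2 by rewrite divr_gt0.
  have [k] := ltr_add_invr e20; rewrite add0r => ke.
  have [m Dm nm] := clU k n (nU k I); exists m => //; rewrite enormBC.
  by apply: (lt_trans nm); rewrite [ltRHS]splitr ltrD.
have dU k : closure (U k.+1) `<=` closure (U k).
  apply: closure_subset => n [m Dm nm]; exists m => //; apply: (lt_le_trans nm).
  by rewrite lef_pV2 ?posrE// ler_nat.
have cvgU B (hB : convex_body B) (e : R) : 0 < e -> \forall k \near \oo,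
    nu B (closure (U k)) <= nu B D + e.
  move=> e0; have := nu_nonincreasing_cvg hB (fun k => @closed_closure _ (U k)) dU capU.
  move=> /(@cvgrPdist_lt _ _ _ (nbhs \oo))/(_ _ e0); apply: filterS => k.
  by rewrite ltr_norml => /andP[? ?]; lra.
apply/eqP; rewrite -subr_eq0 -normr_le0; apply/ler_addgt0Pr => e e0; rewrite add0r.
pose w := e / (2 * (1 + a + b)).
have w0 : 0 < w by rewrite divr_gt0// mulr_gt0//; lra.
have we : 2 * w * (1 + a + b) = e.
  by rewrite /w; field; lra.
have [k [[k0 k1] k2]] : exists k, (nu C (closure (U k)) <= nu C D + w /\
    nu C1 (closure (U k)) <= nu C1 D + w) /\ nu C2 (closure (U k)) <= nu C2 D + w.
  have [N _ HN] := filterI (filterI (cvgU _ hC _ w0) (cvgU _ h1 _ w0)) (cvgU _ h2 _ w0).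
  by exists N; exact: (HN N (leqnn N)).
have up B (hB : convex_body B) zB := nu_upper_semicontinuous zB hB (@closed_closure _ (U k)) w0.
have lo B (hB : convex_body B) zB := nu_lower_semicontinuous zB hB (oU k) w0.
have [u uD Hu] := up _ hC z; have [u1 u1D Hu1] := up _ h1 z1; have [u2 u2D Hu2] := up _ h2 z2.
have [v vD Hv] := lo _ hC z; have [v1 v1D Hv1] := lo _ h1 z1; have [v2 v2D Hv2] := lo _ h2 z2.
have [|eps [P [P1 [P2 [e00 epsd [hP hP1 hP2] [s s1 s2] rel]]]]] :=
    approx (Num.min (Num.min (Num.min u u1) u2) (Num.min (Num.min v v1) v2)).
  by rewrite !lt_min uD u1D u2D vD v1D v2D.
move: epsd; rewrite !lt_min => /andP[/andP[/andP[eu eu1] eu2] /andP[/andP[ev ev1] ev2]].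
have {}Hu := Hu _ _ hP e00 eu s; have {}Hu1 := Hu1 _ _ hP1 e00 eu1 s1.
have {}Hu2 := Hu2 _ _ hP2 e00 eu2 s2; have {}Hv := Hv _ _ hP e00 ev s.
have {}Hv1 := Hv1 _ _ hP1 e00 ev1 s1; have {}Hv2 := Hv2 _ _ hP2 e00 ev2 s2.
have relU := rel _ (@closed_closure _ (U k)).
have sub B (hB : convex_body B) := le_nu hB (@subset_closure _ (U k)).
have subD B (hB : convex_body B) := le_nu hB (DU k).
have := (sub _ hP, sub _ hP1, sub _ hP2); case=> -[p0 p1] p2.
have := (subD _ hC, subD _ h1, subD _ h2); case=> -[q0 q1] q2.
have a1 := ler_wpM2l a0 (le_trans Hu1 (lerD k1 (lexx w))).
have b1 := ler_wpM2l b0 (le_trans Hu2 (lerD k2 (lexx w))).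
have a2 := ler_wpM2l a0 (le_trans (lerD q1 (lexx (- w))) (le_trans Hv1 p1)).
have b2 := ler_wpM2l b0 (le_trans (lerD q2 (lexx (- w))) (le_trans Hv2 p2)).
have aw := mulr_ge0 a0 (ltW w0); have bw := mulr_ge0 b0 (ltW w0).
by rewrite ler_norml; apply/andP; split; lra.
Qed.

End weak_continuity.

(** * Curves parametrized by arc length *)

Section curves.
Context {R : realType}.
Local Notation V := 'rV[R]_3.
Implicit Types (m u v : V) (s t : R).

Lemma le_normr_sin (x : R) : 0 <= x -> `|sin x| <= x.
Proof.
rewrite le_eqVlt => /orP[/eqP <-|x0]; first by rewrite sin0 normr0.
have [|c _] := @MVT R sin cos 0 x x0.
  by apply: continuous_subspaceT => y; exact: continuous_sin.
rewrite sin0 !subr0 => ->; rewrite normrM (gtr0_norm x0) ler_piMl ?(ltW x0)//.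
by rewrite ler_norml cos_geN1 cos_le1.
Qed.

(** The chord has length [2 * sin (th / 2)], where [th] is the angle. *)
Lemma chord_le_angle u v : enorm u = 1 -> enorm v = 1 -> enorm (u - v) <= angle u v.
Proof.
move=> u1 v1; have d : -1 <= dot u v <= 1.
  by rewrite -ler_norml; have := dot_le_enorm u v; rewrite u1 v1 mul1r.
rewrite /angle u1 v1 mul1r divr1; set th := acos _.
have th0 : 0 <= th by exact: acos_ge0.
have thc : cos th = dot u v by rewrite acosK// in_itv.
rewrite -(@ler_pXn2r _ 2) ?nnegrE ?enorm_ge0//.
rewrite sqr_enorm.
have -> : dot (u - v) (u - v) = enorm u ^+ 2 + enorm v ^+ 2 - 2 * dot u v.
  by rewrite !sqr_enorm !dotE !mxE; ring.
rewrite u1 v1 -thc.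
have h : `|sin (th / 2)| <= th / 2 by apply: le_normr_sin; rewrite divr_ge0.
have : sin (th / 2) ^+ 2 <= (th / 2) ^+ 2.
  by rewrite -real_normK ?num_real// ler_pXn2r ?nnegrE// divr_ge0.
have := cos2Dsin2 (th / 2); have -> : cos th = cos (th / 2 *+ 2) by rewrite -mulr_natr divfK.
by rewrite cos_mulr2n; lra.
Qed.

Context (S : set V) (L k : R) (gamma tau : R -> V).
Hypotheses (L0 : 0 < L) (par : natural_C1_parametrization S L gamma tau).
Hypothesis ang : forall s1 s2 : R, s1 \in `[0, L] -> s2 \in `[0, L] ->
  angle (tau s1) (tau s2) <= k * `|s2 - s1|.

Lemma tangent_unit s : 0 <= s <= L -> enorm (tau s) = 1.
Proof. by move=> sL; have [_ _ _ _ h] := par; apply: h; rewrite in_itv. Qed.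

Lemma tangent_lip s t : 0 <= s <= L -> 0 <= t <= L ->
  enorm (tau s - tau t) <= k * `|t - s|.
Proof.
move=> sL tL; apply: le_trans (ang _ _); rewrite ?in_itv//.
by apply: chord_le_angle; exact: tangent_unit.
Qed.

Lemma curve_eps s (e : R) : 0 <= s <= L -> 0 < e -> exists2 d, 0 < d &
  forall t, 0 <= t <= L -> `|t - s| < d ->
    enorm (gamma t - gamma s - (t - s) *: tau s) <= e * `|t - s|.
Proof.
move=> sL e0; have [_ _ h _ _] := par.
have e20 : 0 < e / 2 by rewrite divr_gt0.
have sL' : s \in `[0, L] by rewrite in_itv.
have := h s sL' => /(@cvgrPdist_lt _ _ _ _)/(_ _ e20).
rewrite near_withinE => -[d /= d0 hd]; exists d => // t tL ts.
have [->|tns] := eqVneq t s; first by rewrite !subrr scale0r subrr enorm0 normr0 mulr0.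
have ts0 : t - s != 0 by rewrite subr_eq0.
have := hd t; rewrite /ball_ /= distrC => /(_ ts tns).
rewrite in_itv /= => /(_ tL) /ltW lt.
have -> : gamma t - gamma s - (t - s) *: tau s =
    - (t - s) *: (tau s - (t - s)^-1 *: (gamma t - gamma s)).
  by apply/rowP => i; rewrite !mxE; field.
rewrite enormZ normrN mulrC ler_wpM2r//.
by apply: (le_trans (enorm_le_norm _)); rewrite mulrC -ler_pdivlMr.
Qed.

Lemma curve_continuous : {within `[0, L], continuous gamma}.
Proof.
apply/subspace_continuousP => s /=; rewrite in_itv /= => sL.
apply/(@cvgrPdist_lt _ _ _ _) => e e0; rewrite near_withinE.
have [d d0 hd] := curve_eps sL ltr01.
exists (Num.min d (e / 3)) => /=; first by rewrite lt_min d0 divr_gt0.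
move=> t; rewrite /ball_ /= distrC lt_min in_itv /= => /andP[td te] tL.
rewrite distrC; apply: (le_lt_trans (norm_le_enorm _)).
have := enormB_le (gamma t - gamma s) ((t - s) *: tau s) 0.
rewrite !subr0 enormZ tangent_unit// mulr1.
by have := hd t tL td; rewrite mul1r; lra.
Qed.

Lemma curve_dot_continuous m : {within `[0, L], continuous (fun s => dot m (gamma s))}.
Proof.
have /subspace_continuousP h := curve_continuous; apply/subspace_continuousP => s sL.
by apply: (@cvg_comp _ _ _ gamma (dot m) _ _ _ (h s sL)); exact: continuous_dotr.
Qed.

Lemma tangent_dot_continuous m : {within `[0, L], continuous (fun s => dot m (tau s))}.
Proof.
have [_ _ _ /subspace_continuousP h _] := par; apply/subspace_continuousP => s sL.
by apply: (@cvg_comp _ _ _ tau (dot m) _ _ _ (h s sL)); exact: continuous_dotr.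
Qed.

Lemma curve_dot_derive m s : 0 < s -> s < L ->
  is_derive s 1 (fun s => dot m (gamma s)) (dot m (tau s)).
Proof.
move=> s0 sL; have sL' : 0 <= s <= L by rewrite !ltW.
have h : (fun h => h^-1 *: ((fun s => dot m (gamma s)) (h *: (1 : R^o) + s) - dot m (gamma s)))
    @ 0^' --> dot m (tau s).
  apply/(@cvgrPdist_lt _ _ _ _) => e e0.
  have m1 : 0 < enorm m + 1 by have := enorm_ge0 m; lra.
  have [d d0 hd] := curve_eps sL' (divr_gt0 e0 m1).
  exists (Num.min d (Num.min s (L - s))) => /=; first by rewrite !lt_min d0 s0 subr_gt0.
  move=> h; rewrite /ball_ /= sub0r normrN !lt_min => /and3P[hd' hs hL] h0.
  have hsE : h *: 1 + s = s + h by rewrite addrC /GRing.scale /= mulr1.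
  rewrite hsE.
  have shL : 0 <= s + h <= L.
    by move: hs hL; rewrite !ltr_norml => /andP[? ?] /andP[? ?]; apply/andP; split; lra.
  have := hd _ shL; rewrite (addrC s) addrK => /(_ hd') he.
  rewrite (addrC h) in he *.
  rewrite /GRing.scale /=.
  have -> : dot m (tau s) - h^-1 * (dot m (gamma (s + h)) - dot m (gamma s)) =
      - (h^-1 * dot m (gamma (s + h) - gamma s - h *: tau s)).
    by rewrite !dotX; field.
  rewrite normrN normrM normfV mulrC ltr_pdivrMr ?normr_gt0//.
  apply: (le_lt_trans (dot_le_enorm _ _)).
  apply: (@le_lt_trans _ _ (enorm m * (e / (enorm m + 1) * `|h|))).
    by rewrite ler_wpM2l ?enorm_ge0.
  rewrite mulrA ltr_pM2r ?normr_gt0// mulrCA gtr_pMr// ltr_pdivrMr// mul1r.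
  by rewrite ltrDl.
apply: DeriveDef; first by apply/cvg_ex; exists (dot m (tau s)).
exact: cvg_lim h.
Qed.

Lemma curve_dot_lip m s t : enorm m = 1 -> 0 <= s <= L -> 0 <= t <= L ->
  `|dot m (gamma t) - dot m (gamma s)| <= `|t - s|.
Proof.
move=> m1; wlog st : s t / s < t.
  move=> H sL tL; have [->|] := eqVneq s t; first by rewrite !subrr.
  case: (ltgtP s t) => // st _; first exact: H.
  by rewrite distrC (distrC t); exact: H.
move=> /andP[s0 sL] /andP[t0 tL].
have [||c] := @MVT R (fun s => dot m (gamma s)) (fun s => dot m (tau s)) s t st.
- move=> x; rewrite in_itv /= => /andP[sx xt].
  by apply: curve_dot_derive; [exact: le_lt_trans sx|exact: lt_le_trans tL].
- apply: (continuous_subspaceW _ (@curve_dot_continuous m)) => x /=.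
  by rewrite !in_itv /= => /andP[sx xt]; rewrite (le_trans s0 sx) (le_trans xt tL).
rewrite in_itv /= => /andP[sc ct] ->; rewrite normrM ler_piMl//.
apply: (le_trans (dot_unit_le _ m1)); rewrite tangent_unit//.
by rewrite (le_trans s0 (ltW sc)) (le_trans (ltW ct) tL).
Qed.

(** The mean value theorem yields a tangent at an intermediate parameter, which the curvature bound
    compares with the tangent at [s]; hence the constant [k] rather than [k / 2]. *)
Lemma curve_dot_quadratic m s t : enorm m = 1 -> 0 < s -> s < L -> 0 < t -> t < L ->
  `|dot m (gamma t) - dot m (gamma s) - (t - s) * dot m (tau s)| <= k * (t - s) ^+ 2.
Proof.
move=> m1 s0 sL t0 tL.
have [->|tns] := eqVneq t s; first by rewrite !subrr mul0r subrr normr0 expr0n mulr0.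
suff [c [c0 cL cs ->]] : exists c, [/\ 0 <= c, c <= L, `|c - s| <= `|t - s| &
    dot m (gamma t) - dot m (gamma s) = (t - s) * dot m (tau c)].
  rewrite -mulrBr normrM -(real_normK (num_real (t - s))) expr2 mulrCA ler_wpM2l//.
  have -> : dot m (tau c) - dot m (tau s) = dot m (tau c - tau s) by rewrite !dotX.
  apply: (le_trans (dot_unit_le _ m1)).
  have k0 : 0 <= k.
    have L2 : 0 <= L <= L by rewrite lexx ltW.
    have z2 : 0 <= (0 : R) <= L by rewrite lexx ltW.
    have := le_trans (enorm_ge0 _) (tangent_lip z2 L2).
    by rewrite subr0 pmulr_lge0// normr_gt0 gt_eqF.
  apply: le_trans (ler_wpM2l k0 cs); rewrite distrC.
  by apply: tangent_lip; [rewrite c0|rewrite !ltW].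
have mvt a b : 0 < a -> b < L -> a < b -> exists c, [/\ a <= c, c <= b &
    dot m (gamma b) - dot m (gamma a) = (b - a) * dot m (tau c)].
  move=> a0 bL ab.
  have [||c] := @MVT R (fun s => dot m (gamma s)) (fun s => dot m (tau s)) a b ab.
  - move=> x; rewrite in_itv /= => /andP[ax xb].
    by apply: curve_dot_derive; [exact: lt_trans ax|exact: lt_trans bL].
  - apply: (continuous_subspaceW _ (@curve_dot_continuous m)) => x /=.
    rewrite !in_itv /= => /andP[sx xt].
    by rewrite (le_trans (ltW a0) sx) (le_trans xt (ltW bL)).
  rewrite in_itv /= => /andP[/ltW ac /ltW cb] e; exists c; split=> //.
  by rewrite e mulrC.
case: (ltgtP t s) tns => // ts _.
  have [c [tc cs E]] := mvt t s t0 sL ts; exists c; split.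
  - exact: le_trans (ltW t0) tc.
  - exact: le_trans cs (ltW sL).
  - by rewrite !ler0_norm; lra.
  - by rewrite -[LHS]opprB E; ring.
have [c [sc ct E]] := mvt s t s0 tL ts; exists c; split=> //.
- exact: le_trans (ltW s0) sc.
- exact: le_trans ct (ltW tL).
- by rewrite !ger0_norm; lra.
Qed.

Lemma curve_dot_max m s : 0 < s -> s < L ->
  (forall t, 0 <= t <= L -> dot m (gamma t) <= dot m (gamma s)) -> dot m (tau s) = 0.
Proof.
move=> s0 sL mx; have sL' : 0 <= s <= L by rewrite !ltW.
have m1 : 0 < enorm m + 1 by have := enorm_ge0 m; lra.
have key (e : R) : 0 < e -> exists2 d, 0 < d & forall t, `|t - s| < d ->
    (t - s) * dot m (tau s) <= e * `|t - s|.
  move=> e0; have [d d0 hd] := curve_eps sL' (divr_gt0 e0 m1).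
  exists (Num.min d (Num.min s (L - s))); first by rewrite !lt_min d0 s0 subr_gt0.
  move=> t; rewrite !lt_min => /and3P[td ts tL].
  have tL' : 0 <= t <= L.
    by move: ts tL; rewrite !ltr_norml => /andP[? ?] /andP[? ?]; apply/andP; split; lra.
  have := hd t tL' td; set w := (_ - _ - _) => wle.
  have -> : (t - s) * dot m (tau s) = dot m (gamma t) - dot m (gamma s) - dot m w.
    by rewrite /w !dotX; ring.
  have := mx t tL'; have := dot_le_enorm m w; rewrite ler_norml => /andP[h1 _] h2.
  apply: (@le_trans _ _ (enorm m * enorm w)); first lra.
  apply: (le_trans (ler_wpM2l (enorm_ge0 m) wle)).
  rewrite mulrA ler_wpM2r// mulrCA ger_pMr// ler_pdivrMr// mul1r.
  by rewrite lerDl.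
apply/eqP; rewrite -normr_le0; apply/ler_addgt0Pr => e e0; rewrite add0r.
have [d d0 hd] := key e e0; have d20 : 0 < d / 2 by rewrite divr_gt0.
have h1 := hd (s + d / 2); have h2 := hd (s - d / 2).
move: h1 h2; rewrite (_ : s + d / 2 - s = d / 2) 1?(_ : s - d / 2 - s = - (d / 2)); [|ring..].
rewrite normrN ger0_norm ?(ltW d20)//.
have dd : d / 2 < d by lra.
move=> /(_ dd) h1 /(_ dd) h2.
have : dot m (tau s) <= e by rewrite -(ler_pM2l d20) (mulrC _ e).
have : - dot m (tau s) <= e by rewrite -(ler_pM2l d20) (mulrC _ e) mulrN -mulNr.
by move=> g1 g2; rewrite ler_norml; apply/andP; split; lra.
Qed.

End curves.

(** * Sections by half-planes bounded by the line *)

Section plane_sections.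
Context {R : realType}.
Local Notation V := 'rV[R]_3.
Implicit Types (u v w x y z n m N Y X : V).

Lemma free2P u v : free [:: u; v] <-> forall a b, a *: u + b *: v = 0 -> a = 0 /\ b = 0.
Proof.
split=> [/freeP fr a b ab|fr].
  have := fr (fun i : 'I_2 => if i == 0 then a else b).
  rewrite !big_ord_recl big_ord0 /= addr0 => /(_ ab) h.
  by have := h 0; have := h 1.
apply/freeP => k; rewrite !big_ord_recl big_ord0 /= addr0 => /fr[k0 k1].
by move=> i; case: (unliftP ord0 i) => [j|] -> //; rewrite ord1 -k1; congr k; apply/val_inj.
Qed.

Context (C : set V) (O e : V) (zeta rho : R).
Hypotheses (hC : convex_body C) (outside : forall t, t < 1 -> ~ C (O + t *: e)).
Hypotheses (onB : C (O + e)) (zeta1 : 1 < zeta) (rho0 : 0 < rho).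
Hypothesis ballz : forall y, enorm (y - (O + zeta *: e)) <= rho -> C y.

Let e0 : e != 0.
Proof.
by apply/eqP => ee; apply: (outside ltr01); rewrite scale0r -ee; exact: onB.
Qed.

Let Cz : C (O + zeta *: e).
Proof. by apply: ballz; rewrite subrr enorm0 ltW. Qed.

(** The plane of support stays at distance at least [rho] from the center of the ball, so it cannot
    be almost parallel to [e]. *)
Lemma front_dot n t : enorm n = 1 -> supp C n <= dot n (O + t *: e) ->
  rho <= (zeta - t) * - dot n e.
Proof.
move=> n1 h; have := supp_ball n hC rho0 ballz; rewrite n1 mulr1.
by move: h; rewrite !dotX; lra.
Qed.

Lemma normal_center_lt x n : normal C x n -> dot n (O + zeta *: e - x) < 0.
Proof.
move=> nx; have [_ n1 _] := nx; have := supp_ball n hC rho0 ballz.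
by rewrite n1 mulr1 -(normal_supp hC nx) !dotX; move: rho0; lra.
Qed.

Section half_plane.
Variable f : V.
Hypothesis fr : free [:: e; f].
Hypothesis CX : C (O + f).

Definition half_plane : set V := [set x | exists t r : R, 0 <= r /\ x = O + t *: e + r *: f].
Definition full_plane : set V := [set x | exists t r : R, x = O + t *: e + r *: f].

Let gram := dot e e * dot f f - dot e f ^+ 2.

Let gram_gt0 : 0 < gram.
Proof.
pose w := dot e e *: f - dot e f *: e.
have w0 : w != 0.
  apply/eqP => w0; have [] := (free2P e f).1 fr (- dot e f) (dot e e).
    by rewrite -w0 /w; vring.
  by move=> _ /eqP; rewrite gt_eqF// dot_gt0.
have : 0 < dot w w by exact: dot_gt0.
have -> : dot w w = dot e e * gram by rewrite /w /gram !dotE !mxE; ring.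
by rewrite pmulr_rgt0// dot_gt0.
Qed.

(* The basis of the linear span of [e] and [f] dual to [(e, f)]. *)
Let es := gram^-1 *: (dot f f *: e - dot e f *: f).
Let fs := gram^-1 *: (dot e e *: f - dot e f *: e).

Let dual : [/\ dot es e = 1, dot es f = 0, dot fs e = 0 & dot fs f = 1].
Proof.
have g0 : gram != 0 by rewrite gt_eqF// gram_gt0.
split; rewrite /es /fs !dotX ?(dotC f e).
- by rewrite -[RHS](mulVf g0) /gram; ring.
- by ring.
- by ring.
- by rewrite -[RHS](mulVf g0) /gram; ring.
Qed.

Let al Y := dot es (Y - O).
Let be Y := dot fs (Y - O).

Let alE t r : al (O + t *: e + r *: f) = t.
Proof.
have [d1 d2 _ _] := dual.
rewrite /al (_ : O + t *: e + r *: f - O = t *: e + r *: f); last by vring.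
by rewrite dotDr !dotZr d1 d2; ring.
Qed.

Let beE t r : be (O + t *: e + r *: f) = r.
Proof.
have [_ _ d1 d2] := dual.
rewrite /be (_ : O + t *: e + r *: f - O = t *: e + r *: f); last by vring.
by rewrite dotDr !dotZr d1 d2; ring.
Qed.

Let full_planeP Y : full_plane Y -> Y = O + al Y *: e + be Y *: f.
Proof. by move=> [t [r ->]]; rewrite alE beE. Qed.

Let half_planeP Y : half_plane Y <-> 0 <= be Y /\ Y = O + al Y *: e + be Y *: f.
Proof.
split; first by move=> [t [r [r0 ->]]]; rewrite alE beE.
by move=> [b0 E]; exists (al Y), (be Y).
Qed.

Lemma half_plane_full Y : half_plane Y -> full_plane Y.
Proof. by move=> [t [r [_ ->]]]; exists t, r. Qed.

Lemma is_plane_full : is_plane full_plane.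
Proof. by exists O, e, f. Qed.

Lemma half_plane_bounded : half_plane_bounded_by (line O e) half_plane.
Proof. by exists O, e, f. Qed.

Let K := C `&` half_plane.

Let line_half t : half_plane (O + t *: e).
Proof. by exists t, 0; rewrite scale0r addr0. Qed.

Let X_half : half_plane (O + f).
Proof. by exists 0, 1; rewrite scale0r scale1r addr0 ler01. Qed.

Let be_line t : be (O + t *: e) = 0.
Proof. by rewrite (_ : O + t *: e = O + t *: e + 0 *: f) ?beE//; vring. Qed.

Let al_line t : al (O + t *: e) = t.
Proof. by rewrite (_ : O + t *: e = O + t *: e + 0 *: f) ?alE//; vring. Qed.

Let beX : be (O + f) = 1.
Proof. by rewrite (_ : O + f = O + 0 *: e + 1 *: f) ?beE//; vring. Qed.

Let dot_plane m Y : half_plane Y -> dot m (Y - O) = al Y * dot m e + be Y * dot m f.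
Proof.
by move=> /half_planeP[_ {1}->]; rewrite !dotX; ring.
Qed.

Let cont_al : continuous al.
Proof.
move=> Y; apply: (@continuous_dot _ _ (fun=> es) (fun Y => Y - O)); first exact: cst_continuous.
by apply: (@cvgB _ _ _ (nbhs Y)); [exact: cvg_id|exact: cvg_cst].
Qed.

Let cont_be : continuous be.
Proof.
move=> Y; apply: (@continuous_dot _ _ (fun=> fs) (fun Y => Y - O)); first exact: cst_continuous.
by apply: (@cvgB _ _ _ (nbhs Y)); [exact: cvg_id|exact: cvg_cst].
Qed.

Let half_plane_closed : closed half_plane.
Proof.
rewrite (_ : half_plane = [set Y | 0 <= be Y] `&`
    [set Y | Y - (O + al Y *: e + be Y *: f) = 0]); last first.
  apply/seteqP; split=> Y.
    by move=> /half_planeP[b0 E]; split=> //=; rewrite -E subrr.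
  by move=> [/= b0 /eqP]; rewrite subr_eq0 => /eqP E; apply/half_planeP.
apply: closedI.
  by apply: (@closed_comp _ _ be [set r | 0 <= r]) => [Y _|]; [exact: cont_be|exact: closed_ge].
apply: (@closed_comp _ _ (fun Y => Y - (O + al Y *: e + be Y *: f)) [set 0]) => [Y _|].
  apply: (@cvgB _ _ _ (nbhs Y)); first exact: cvg_id.
  apply: (@cvgD _ _ _ (nbhs Y)); first apply: (@cvgD _ _ _ (nbhs Y)).
  - exact: cvg_cst.
  - by apply: (cvgZ (s := al) (f := fun=> e)); [exact: cont_al|exact: cvg_cst].
  - by apply: (cvgZ (s := be) (f := fun=> f)); [exact: cont_be|exact: cvg_cst].
by apply: compact_is_closed; exact: compact_set1.
Qed.

Let K_compact : compact K.
Proof. by have [_ kC _] := hC; apply: compact_closedI. Qed.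

(** On the span of [e] and [f] the form [m] does not vanish identically, so its kernel there is a
    line. *)
Lemma line_through_kernel m u v : dot m e != 0 \/ dot m f != 0 ->
  (exists a b, u = a *: e + b *: f) -> u != 0 -> dot m u = 0 ->
  (exists a b, v = a *: e + b *: f) -> dot m v = 0 -> exists s, v = s *: u.
Proof.
move=> m0 [a [b ->]] u0 mu [c [d ->]] mv.
have ab : 0 < a ^+ 2 + b ^+ 2.
  rewrite lt_neqAle addr_ge0 ?sqr_ge0// andbT eq_sym paddr_eq0 ?sqr_ge0//.
  rewrite !sqrf_eq0; apply/negP => /andP[/eqP a0 /eqP b0].
  by move: u0; rewrite a0 b0 !scale0r addr0 eqxx.
have cross : c * b = d * a.
  move: mu mv; rewrite !dotX => mu mv; apply/eqP; rewrite -subr_eq0; apply/eqP.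
  case: m0 => /mulfI inj; apply: inj; rewrite mulr0.
    have -> : dot m e * (c * b - d * a) =
       (c * dot m e + d * dot m f) * b - (a * dot m e + b * dot m f) * d by ring.
    by rewrite mu mv; ring.
  have -> : dot m f * (c * b - d * a) =
     (a * dot m e + b * dot m f) * c - (c * dot m e + d * dot m f) * a by ring.
  by rewrite mu mv; ring.
exists ((c * a + d * b) / (a ^+ 2 + b ^+ 2)).
have cE : c = (c * a + d * b) / (a ^+ 2 + b ^+ 2) * a.
  apply: (mulIf (lt0r_neq0 ab)); rewrite mulrAC divfK ?lt0r_neq0//.
  have -> : (c * a + d * b) * a = c * a * a + d * a * b by ring.
  by rewrite -cross; ring.
have dE : d = (c * a + d * b) / (a ^+ 2 + b ^+ 2) * b.
  apply: (mulIf (lt0r_neq0 ab)); rewrite mulrAC divfK ?lt0r_neq0//.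
  have -> : (c * a + d * b) * b = c * b * a + d * b * b by ring.
  by rewrite cross; ring.
by set s := (_ / _) in cE dE *; move: (s) cE dE => k -> ->; vring.
Qed.

Lemma planar_support_line N m u : K N -> dot m e != 0 \/ dot m f != 0 ->
  (forall Y, K Y -> dot m (Y - N) <= 0) ->
  (exists a b, u = a *: e + b *: f) -> u != 0 -> dot m u = 0 ->
  support_line full_plane K N (line N u).
Proof.
move=> KN m0 mK uef u0 mu; split=> //.
- by exists N, u.
- by exists 0 => //; rewrite scale0r addr0.
(* [w] points into the supporting half-plane. *)
have [w [wef mw]] : exists w, (exists a b, w = a *: e + b *: f) /\ dot m w < 0.
  case: m0 => m0; [exists (- dot m e *: e)|exists (- dot m f *: f)]; split.
  - by exists (- dot m e), 0; rewrite scale0r addr0.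
  - by rewrite dotZr mulNr oppr_lt0 -expr2 exprn_even_gt0.
  - by exists 0, (- dot m f); rewrite scale0r add0r.
  - by rewrite dotZr mulNr oppr_lt0 -expr2 exprn_even_gt0.
have NE : N = O + al N *: e + be N *: f.
  by apply/full_planeP/half_plane_full; have [] := KN.
exists [set x | exists t r : R, 0 <= r /\ x = N + t *: u + r *: w]; split.
- exists N, u, w; split=> //; apply/free2P => a b ab.
  have b0 : b = 0.
    have := congr1 (dot m) ab; rewrite !dotX mu mulr0 add0r => /eqP.
    by rewrite mulf_eq0 (lt_eqF mw) orbF => /eqP.
  split=> //; move: ab; rewrite b0 scale0r addr0 => /eqP.
  by rewrite scaler_eq0 (negbTE u0) orbF => /eqP.
- move=> _ [t [r [_ ->]]]; case: uef => a [b ->]; case: wef => c [d ->].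
  rewrite NE; exists (al N + t * a + r * c), (be N + t * b + r * d); vring.
- move=> Y KY; pose r := dot m (Y - N) / dot m w.
  have YE : Y = O + al Y *: e + be Y *: f.
    by apply/full_planeP/half_plane_full; have [] := KY.
  have [||s sE] := @line_through_kernel m u (Y - N - r *: w) m0 uef u0 mu.
  + case: wef => c [d ->]; rewrite {1}YE {1}NE.
    by exists (al Y - al N - r * c), (be Y - be N - r * d); vring.
  + by rewrite dotDr dotNr dotZr /r divfK ?subrr// lt_eqF.
  exists s, r; split.
    by rewrite /r -mulrNN -invrN mulr_ge0 ?invr_ge0 ?oppr_ge0 ?mK// ltW.
  by rewrite -sE; vring.
Qed.

(* The tangency point maximizes over the section the slope [be / Q] seen from [O],
   where [Q] is a linear form which is positive on [C - O]. *)
Lemma tangency_point_exists : exists M sigma Q,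
  [/\ tangency_point C O half_plane M, K M,
      (forall Y, C Y -> 0 < dot Q (Y - O)), be M = sigma * dot Q (M - O) & 1 <= sigma * dot Q f].
Proof.
have [cC kC _] := hC.
have nCO : ~ C O by move=> CO; apply: (outside ltr01); rewrite scale0r addr0.
have [q [d [q1 d0 qd]]] := separation cC kC (body_neq0 hC) nCO.
pose Q := - q; have Qd Y : C Y -> d <= dot Q (Y - O).
  by move=> /qd; rewrite /Q !dotX; lra.
have Q0 Y : C Y -> 0 < dot Q (Y - O) by move=> /Qd; exact: lt_le_trans.
have Qe : 0 < dot Q e by have := Q0 _ onB; rewrite addrAC subrr add0r.
have Qf : 0 < dot Q f by have := Q0 _ CX; rewrite addrAC subrr add0r.
have contQ : continuous (fun Y => dot Q (Y - O)).
  move=> Y; apply: (@continuous_dot _ _ (fun=> Q) (fun Y => Y - O)); first exact: cst_continuous.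
  by apply: (@cvgB _ _ _ (nbhs Y)); [exact: cvg_id|exact: cvg_cst].
have KX : K (O + f) by [].
have [|Y0 /set_mem KY0 Y0m] := @EVT_max_rV R 3 (fun Y => be Y / dot Q (Y - O)) K (ex_intro _ _ KX) K_compact.
  apply: continuous_in_subspaceT => Y /set_mem[CY _].
  apply: (@cvgM _ _ (nbhs Y)); first exact: cont_be.
  by apply: (@cvgV _ _ (nbhs Y)); [rewrite gt_eqF// Q0|exact: contQ].
pose sigma := be Y0 / dot Q (Y0 - O).
have slope Y : K Y -> be Y <= sigma * dot Q (Y - O).
  move=> KY; have [CY _] := KY; rewrite -ler_pdivrMr ?Q0//.
  by apply: Y0m; exact: mem_set.
have sQf : 1 <= sigma * dot Q f.
  by have := slope _ KX; rewrite beX addrAC subrr add0r.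
have sigma0 : 0 < sigma by rewrite -(pmulr_lgt0 _ Qf); apply: lt_le_trans sQf.
pose T := K `&` [set Y | be Y - sigma * dot Q (Y - O) = 0].
have TP Y : T Y <-> K Y /\ be Y = sigma * dot Q (Y - O).
  by split=> [[KY /= /eqP]|[KY E]]; [rewrite subr_eq0 => /eqP|split=> //=; rewrite E subrr].
have kT : compact T.
  apply: compact_closedI => //.
  apply: (@closed_comp _ _ (fun Y => be Y - sigma * dot Q (Y - O)) [set 0]) => [Y _|].
    apply: (@cvgB _ _ _ (nbhs Y)); first exact: cont_be.
    by apply: (@cvgM _ _ (nbhs Y)); [exact: cvg_cst|exact: contQ].
  exact: closed_eq.
have T0 : T !=set0.
  exists Y0; apply/TP; split=> //; rewrite /sigma divfK// gt_eqF// Q0//.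
  by case: KY0.
have [|M /set_mem TM Mm] := @EVT_min_rV R 3 (fun Y => enorm (Y - O)) T T0 kT.
  apply: continuous_subspaceT => Y.
  apply: (@continuous_comp _ _ _ (fun Y => Y - O) (@enorm R)); last exact: continuous_enorm.
  by apply: (@cvgB _ _ _ (nbhs Y)); [exact: cvg_id|exact: cvg_cst].
have [KM bM] := (TP M).1 TM.
have beT Y : T Y -> 0 < be Y.
  by move=> /TP[[CY _] ->]; rewrite mulr_gt0// Q0.
have coneC Y : C Y -> support_cone C O Y.
  move=> CY; exists Y => //; exists 1; first by rewrite /= in_itv /= ler01.
  by rewrite scale1r addrCA subrr addr0.
(* Moving from [Y] in direction [- e] raises the slope above its maximum, so [Y] is not interior to
   the cone. *)
have T_sub Y : T Y -> (support_ray C O half_plane `&` (boundary C `&` half_plane)) Y.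
  move=> TY; have /TP[[CY PY] bY] := TY.
  have nint : ~ interior (support_cone C O) Y.
    move=> /interior_enormP[r r0 /(_ (Y - (r / enorm e) *: e))].
    have en : 0 < enorm e by rewrite enorm_gt0.
    have -> : Y - (r / enorm e) *: e - Y = - (r / enorm e) *: e by vring.
    rewrite enormZ normrN ger0_norm; last by rewrite divr_ge0// ltW.
    rewrite divfK ?gt_eqF// => /(_ (lexx _))[y Cy [l]]; rewrite /= in_itv /= andbT => l0.
    set k := r / enorm e => E; have k0 : 0 < k by exact: divr_gt0.
    have /half_planeP[b0 YE] := PY.
    have bY0 := beT _ TY.
    have ly : l *: (y - O) = (al Y - k) *: e + be Y *: f.
      by apply: (@addrI _ O); rewrite E {1}YE; vring.
    have lp : 0 < l.
      rewrite lt_neqAle l0 andbT eq_sym; apply/eqP => l00.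
      move: ly; rewrite l00 scale0r => /esym /((free2P e f).1 fr)[_ bz].
      by rewrite bz ltxx in bY0.
    have yE : y = O + ((al Y - k) / l) *: e + (be Y / l) *: f.
      have -> : y = O + l^-1 *: (l *: (y - O)).
        by apply/rowP => i; rewrite !mxE; field; rewrite gt_eqF.
      by rewrite ly; vring.
    have Ky : K y by split=> //; exists ((al Y - k) / l), (be Y / l); split=> //; rewrite divr_ge0// ltW.
    have := slope _ Ky; have lQ : l * dot Q (y - O) = dot Q (Y - O) - k * dot Q e.
      by rewrite -dotZr ly (dot_plane Q PY) !dotX; ring.
    rewrite {1}yE beE ler_pdivrMr// -mulrA (mulrC _ l) lQ bY mulrBr.
    by have := mulr_gt0 sigma0 (mulr_gt0 k0 Qe); lra.
  split; first by split=> //; split=> //; apply: subset_closure; exact: coneC.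
  split=> //; split; first exact: subset_closure.
  by move=> iY; apply: nint; apply: interiorS iY.
(* If the slope at [N] is not maximal, [N - O] is [c *: (M - O)] plus a positive multiple of [e]; a
   scaled copy of the ball around [O + zeta *: e], translated by [c *: (M - O)], is then a
   neighborhood of [N] in the cone. *)
have sub_T N : (support_ray C O half_plane `&` (boundary C `&` half_plane)) N -> T N.
  move=> [[PN [_ nint]] [[/(body_closed hC) CN _] _]]; apply/TP; split=> //.
  apply/eqP; rewrite eq_le slope//= leNgt; apply/negP => lt; apply: nint.
  have bM0 := beT _ TM; have PM : half_plane M by case: KM.
  pose c := be N / be M; pose k := al N - c * al M.
  have /half_planeP[bN0 NE] := PN; have /half_planeP[_ ME] := PM.
  have c0 : 0 <= c by rewrite divr_ge0// ltW.
  have cbM : c * be M = be N by rewrite /c divfK// gt_eqF.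
  have k0 : 0 < k.
    have E1 : c * be M = sigma * (c * al M * dot Q e + c * be M * dot Q f).
      by rewrite {1}bM (dot_plane Q PM); ring.
    move: lt; rewrite (dot_plane Q PN) -cbM {1}E1 ltr_pM2l// ltrD2r ltr_pM2r//.
    by rewrite /k subr_gt0.
  have z0 : 0 < zeta by exact: lt_trans zeta1.
  have kz : 0 < k / zeta by exact: divr_gt0.
  apply/interior_enormP; exists ((k / zeta) * rho); first exact: mulr_gt0.
  move=> y yN; pose w := (k / zeta)^-1 *: (y - N).
  have Cw : C (O + zeta *: e + w).
    apply: ballz; rewrite addrAC subrr add0r enormZ ger0_norm ?invr_ge0 ?(ltW kz)//.
    by rewrite mulrC ler_pdivrMr// mulrC.
  pose s := k / zeta + c; have s0 : 0 < s by rewrite /s; lra.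
  pose p := O + zeta *: e + w + (c / s) *: (M - (O + zeta *: e + w)).
  have Cp : C p.
    apply: body_convex => //; last by case: KM.
      by rewrite divr_ge0// ltW.
    by rewrite ler_pdivrMr// mul1r /s; lra.
  exists p => //; exists s; first by rewrite /= in_itv /= ltW.
  have -> : s *: (p - O) = (s - c) *: (zeta *: e + w) + c *: (M - O).
    rewrite /p; move: (s) (lt0r_neq0 s0) => s1 s10; apply/rowP => i; rewrite !mxE; field.
    by apply/and3P; split=> //; exact: lt0r_neq0.
  rewrite (_ : s - c = k / zeta); last by rewrite /s; ring.
  rewrite scalerDr /w !scalerA divfK ?gt_eqF// mulfV ?gt_eqF// scale1r.
  rewrite {1}ME {1}NE /k -cbM; vring.
exists M, sigma, Q; split=> //.
split; first exact: T_sub.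
by move=> N /sub_T TN; apply: Mm; exact: mem_set.
Qed.

Lemma O_support_ray Q : (forall Y, C Y -> 0 < dot Q (Y - O)) -> support_ray C O half_plane O.
Proof.
move=> Q0; have cO : support_cone C O O.
  by exists (O + e) => //; exists 0; rewrite ?scale0r ?addr0//= in_itv /= lexx.
split; first by exists 0, 0; rewrite !scale0r !addr0.
split; first exact: subset_closure.
move=> /interior_enormP[r r0 /(_ (O - (r / enorm e) *: e))].
have en : 0 < enorm e by rewrite enorm_gt0.
rewrite (_ : O - _ - O = - (r / enorm e) *: e); last by vring.
rewrite enormZ normrN ger0_norm; last by rewrite divr_ge0// ltW.
rewrite divfK ?gt_eqF// => /(_ (lexx _))[y Cy [l]]; rewrite /= in_itv /= andbT => l0 E.
have Qe : 0 < dot Q e by have := Q0 _ onB; rewrite addrAC subrr add0r.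
have := congr1 (dot Q) E; rewrite !dotDr dotNr !dotZr => /addrI E2.
have := mulr_ge0 l0 (ltW (Q0 _ Cy)); rewrite E2 oppr_ge0 leNgt.
by rewrite mulr_gt0// divr_gt0.
Qed.

(** The line of support cut out by [m] must be the one that carries the ray of support, and this ray
    contains [O]. *)
Lemma touching M m u Q : (forall Y, C Y -> 0 < dot Q (Y - O)) ->
  ray_touches C O half_plane M -> K M -> dot m e != 0 \/ dot m f != 0 ->
  (forall Y, K Y -> dot m (Y - M) <= 0) ->
  (exists a b, u = a *: e + b *: f) -> u != 0 -> dot m u = 0 ->
  exists s, O = M + s *: u.
Proof.
move=> Q0 tM KM m0 mK uef u0 mu.
have [L [_ sL uL]] := tM _ is_plane_full half_plane_full.
have /uL E := planar_support_line KM m0 mK uef u0 mu.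
have := sL _ (O_support_ray Q0); rewrite -E => -[s _ <-].
by exists s.
Qed.

Variables (n : V) (t : R).
Hypotheses (nX : normal C (O + f) n) (nt : dot n f = t * dot n e) (t0 : 0 < t) (t1 : t < 1).

Lemma front_slope : rho <= (zeta - t) * - dot n e.
Proof.
have [_ n1 _] := nX; apply: front_dot => //.
by rewrite -(normal_supp hC nX) !dotX nt.
Qed.

Let p0 : 0 < - dot n e.
Proof.
have zt : 0 < zeta - t by move: t1 zeta1; lra.
by rewrite -(pmulr_rgt0 _ zt); apply: lt_le_trans front_slope.
Qed.

(** The slope at [M] is at least that at [X], whence [al M <= 0]. The line of support at [X] passes
    through (t, 0) and (0, 1), and [M] lies on its inner side, whence the last inequality; the two
    imply the middle one. *)
Lemma tangency_point_position M sigma Q : K M -> (forall Y, C Y -> 0 < dot Q (Y - O)) ->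
  be M = sigma * dot Q (M - O) -> 1 <= sigma * dot Q f ->
  [/\ al M <= 0, 1 <= be M & t <= al M + t * be M].
Proof.
move=> KM Q0 bM sQf; have [CM PM] := KM.
have Qe : 0 < dot Q e by have := Q0 _ onB; rewrite addrAC subrr add0r.
have Qf : 0 < dot Q f by have := Q0 _ CX; rewrite addrAC subrr add0r.
have sg : 0 < sigma by rewrite -(pmulr_lgt0 _ Qf); apply: lt_le_trans sQf.
have bM0 : 0 < be M by rewrite bM mulr_gt0// Q0.
have h3 : t <= al M + t * be M.
  have [_ _ /(_ _ CM)] := nX.
  rewrite (_ : M - (O + f) = (M - O) - f); last by vring.
  rewrite dotDr dotNr (dot_plane n PM) nt => h.
  have : (al M + t * be M - t) * dot n e <= 0 by lra.
  by rewrite nmulr_lle0 ?subr_ge0//; move: p0; lra.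
have aM : al M <= 0.
  move: bM; rewrite (dot_plane Q PM) => bM.
  have : sigma * (al M * dot Q e) <= 0.
    have : be M * 1 <= be M * (sigma * dot Q f) by rewrite ler_pM2l.
    by rewrite mulr1 {1}bM; lra.
  by rewrite pmulr_rle0// pmulr_lle0.
split=> //.
have : 0 <= t * (be M - 1) by lra.
by rewrite pmulr_rge0// subr_ge0.
Qed.

(** Otherwise the line of support at [X] with normal [n] would contain [O], whereas it meets l at
    [O + t *: e] with [t > 0]. *)
Lemma tangency_point_neq M Q : (forall Y, C Y -> 0 < dot Q (Y - O)) ->
  ray_touches C O half_plane M -> K M -> M <> O + f.
Proof.
move=> Q0 tM KM E.
have pe : dot n e != 0 by rewrite -oppr_eq0 gt_eqF.
have [|||||s Os] := @touching M n (f - t *: e) Q Q0 tM KM.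
- by left.
- by move=> Y [CY _]; rewrite E; have [_ _] := nX; apply.
- by exists (- t), 1; vring.
- apply/eqP => /eqP; rewrite subr_eq0 => /eqP fe.
  have [] := (free2P e f).1 fr t (-1); first by rewrite {1}fe; vring.
  by move=> _ /eqP; rewrite oppr_eq0 oner_eq0.
- by rewrite !dotX nt subrr.
have := congr1 (dot n) Os; rewrite E !dotX nt subrr mulr0 addr0 => /eqP.
rewrite -subr_eq0 opprD addrA subrr add0r oppr_eq0 mulf_eq0 (negbTE pe) orbF.
by rewrite gt_eqF.
Qed.

Let boundary_C Y : boundary C Y -> C Y.
Proof. by case=> /(body_closed hC). Qed.

(* The linear form [psi] vanishing at [z] and [X] separates [B] from [M], and [X]
   is its only zero on the planar curve. *)
Lemma arc_between_mem M : al M <= 0 -> 1 <= be M -> t <= al M + t * be M -> M <> O + f ->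
  K M -> arc_between (boundary C `&` half_plane) (O + e) M (O + f).
Proof.
move=> aM bM h3 MX [CM PM] A [AG cA AB AM].
pose psi Y := (al Y - zeta) + zeta * be Y.
have cpsi : continuous psi.
  move=> Y; apply: (@cvgD _ _ _ (nbhs Y)).
    by apply: (@cvgB _ _ _ (nbhs Y)); [exact: cont_al|exact: cvg_cst].
  by apply: (@cvgM _ _ (nbhs Y)); [exact: cvg_cst|exact: cont_be].
have pB : psi (O + e) < 0.
  have -> : O + e = O + 1 *: e by rewrite scale1r.
  by rewrite /psi al_line be_line mulr0 addr0 subr_lt0.
have pM : 0 < psi M.
  have zt : 0 < zeta - t by move: t1 zeta1; lra.
  have h : 0 <= (zeta - t) * (be M - 1) by rewrite mulr_ge0 ?subr_ge0// -subr_ge0 ltW.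
  rewrite lt_neqAle; apply/andP; split; last by rewrite /psi; lra.
  apply/eqP => ps; apply: MX.
  have : (zeta - t) * (be M - 1) <= 0 by move: ps; rewrite /psi; lra.
  rewrite pmulr_rle0// subr_le0 => b1.
  have be1 : be M = 1 by apply/eqP; rewrite eq_le b1.
  have al0 : al M = 0 by move: ps; rewrite /psi be1; lra.
  by rewrite (full_planeP (half_plane_full PM)) be1 al0 scale0r addr0 scale1r.
have /connected_intervalP iA : connected (psi @` A).
  by apply: connected_continuous_connected => //; exact: continuous_subspaceT.
have [Y AY pY] : (psi @` A) 0.
  apply: (iA (psi (O + e)) (psi M)); [by exists (O + e)|by exists M|].
  by rewrite !ltW.
have [bY PY] := AG _ AY; have CY := boundary_C bY.
have /(boundary_bodyP _ hC)[m mY] := bY.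
have YE : Y = O + zeta *: e + be Y *: (f - zeta *: e).
  rewrite {1}(full_planeP (half_plane_full PY)) (_ : al Y = zeta - zeta * be Y); first by vring.
  by move: pY; rewrite /psi; lra.
have b0 : 0 <= be Y by have /half_planeP[] := PY.
(* [X] and [Y] are boundary points on one ray from the interior point [O + zeta *: e], hence
   equal. *)
have be1 : be Y = 1.
  apply/eqP; rewrite eq_le; apply/andP; split.
  - have := normal_center_lt nX; have [_ _ /(_ _ CY)] := nX.
    have -> : Y - (O + f) = (1 - be Y) *: (zeta *: e - f) by rewrite {1}YE; vring.
    have -> : O + zeta *: e - (O + f) = zeta *: e - f by vring.
    by rewrite dotZr => h1 h2; rewrite -subr_ge0; move: h1; rewrite nmulr_lle0.
  - have := normal_center_lt mY; have [_ _ /(_ _ CX)] := mY.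
    have -> : O + zeta *: e - Y = - be Y *: (f - zeta *: e) by rewrite {1}YE; vring.
    have -> : O + f - Y = (1 - be Y) *: (f - zeta *: e) by rewrite {1}YE; vring.
    rewrite !dotZr => h1 h2.
    have m0 : 0 < dot m (f - zeta *: e).
      rewrite ltNge; apply/negP => h; move: h2; rewrite ltNge.
      by rewrite mulNr oppr_ge0 mulr_ge0_le0.
    by move: h1; rewrite pmulr_lle0// subr_le0.
have -> : O + f = Y by rewrite YE be1 scale1r; vring.
by [].
Qed.

Section section_curve.
Variables (M Q : V) (sigma k M0 : R) (L : R) (gamma tau : R -> V).
Hypotheses (KM : K M) (Q0 : forall Y, C Y -> 0 < dot Q (Y - O)).
Hypotheses (bM : be M = sigma * dot Q (M - O)) (sQf : 1 <= sigma * dot Q f).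
Hypotheses (touchM : ray_touches C O half_plane M) (L0 : 0 < L).
Let G := boundary C `&` half_plane.
Hypothesis par : natural_C1_parametrization (arc_between G (O + e) M) L gamma tau.
Hypothesis ang : forall s1 s2 : R, s1 \in `[0, L] -> s2 \in `[0, L] ->
  angle (tau s1) (tau s2) <= k * `|s2 - s1|.
Hypothesis M0P : forall y, C y -> enorm (y - O) <= M0.

Let gamma_arc s : 0 <= s <= L -> arc_between G (O + e) M (gamma s).
Proof.
by move=> sL; have [_ <- _ _ _] := par; exists s => //=.
Qed.

Let arc_gamma Y : arc_between G (O + e) M Y -> exists2 s, 0 <= s <= L & gamma s = Y.
Proof.
have [_ <- _ _ _] := par => -[s /=]; rewrite in_itv /= => sL <-.
by exists s.
Qed.

Let gamma_inj s s' : 0 <= s <= L -> 0 <= s' <= L -> gamma s = gamma s' -> s = s'.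
Proof.
move=> sL s'L E; have [inj _ _ _ _] := par.
by apply: inj => //; rewrite inE /= in_itv.
Qed.

Let gammaG s : 0 <= s <= L -> G (gamma s).
Proof.
move=> sL.
have [[A [AG cA AB AM]]|nA] := pselect (exists A : set V,
    [/\ A `<=` G, connected A, A (O + e) & A M]).
  by apply: (AG); apply: (gamma_arc sL).
(* An intersection over no set is the whole space, which the compact image of [gamma] cannot be. *)
have allS Y : arc_between G (O + e) M Y by move=> A hA; case: nA; exists A.
have kS : compact (gamma @` [set` `[0, L]]).
  apply: continuous_compact; last exact: segment_compact.
  exact (@curve_continuous _ _ _ _ _ par).
have [N N0 bN] := compact_bounded kS.
have [_ n1 _] := nX.
have [s' s'L E] := arc_gamma (allS ((N + 1) *: n)).
have : enorm (gamma s') <= N by apply: bN; exists s' => //=; rewrite in_itv.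
by rewrite E enormZ n1 mulr1 ger0_norm; lra.
Qed.

Let gammaC s : 0 <= s <= L -> C (gamma s).
Proof. by move=> /gammaG[/boundary_C]. Qed.

(** If [gamma c] were neither [O + e] nor [M], the image of [J] would be a connected set through
    both that avoids [gamma c], against the minimality of the arc. *)
Let endpoint_aux c (J : set R) : 0 <= c <= L -> connected J -> ~ J c ->
  (forall s, 0 <= s <= L -> s != c -> J s) -> J `<=` [set` `[0, L]] ->
  gamma c = O + e \/ gamma c = M.
Proof.
move=> cL cJ nJc Js JL; apply: contrapT => /not_orP[cB cM].
have endp Y : arc_between G (O + e) M Y -> gamma c <> Y -> (gamma @` J) Y.
  move=> /arc_gamma[s sL E] cY; exists s => //; apply: Js => //.
  by apply/eqP => sc; apply: cY; rewrite -E sc.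
have : (gamma @` J) (gamma c).
  apply: (gamma_arc cL); split.
  - move=> y [s /JL /=]; rewrite in_itv /= => sL <-; exact: gammaG.
  - apply: connected_continuous_connected => //.
    exact: (continuous_subspaceW JL (@curve_continuous _ _ _ _ _ par)).
  - by apply: endp => // A [].
  - by apply: endp => // A [].
move=> [s Jss E]; apply: nJc; have := JL _ Jss; rewrite /= in_itv /= => sL.
by rewrite -(gamma_inj sL cL E).
Qed.

Let endpoint0 : gamma 0 = O + e \/ gamma 0 = M.
Proof.
have zL : 0 <= (0 : R) <= L by rewrite lexx ltW.
apply: (@endpoint_aux 0 [set` `]0, L]]) => //.
- exact/connected_intervalP/interval_is_interval.
- by rewrite /= in_itv /= ltxx.
- by move=> s /andP[s0 sL] sn0; rewrite /= in_itv /= sL andbT lt_neqAle eq_sym sn0.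
- by move=> s /=; rewrite !in_itv /= => /andP[/ltW -> ->].
Qed.

Let endpointL : gamma L = O + e \/ gamma L = M.
Proof.
have zL : 0 <= L <= L by rewrite lexx ltW.
apply: (@endpoint_aux L [set` `[0, L[]) => //.
- exact/connected_intervalP/interval_is_interval.
- by rewrite /= in_itv /= ltxx andbF.
- by move=> s /andP[s0 sL] sn0; rewrite /= in_itv /= s0 lt_neqAle sn0.
- by move=> s /=; rewrite !in_itv /= => /andP[-> /ltW ->].
Qed.

Let within_nonneg (F : R -> R) : {within `[0, L], continuous F} ->
  (forall s, 0 < s -> s < L -> 0 <= F s) -> forall c, 0 <= c <= L -> 0 <= F c.
Proof.
move=> /subspace_continuousP cF F0 c cL; rewrite leNgt; apply/negP => Fc.
have cL' : [set` `[0, L]] c by rewrite /= in_itv.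
have Fc0 : 0 < - F c by rewrite oppr_gt0.
have := cF c cL' => /(@cvgrPdist_lt _ _ _ _)/(_ _ Fc0); rewrite near_withinE => -[d /= d0 hd].
(* A step of proportion [th] from [c] towards the midpoint of [0, L] leads into the open interval,
   even from an end. *)
pose th := Num.min 1 (d / (2 * L)).
have th0 : 0 < th by rewrite lt_min ltr01 divr_gt0// mulr_gt0.
have th1 : th <= 1 by rewrite ge_min lexx.
have thd : th * L < d.
  have : th <= d / (2 * L) by rewrite ge_min lexx orbT.
  by rewrite ler_pdivlMr ?mulr_gt0//; move: d0; lra.
pose s := c + th * (L / 2 - c).
have /andP[c0 cl] := cL.
have Lp := L0.
have s0 : 0 < s.
  have : 0 <= (1 - th) * c by rewrite mulr_ge0// subr_ge0.
  by have := mulr_gt0 th0 Lp; rewrite /s; lra.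
have sL : s < L.
  have : 0 <= (1 - th) * (L - c) by rewrite mulr_ge0 ?subr_ge0.
  by have := mulr_gt0 th0 Lp; rewrite /s; lra.
have scd : `|c - s| < d.
  rewrite (_ : c - s = - (th * (L / 2 - c))); last by rewrite /s; ring.
  rewrite normrN normrM (gtr0_norm th0); apply: le_lt_trans thd.
  by rewrite ler_pM2l// ler_norml; apply/andP; move: Lp c0 cl => *; split; lra.
have := hd s scd; rewrite in_itv /= !ltW// => /(_ isT).
have := F0 s s0 sL; rewrite ltr_norml => h1 /andP[]; rewrite /from_subspace => h2 _; lra.
Qed.

Let dual_orth r : dot es r = 0 -> dot fs r = 0 -> dot e r = 0 /\ dot f r = 0.
Proof.
move=> esr fsr; have g0 := lt0r_neq0 gram_gt0.
have ge (x : R) : gram * (gram^-1 * x) = x by rewrite mulrA mulfV// mul1r.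
have /eqP : gram * dot e r = 0.
  have -> : gram * dot e r = dot e e * (gram * dot es r) + dot e f * (gram * dot fs r).
    by rewrite /es /fs !dotZl !ge !dotX /gram; ring.
  by rewrite esr fsr; ring.
have /eqP : gram * dot f r = 0.
  have -> : gram * dot f r = dot e f * (gram * dot es r) + dot f f * (gram * dot fs r).
    by rewrite /es /fs !dotZl !ge !dotX /gram; ring.
  by rewrite esr fsr; ring.
by rewrite !mulf_eq0 !(negbTE g0) => /eqP -> /eqP ->.
Qed.

(** The component [r] of the tangent orthogonal to the plane defines a form constant along the
    curve, so it annihilates the tangents. *)
Let tau_span s : 0 <= s <= L -> tau s = dot es (tau s) *: e + dot fs (tau s) *: f.
Proof.
move=> sL; have [d1 d2 d3 d4] := dual.
pose r := tau s - (dot es (tau s) *: e + dot fs (tau s) *: f).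
suff rr : dot r (tau s) = 0.
  suff : r = 0 by move/eqP; rewrite subr_eq0 => /eqP.
  have esr : dot es r = 0 by rewrite /r dotDr dotNr dotDr !dotZr d1 d2; ring.
  have fsr : dot fs r = 0 by rewrite /r dotDr dotNr dotDr !dotZr d3 d4; ring.
  have [er fr'] := dual_orth esr fsr.
  apply: dot_eq0; rewrite {2}/r dotDr dotNr dotDr !dotZr rr.
  by rewrite (dotC r e) er (dotC r f) fr'; ring.
have esr : dot es r = 0 by rewrite /r dotDr dotNr dotDr !dotZr d1 d2; ring.
have fsr : dot fs r = 0 by rewrite /r dotDr dotNr dotDr !dotZr d3 d4; ring.
have [er fr'] := dual_orth esr fsr.
have gr s' : 0 <= s' <= L -> dot r (gamma s') = dot r O.
  move=> /gammaG[_ /half_plane_full /full_planeP ->].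
  by rewrite !(dotDr, dotZr) (dotC r e) er (dotC r f) fr'; ring.
have int m : m = r \/ m = - r -> 0 <= dot m (tau s).
  move=> mr; apply: (@within_nonneg (fun s => dot m (tau s))) => //.
    exact: (@tangent_dot_continuous _ _ _ _ _ par).
  move=> s' s'0 s'L; rewrite (@curve_dot_max _ _ _ _ _ par)// => u uL.
  have s'L' : 0 <= s' <= L by rewrite !ltW.
  by case: mr => ->; rewrite ?dotNl !gr.
apply/eqP; rewrite eq_le (int r)// ?andbT; last by left.
by rewrite -oppr_ge0 -dotNl (int (- r))//; right.
Qed.

(** [X] differs from both ends of the arc; the parametrization may run in either direction, hence
    the disjunction. *)
Let params : exists s0 sM, [/\ 0 < s0, s0 < L, gamma s0 = O + f, gamma sM = M &
  (sM = 0 /\ gamma L = O + e) \/ (sM = L /\ gamma 0 = O + e)].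
Proof.
have [aM b1 h3] := tangency_point_position KM Q0 bM sQf.
have MX := tangency_point_neq Q0 touchM KM.
have [s0 /andP[s00 s0L] sX] := arc_gamma (arc_between_mem aM b1 h3 MX KM).
have BX : O + e <> O + f.
  move=> E; have := beX; rewrite -E -(scale1r e) be_line => /eqP.
  by rewrite eq_sym oner_eq0.
have z0 : 0 <= (0 : R) <= L by rewrite lexx ltW.
have zL : 0 <= L <= L by rewrite lexx ltW.
have nL : gamma 0 <> gamma L by move=> /(gamma_inj z0 zL) E; move: L0; rewrite -E ltxx.
have s0n : s0 != 0 /\ s0 != L.
  split; apply/eqP => E; move: sX; rewrite E.
    by case: endpoint0 => -> // /esym.
  by case: endpointL => -> // /esym.
have [s0n0 s0nL] := s0n.
have s0p : 0 < s0 by rewrite lt_neqAle eq_sym s0n0.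
have s0l : s0 < L by rewrite lt_neqAle s0nL.
case: endpoint0 endpointL => [g0|g0] [gL|gL].
- by case: nL; rewrite g0 gL.
- by exists s0, L; split=> //; right.
- by exists s0, 0; split=> //; left.
- by case: nL; rewrite g0 gL.
Qed.

(** [dot (J u) w] is the determinant of [u] and [w] in the coordinates with respect to [e] and
    [f]. *)
Let J u := dot es u *: fs - dot fs u *: es.

Let JE u w : dot (J u) w = dot es u * dot fs w - dot fs u * dot es w.
Proof. by rewrite /J dotDl dotNl (dotZl (dot es u)) (dotZl (dot fs u)). Qed.

(** The section lies on one side of each tangent. Which sign this gives the determinant depends on
    the orientation of [gamma]; the product for two points does not, and it passes to the ends of
    the arc by continuity. *)
Let cross_interior s Y Y' : 0 < s -> s < L -> K Y -> K Y' ->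
  0 <= dot (J (tau s)) (Y - gamma s) * dot (J (tau s)) (Y' - gamma s).
Proof.
move=> s0 sL KY KY'; have sL' : 0 <= s <= L by rewrite !ltW.
have [d1 d2 d3 d4] := dual.
have [bG PG] := gammaG sL'; have /(boundary_bodyP _ hC)[m mG] := bG.
have mtau : dot m (tau s) = 0.
  apply: (curve_dot_max par) => // u /gammaC Cu; have [_ _ /(_ _ Cu)] := mG.
  by rewrite dotDr dotNr subr_le0.
set a := dot es (tau s); set b := dot fs (tau s).
have tE : tau s = a *: e + b *: f by exact: tau_span.
have ab : 0 < a ^+ 2 + b ^+ 2.
  rewrite lt_neqAle addr_ge0 ?sqr_ge0// andbT eq_sym paddr_eq0 ?sqr_ge0//.
  rewrite !sqrf_eq0; apply/negP => /andP[/eqP a0 /eqP b0].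
  have := tangent_unit par sL'; rewrite tE a0 b0 !scale0r addr0 enorm0 => /eqP.
  by rewrite eq_sym oner_eq0.
pose c := a * dot m f - b * dot m e.
have m0 : a * dot m e + b * dot m f = 0 by rewrite -mtau tE !dotX.
have wE Z : half_plane Z -> c * dot (J (tau s)) (Z - gamma s) = (a ^+ 2 + b ^+ 2) * dot m (Z - gamma s).
  move=> /half_plane_full/full_planeP ZE; have /half_plane_full/full_planeP GE := PG.
  rewrite JE -/a -/b.
  have -> : Z - gamma s = (al Z - al (gamma s)) *: e + (be Z - be (gamma s)) *: f.
    by rewrite {1}ZE {1}GE; vring.
  move: (al Z - _) (be Z - _) => x y; rewrite !(dotDr, dotZr) d1 d2 d3 d4 /c.
  apply/eqP; rewrite -subr_eq0; apply/eqP.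
  transitivity (- (a * x + b * y) * (a * dot m e + b * dot m f)); first by ring.
  by rewrite m0 mulr0.
have le0 Z : K Z -> c * dot (J (tau s)) (Z - gamma s) <= 0.
  move=> [CZ PZ]; rewrite wE// pmulr_rle0//; have [_ _] := mG; exact.
have c0 : c != 0.
  apply/eqP => c0; have := wE _ (line_half zeta); rewrite c0 mul0r => /esym/eqP.
  by rewrite mulf_eq0 (gt_eqF ab) (lt_eqF (normal_center_lt mG)).
have c2 : 0 < c ^+ 2 by rewrite exprn_even_gt0.
rewrite -(pmulr_rge0 _ c2).
have -> : forall x y : R, c ^+ 2 * (x * y) = (c * x) * (c * y) by move=> x y; ring.
by rewrite mulr_le0 // le0.
Qed.

Let cross_closed s Y Y' : 0 <= s <= L -> K Y -> K Y' ->
  0 <= dot (J (tau s)) (Y - gamma s) * dot (J (tau s)) (Y' - gamma s).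
Proof.
move=> sL KY KY'.
apply: (@within_nonneg (fun s => dot (J (tau s)) (Y - gamma s) * dot (J (tau s)) (Y' - gamma s))) => //; last first.
  by move=> s' s0 s'L; exact: cross_interior.
have cd m : {within `[0, L], continuous (fun s => dot m (tau s))}.
  exact: (@tangent_dot_continuous _ _ _ _ _ par).
have cc Z : {within `[0, L], continuous (fun s => dot (J (tau s)) (Z - gamma s))}.
  rewrite (_ : (fun s => _) = (fun s => dot es (tau s) * (dot fs Z - dot fs (gamma s)) -
      dot fs (tau s) * (dot es Z - dot es (gamma s)))); last first.
    by apply/funext => r; rewrite JE !(dotDr, dotNr); ring.
  move=> x; apply: (@cvgB _ _ _ (nbhs x)); apply: (@cvgM _ _ (nbhs x)); try exact: cd.
  - by apply: (@cvgB _ _ _ (nbhs x)); [exact: cvg_cst|exact: (@curve_dot_continuous _ _ _ _ _ par)].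
  - by apply: (@cvgB _ _ _ (nbhs x)); [exact: cvg_cst|exact: (@curve_dot_continuous _ _ _ _ _ par)].
by move=> x; apply: (@cvgM _ _ (nbhs x)); exact: cc.
Qed.

(** By [cross_closed] the tangent at [M] is a line of support, so assumption (i) makes it pass
    through [O]. The point [Y1] off the tangent tells on which side the section lies. *)
Let tangent_through_O s : 0 <= s <= L -> gamma s = M -> exists r, M - O = r *: tau s.
Proof.
move=> sL gM; have [d1 d2 d3 d4] := dual.
set u := tau s; have uE : u = dot es u *: e + dot fs u *: f by exact: tau_span.
have u0 : u != 0 by apply: enorm_neq0; exact: (tangent_unit par).
have Je : dot (J u) e = - dot fs u by rewrite JE d1 d3; ring.
have Jf : dot (J u) f = dot es u by rewrite JE d2 d4; ring.
have J0 : dot (J u) e != 0 \/ dot (J u) f != 0.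
  rewrite Je Jf oppr_eq0; apply/orP; rewrite -negb_and; apply/negP => /andP[/eqP x0 /eqP y0].
  by move: u0; rewrite uE x0 y0 !scale0r addr0 eqxx.
have KB : K (O + e) by split=> //; rewrite -(scale1r e); exact: line_half.
have Kz : K (O + zeta *: e) by split.
have KX : K (O + f) by split.
have [Y1 [KY1 g0]] : exists Y, K Y /\ dot (J u) (Y - M) != 0.
  apply: contrapT => /forallNP H.
  have H0 Y : K Y -> dot (J u) Y = dot (J u) M.
    move=> KY; apply/eqP; rewrite -subr_eq0 -dotNr -dotDr; apply: contrapT => /negP h.
    by apply: (H Y).
  have h1 := H0 _ KB; have h2 := H0 _ Kz; have h3 := H0 _ KX.
  rewrite !(dotDr, dotZr) in h1 h2 h3.
  have ze : (zeta - 1) * dot (J u) e = 0 by lra.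
  have e00 : dot (J u) e = 0.
    by move/eqP: ze; rewrite mulf_eq0 subr_eq0 (gt_eqF zeta1) => /eqP.
  have f00 : dot (J u) f = 0 by lra.
  by case: J0; rewrite ?e00 ?f00 eqxx.
pose g := dot (J u) (Y1 - M).
have [|||||r Or] := @touching M (- g *: J u) u Q Q0 touchM KM.
- by rewrite !dotZl !mulf_eq0 oppr_eq0 (negbTE g0).
- move=> Y KY; rewrite dotZl mulNr oppr_le0 /g -gM; exact: cross_closed.
- by exists (dot es u), (dot fs u).
- done.
- by rewrite dotZl JE (mulrC (dot fs u)) subrr mulr0.
exists (- r); rewrite {1}Or; vring.
Qed.

(** [X] is at arc length at least [d] from both ends: from B because [n] separates them by
    [(1 - t) * - dot n e], and from [M] because the tangent there passes through [O], so a short arc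
    would make [n] almost orthogonal to [M - O]. Thus the curve can be followed from [X] in the
    direction in which [n'] increases, by a length proportional to its slope, and the gain is of the
    order of the square of the slope. *)
Lemma curve_gap d h n' : 0 < k -> 0 < d -> d <= (1 - t) * - dot n e ->
  d * (M0 * k) <= t * - dot n e -> 0 < h -> 2 * h <= d -> 2 * (h * k) <= 1 -> enorm n' = 1 ->
  dot n' (f - t *: e) ^+ 2 * h <=
    2 * (supp C n' - dot n' (O + f)) * enorm (f - t *: e) ^+ 2.
Proof.
move=> k0 d0 dB dM h0 hd hk n1'.
have [s0 [sM [s00 s0L gX gM ends]]] := params.
have s0L' : 0 <= s0 <= L by rewrite !ltW.
have z0 : 0 <= (0 : R) <= L by rewrite lexx ltW.
have zL : 0 <= L <= L by rewrite lexx ltW.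
have [_ n1 nC] := nX.
have ntau : dot n (tau s0) = 0.
  apply: (curve_dot_max par) => // u /gammaC Cu; have := nC _ Cu.
  by rewrite gX dotDr dotNr subr_le0.
have farB s : 0 <= s <= L -> gamma s = O + e -> d <= `|s0 - s|.
  move=> sL gB; apply: le_trans (curve_dot_lip par n1 sL s0L').
  apply: (le_trans dB); apply: le_trans (ler_norm _).
  by rewrite gX gB !dotDr nt; lra.
have farM : d <= `|s0 - sM|.
  have sML : 0 <= sM <= L by case: ends => -[->].
  have [r Mr] := tangent_through_O sML gM.
  have [CM _] := KM.
  have rM : `|r| <= M0.
    by have := M0P CM; rewrite Mr enormZ (tangent_unit par sML) mulr1.
  have M00 : 0 < M0.
    apply: lt_le_trans (M0P onB); rewrite enorm_gt0.
    by rewrite addrAC subrr add0r.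
  have lip := tangent_lip par ang sML s0L'.
  have h1 : `|dot n (M - O)| <= M0 * (k * `|s0 - sM|).
    rewrite Mr dotZr normrM; apply: ler_pM => //.
    rewrite -[dot n (tau sM)]subr0 -ntau -dotNr -dotDr.
    exact: le_trans (dot_unit_le _ n1) lip.
  have h2 : t * - dot n e <= `|dot n (M - O)|.
    rewrite -normrN; apply: le_trans (ler_norm _); have := nC _ CM.
    by rewrite !(dotDr, dotNr) nt; lra.
  by rewrite -(ler_pM2r (mulr_gt0 M00 k0)); apply: (le_trans dM); apply: (le_trans h2); rewrite (mulrC `|_|) -mulrA.
have [ds0 dsL] : d <= s0 /\ d <= L - s0.
  case: ends => -[Es gE]; [have := farB L zL gE|have := farB 0 z0 gE]; move: farM; rewrite Es !subr0.
    by rewrite (ger0_norm (ltW s00)) ltr0_norm ?subr_lt0// opprB.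
  by rewrite (ger0_norm (ltW s00)) ltr0_norm ?subr_lt0// opprB.
(* Both vectors lie in the plane and are orthogonal to [n]. *)
have fE : exists r, f - t *: e = r *: tau s0.
  apply: (@line_through_kernel n) => //.
  - by left; rewrite -oppr_eq0 gt_eqF.
  - by exists (dot es (tau s0)), (dot fs (tau s0)); exact: tau_span.
  - by apply: enorm_neq0; exact: (tangent_unit par).
  - by exists (- t), 1; vring.
  - by rewrite !dotDr dotNr dotZr nt subrr.
have [r rE] := fE.
set g := dot n' (tau s0); set delta := supp C n' - _.
have g1 : `|g| <= 1.
  by have := dot_unit_le (tau s0) n1'; rewrite (tangent_unit par).
have key s : 0 < s -> s < L -> (s - s0) * g - k * (s - s0) ^+ 2 <= delta.
  move=> sp sl; have := curve_dot_quadratic L0 par ang n1' s00 s0L sp sl.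
  rewrite ler_norml => /andP[+ _]; rewrite gX -/g.
  have := supp_ub n' hC (gammaC (s := s) _); rewrite /delta => /(_ (introT andP (conj (ltW sp) (ltW sl)))).
  lra.
have hg : `|g| * h < d by have := ler_wpM2r (ltW h0) g1; lra.
(* The step is [s - s0 = g * h]; since [2 * (h * k) <= 1], the quadratic error consumes at most half
   of the linear gain. *)
have key2 : g ^+ 2 * h <= 2 * delta.
  have kk : g ^+ 2 * h - k * (g * h) ^+ 2 <= delta.
    have : `|g * h| < d by rewrite normrM (gtr0_norm h0).
    rewrite ltr_norml => /andP[gd1 gd2].
    have p1 : 0 < s0 + g * h by lra.
    have p2 : s0 + g * h < L by lra.
    have := key _ p1 p2; rewrite (_ : s0 + g * h - s0 = g * h); last by ring.
    by rewrite (_ : g * h * g = g ^+ 2 * h)//; ring.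
  have gh0 : 0 <= g ^+ 2 * h by rewrite mulr_ge0 ?sqr_ge0 ?(ltW h0).
  have : 0 <= g ^+ 2 * h * (1 - 2 * (h * k)) by rewrite mulr_ge0 ?subr_ge0.
  by move: kk; rewrite exprMn; lra.
rewrite rE dotZr enormZ (tangent_unit par)// mulr1 real_normK ?num_real// exprMn.
have -> : r ^+ 2 * g ^+ 2 * h = (g ^+ 2 * h) * r ^+ 2 by ring.
by rewrite ler_wpM2r ?sqr_ge0.
Qed.

End section_curve.
End half_plane.
End plane_sections.

(** * The gap inequality *)

Section gap.
Context {R : realType}.
Local Notation V := 'rV[R]_3.
Implicit Types (n X : V).

(* In the half-plane through [X], the boundary arc around [X] is of class C^{1,1}, with
   uniform constants since [X] stays away from [B] and from the tangency point. *)
Lemma gap (C : set V) (O e : V) (zeta rho k a b : R) :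
  convex_body C -> (forall t, t < 1 -> ~ C (O + t *: e)) -> C (O + e) -> 1 < zeta -> 0 < rho ->
  (forall y, enorm (y - (O + zeta *: e)) <= rho -> C y) ->
  (forall Pi M, half_plane_bounded_by (line O e) Pi ->
    tangency_point C O Pi M -> ray_touches C O Pi M) ->
  0 < k ->
  (forall Pi M, half_plane_bounded_by (line O e) Pi -> tangency_point C O Pi M ->
    C1_with_curvature_le (arc_between (boundary C `&` Pi) (O + e) M) k) ->
  0 < a -> b < 1 ->
  exists2 c, 0 < c & forall X n t, a <= t -> t <= b -> normal C X n ->
    dot n X = dot n (O + t *: e) -> forall n', enorm n' = 1 ->
    c * (supp C n' - dot n' (O + t *: e)) ^+ 2 <= supp C n' - dot n' X.
Proof.
move=> hC outside onB zeta1 rho0 ballz touch k0 curv a0 b1.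
have [M M_ bM] := body_bounded hC.
pose M0 := M + enorm O.
have M00 : 0 < M0 by have := enorm_ge0 O; rewrite /M0; lra.
have M0P y : C y -> enorm (y - O) <= M0.
  by move=> /bM yM; have := enormD y (- O); rewrite enormN /M0; lra.
have eM : enorm e <= M0 by have := M0P _ onB; rewrite addrAC subrr add0r.
have z0 : 0 < zeta by lra.
(* [p] will bound [- dot n e] from below; [d] and [h] are then admissible in [curve_gap] for all [t]
   in [a, b]. *)
pose p := rho / zeta; have p0 : 0 < p by exact: divr_gt0.
pose d := Num.min ((1 - b) * p) (a * p / (M0 * k)).
have Mk : 0 < M0 * k by exact: mulr_gt0.
have d0 : 0 < d by rewrite lt_min !mulr_gt0 ?invr_gt0// subr_gt0.
pose h := Num.min (d / 2) (1 / (2 * k)).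
have h0 : 0 < h by rewrite lt_min !divr_gt0// mulr_gt0.
(* From [delta <= 2 * M0] and [g ^+ 2 <= delta * (8 * M0 ^+ 2 / h)] it follows that
   [2 * delta ^+ 2 + 2 * g ^+ 2 <= delta * c]. *)
pose c := 4 * M0 + 16 * M0 ^+ 2 / h.
have c0 : 0 < c by rewrite addr_gt0 ?mulr_gt0 ?invr_gt0// exprn_gt0.
exists c^-1; first by rewrite invr_gt0.
move=> X n t at_ tb nX nXt n' n'1; have [CX n1 _] := nX.
have t0 : 0 < t by exact: lt_le_trans at_.
have t1 : t < 1 by exact: le_lt_trans b1.
have pn : p <= - dot n e.
  have fd : rho <= (zeta - t) * - dot n e.
    by apply: (front_dot hC rho0 ballz) => //; rewrite -nXt (normal_supp hC nX).
  have pp : 0 < - dot n e.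
    have zt : 0 < zeta - t by lra.
    by rewrite -(pmulr_rgt0 _ zt) (lt_le_trans rho0).
  by rewrite ler_pdivrMr//; apply: (le_trans fd); rewrite mulrC ler_pM2l//; lra.
pose f := X - O; have XE : X = O + f by rewrite /f addrC subrK.
have nt : dot n f = t * dot n e by move: nXt; rewrite XE !dotX; lra.
(* If [f] were parallel to [e], [X] would be the point [O + t *: e], which is outside [C]. *)
have fr : free [:: e; f].
  apply/free2P => x y xy.
  have [y0|y0] := eqVneq y 0.
    split=> //; move/eqP: xy; rewrite y0 scale0r addr0 scaler_eq0 => /orP[/eqP//|/eqP e0].
    by move: pn; rewrite e0 dot0r; lra.
  have fE : f = (- (x / y)) *: e.
    have -> : f = y^-1 *: (x *: e + y *: f) - (x / y) *: e.
      by apply/rowP => i; rewrite !mxE; field.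
    by rewrite xy scaler0 sub0r scaleNr.
  case: (outside _ t1); suff -> : O + t *: e = X by [].
  rewrite XE fE; congr (_ + _ *: _); move: nt; rewrite fE dotZr => /mulIf -> //.
  by rewrite -oppr_eq0 gt_eqF//; lra.
have CX' : C (O + f) by rewrite -XE.
have [T [sigma [Q [TT KT Q0 bT sQ]]]] := tangency_point_exists hC outside onB zeta1 rho0 ballz fr CX'.
have hp := half_plane_bounded O fr.
have [L [gamma [tau [L0 par ang]]]] := curv _ _ hp TT.
have nX' : normal C (O + f) n by rewrite -XE.
have hg : dot n' (f - t *: e) ^+ 2 * h <=
    2 * (supp C n' - dot n' (O + f)) * enorm (f - t *: e) ^+ 2.
  apply: (curve_gap hC outside onB zeta1 rho0 ballz fr CX' nX' nt t0 t1 KT Q0 bT sQ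
    (touch _ _ hp TT) L0 par ang M0P k0 d0) => //.
  - have : d <= (1 - b) * p by rewrite ge_min lexx.
    move/le_trans; apply; apply: ler_pM; lra.
  - rewrite -ler_pdivlMr//; have : d <= a * p / (M0 * k) by rewrite ge_min lexx orbT.
    move/le_trans; apply; rewrite ler_pM2r ?invr_gt0//.
    by apply: ler_pM; lra.
  - have : h <= d / 2 by rewrite ge_min lexx.
    by move: (h) (d) => *; lra.
  - have : h <= 1 / (2 * k) by rewrite ge_min lexx orbT.
    by rewrite ler_pdivlMr ?mulr_gt0//; lra.
rewrite -XE in hg.
set delta := supp C n' - dot n' X in hg *.
have dge : 0 <= delta by rewrite subr_ge0 supp_ub.
have dle : delta <= 2 * M0.
  have [y Cy yE] := supp_att n' hC.
  rewrite /delta -yE -dotNr -dotDr; apply: (le_trans (le_trans (ler_norm _) (dot_unit_le _ n'1))).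
  have := enormB_le y O X; have := M0P _ Cy; have := M0P _ CX; rewrite (enormBC O X); lra.
have ell : enorm (f - t *: e) <= 2 * M0.
  have := enormD f (- (t *: e)); rewrite enormN enormZ gtr0_norm//.
  have := M0P _ CX; rewrite -/f; have : t * enorm e <= 1 * M0 by apply: ler_pM; rewrite ?enorm_ge0//; lra.
  lra.
have ell2 : enorm (f - t *: e) ^+ 2 <= 4 * M0 ^+ 2.
  by rewrite (_ : 4 * M0 ^+ 2 = (2 * M0) ^+ 2) ?ler_pXn2r ?nnegrE ?enorm_ge0// ?mulr_ge0 ?(ltW M00)//; ring.
rewrite mulrC ler_pdivrMr//.
set g := dot n' (f - t *: e) in hg.
have -> : supp C n' - dot n' (O + t *: e) = delta + g.
  by rewrite /delta /g /f !dotX; ring.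
have g2 : g ^+ 2 <= delta * (8 * M0 ^+ 2 / h).
  rewrite -ler_pdivlMr// in hg; apply: (le_trans hg).
  rewrite !mulrA ler_pM2r ?invr_gt0//.
  have := ler_wpM2l dge ell2; lra.
have d2 : delta ^+ 2 <= delta * (2 * M0) by rewrite expr2 ler_wpM2l.
have cE : delta * c = delta * (2 * M0) * 2 + delta * (8 * M0 ^+ 2 / h) * 2.
  by rewrite /c; ring.
rewrite cE; move: g2 d2; move: (delta * (8 * _ / _)) (delta * (2 * _)) => u v.
have : (delta + g) ^+ 2 <= 2 * delta ^+ 2 + 2 * g ^+ 2.
  by move: (delta) => x; have := sqr_ge0 (x - g); rewrite sqrrB sqrrD; lra.
by lra.
Qed.

End gap.

(** * Lipschitz slopes and their primitives *)

Section slopes.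
Context {R : realType}.
Local Notation mu := (@lebesgue_measure R).
Implicit Types (g : R -> R) (x y : R).

Definition lipschitz (c : R) g := forall x y, `|g x - g y| <= c * `|x - y|.

Lemma lipschitz_continuous c g : lipschitz c g -> continuous g.
Proof.
move=> gl x; apply/(@cvgrPdist_lt _ _ _ (nbhs x)) => e e0.
have c1 : 0 < `|c| + 1 by have := normr_ge0 c; lra.
near=> y; apply: (le_lt_trans (gl x y)).
apply: (@le_lt_trans _ _ ((`|c| + 1) * `|x - y|)).
  by apply: ler_wpM2r => //; have := ler_norm c; lra.
rewrite mulrC -ltr_pdivlMr//; near: y.
by apply: cvgr_dist_lt => //; exact: divr_gt0.
Unshelve. all: by end_near. Qed.

(** Both integrals start at 0, so that the function is differentiable on both sides of 1 / 4, where
    it is normalized. *)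
Definition primitive g x : R :=
  1 / 4 + (\int[mu]_(t in `[0, x]) g t - \int[mu]_(t in `[0, 1 / 4]) g t).

Lemma primitive_start g : primitive g (1 / 4) = 1 / 4.
Proof. by rewrite /primitive subrr addr0. Qed.

Lemma primitive_derive c g x : lipschitz c g -> 0 < x -> x < 2 ->
  is_derive x 1 (primitive g) (g x).
Proof.
move=> gl x0 x2; have cg := lipschitz_continuous gl.
have ig : mu.-integrable `[0, 2] (EFin \o g).
  apply: continuous_compact_integrable; first exact: segment_compact.
  by apply: continuous_subspaceT; exact: cg.
have [dF FE] := continuous_FTC1_closed x2 ig x0 (cg x).
have -> : primitive g = (fun x => \int[mu]_(t in `[0, x]) g t) + cst (1 / 4 - \int[mu]_(t in `[0, 1 / 4]) g t).
  by apply/funext => y; rewrite /primitive /= fctE /=; ring.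
rewrite -[X in is_derive _ _ _ X]addr0; apply: is_deriveD.
by split; [exact: dF|rewrite -derive1E FE].
Qed.

Lemma primitive_mvt c g x y : lipschitz c g -> 0 < x -> x <= y -> y < 2 ->
  exists2 w, x <= w <= y & primitive g y - primitive g x = g w * (y - x).
Proof.
move=> gl x0 xy y2.
have dF w : x <= w <= y -> is_derive w 1 (primitive g) (g w).
  by move=> /andP[xw wy]; apply: (primitive_derive gl); lra.
have [|w wxy wE] := @MVT_segment R (primitive g) g x y xy (fun w h => dF w (subset_itv_oo_cc h)).
  apply: derivable_within_continuous => w; rewrite in_itv /= => wxy.
  exact: (@ex_derive _ _ _ _ _ _ _ (dF w wxy)).
by exists w => //; rewrite in_itv in wxy.
Qed.

Lemma lipschitz_const_ge0 c g : lipschitz c g -> 0 <= c.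
Proof.
by move=> /(_ 1 0); rewrite subr0 normr1 mulr1; apply: le_trans.
Qed.

Lemma primitive_taylor c g x y : lipschitz c g -> 0 < x -> x < 2 -> 0 < y -> y < 2 ->
  `|primitive g y - primitive g x - g x * (y - x)| <= c * (y - x) ^+ 2.
Proof.
move=> gl x0 x2 y0 y2; have c0 := lipschitz_const_ge0 gl.
have key w : `|w - x| <= `|y - x| ->
    `|(g w - g x) * (y - x)| <= c * (y - x) ^+ 2.
  move=> h; rewrite normrM -[in leRHS]real_normK ?num_real//.
  rewrite expr2 mulrA; apply: ler_wpM2r => //.
  by apply: (le_trans (gl w x)); apply: ler_wpM2l.
have [xy|yx] := leP x y.
  have [w /andP[xw wy] ->] := primitive_mvt gl x0 xy y2.
  by rewrite -mulrBl; apply: key; rewrite !ger0_norm; lra.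
have [w /andP[yw wx] E] := primitive_mvt gl y0 (ltW yx) x2.
have -> : primitive g y - primitive g x = g w * (y - x) by rewrite -opprB E; ring.
by rewrite -mulrBl; apply: key; rewrite !ler0_norm; lra.
Qed.

(* Slopes of the profiles [primitive g], which replace the intercepts of the planes
   of support of [C]: they are kept up to [1 / 4] and undergo a homothety from
   [3 / 4] on. *)
Definition admissible (eta : R) g :=
  [/\ lipschitz (2 * eta) g, forall x, x <= 1 / 4 -> g x = 1,
      forall x, 3 / 4 <= x -> g x = g (3 / 4) &
      forall x, 1 / 2 <= g x /\ g x <= 1 + eta].

Section admissible.
Variables (eta : R) (g : R -> R).
Hypothesis ag : admissible eta g.

Let gl : lipschitz (2 * eta) g.
Proof. by case: ag. Qed.

Lemma primitive_high x y : 3 / 4 <= x -> 3 / 4 <= y -> x < 2 -> y < 2 ->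
  primitive g y - primitive g x = g (3 / 4) * (y - x).
Proof.
wlog xy : x y / x <= y.
  move=> H bx by_ x2 y2; case: (leP x y) => [xy|/ltW yx]; first exact: H.
  by rewrite -opprB (H y x)//; ring.
move=> bx by_ x2 y2; have [_ _ gb _] := ag.
have [|w /andP[xw _] ->] := primitive_mvt gl _ xy y2; first lra.
by rewrite gb//; lra.
Qed.

Lemma primitive_growth x y : 0 < x -> x <= y -> y < 2 ->
  (y - x) / 2 <= primitive g y - primitive g x <= (1 + eta) * (y - x).
Proof.
move=> x0 xy y2; have [_ _ _ gb] := ag.
have [w _ ->] := primitive_mvt gl x0 xy y2; have [g1 g2] := gb w.
apply/andP; split; last by apply: ler_wpM2r => //; lra.
by rewrite mulrC; apply: ler_wpM2r; lra.
Qed.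

Lemma primitive_bounds x : 1 / 4 <= x -> x <= 1 -> 1 / 4 <= primitive g x <= 1 + eta.
Proof.
move=> ax x1; have p0 : 0 < (1 / 4 : R) by lra.
have x2 : x < 2 by lra.
have := primitive_growth p0 ax x2.
move=> /andP[]; rewrite primitive_start => h1 h2.
have := lipschitz_const_ge0 gl => e0.
have : 0 <= eta * (1 - (x - 1 / 4)) by apply: mulr_ge0; lra.
by move=> h3; apply/andP; split; lra.
Qed.

End admissible.

Lemma primitive1 x : 0 < x -> x < 2 -> primitive (cst 1) x = x.
Proof.
move=> x0 x2; have l1 : lipschitz 0 (cst 1 : R -> R).
  by move=> ? ?; rewrite subrr normr0 mul0r.
have [xa|/ltW ax] := leP x (1 / 4).
  have [|w _] := primitive_mvt l1 x0 xa; first lra.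
  by rewrite primitive_start /= mul1r; lra.
have [|w _] := primitive_mvt l1 _ ax x2; first lra.
by rewrite primitive_start /= mul1r; lra.
Qed.

End slopes.

(** * Bodies bounded by displaced planes of support *)

Section profile_bodies.
Context {R : realType}.
Local Notation V := 'rV[R]_3.
Implicit Types (n m X Y xi : V) (g : R -> R) (s t x : R).
Variables (C : set V) (O e : V).

(* [O + intercept n *: e] lies on the plane of support with outer normal [n]. *)
Definition intercept n : R := (supp C n - dot n O) / dot n e.

(** Negative exactly when the plane of support with outer normal [n] strictly separates [O + t *: e]
    from [C]. *)
Definition side t n : R := supp C n - dot n (O + t *: e).

Definition profile_supp g n : R :=
  if side (1 / 4) n < 0 then dot n (O + primitive g (intercept n) *: e) else supp C n.

(* Each plane of support of [C] with intercept [x > 1 / 4], i.e. separating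
   [O + (1 / 4) *: e] from [C], is moved parallelly to the intercept [primitive g x]. *)
Definition profile_body g : set V := [set y | forall n, dot n y <= profile_supp g n].

(* The characteristic point of the family of displaced planes which corresponds to the
   contact point [X] of [C] with its plane of support of normal [n]. *)
Definition contact g n X : V :=
  let x := if side (1 / 4) n < 0 then intercept n else 1 / 4 in
  O + primitive g x *: e + g x *: (X - (O + x *: e)).

Variables (zeta rho c0 eta : R).
Hypotheses (hC : convex_body C) (onB : C (O + e)) (zeta1 : 1 < zeta) (rho0 : 0 < rho).
Hypothesis ballz : forall y, enorm (y - (O + zeta *: e)) <= rho -> C y.
Hypothesis c00 : 0 < c0.
Hypothesis gapC : forall X n t, 1 / 4 <= t -> t <= 3 / 4 -> normal C X n ->
  dot n X = dot n (O + t *: e) -> forall n', enorm n' = 1 ->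
  c0 * (supp C n' - dot n' (O + t *: e)) ^+ 2 <= supp C n' - dot n' X.
Hypotheses (eta0 : 0 < eta) (eta1 : eta <= 1 / 10) (etaz : 1 + eta < zeta).
Hypothesis etac : 4 * eta * zeta <= c0 * rho.

Lemma sideE t n : side t n = supp C n - dot n O - t * dot n e.
Proof. by rewrite /side !(dotDr, dotZr); ring. Qed.

Lemma side_continuous t : continuous (side t).
Proof.
move=> n; apply: (@cvgB _ _ _ (nbhs n)); first exact: continuous_supp.
by apply: (@continuous_dot _ _ idfun (fun=> O + t *: e)); [exact: cvg_id|exact: cst_continuous].
Qed.

Lemma side_root t n n' : side t n * side t n' <= 0 -> exists s,
  [/\ 0 <= s, s <= 1 & side t (n + s *: (n' - n)) = 0].
Proof.
set f := side t => ff; pose m s := n + s *: (n' - n).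
have mc : continuous m.
  move=> s; apply: (@cvgD _ _ _ (nbhs s)); first exact: cvg_cst.
  by apply: (cvgZ (s := idfun) (f := fun=> n' - n)); [exact: cvg_id|exact: cvg_cst].
have m0 : m 0 = n by rewrite /m scale0r addr0.
have m1 : m 1 = n' by rewrite /m scale1r addrC subrK.
have [||s] := @IVT R (f \o m) 0 1 0 ler01.
- by apply: continuous_subspaceT => s; apply: continuous_comp; [exact: mc|exact: side_continuous].
- rewrite /= m0 m1 ge_min le_max; have [f0|] := eqVneq (f n) 0; first by rewrite f0 lexx.
  rewrite neq_lt => /orP[h|h].
    by move: ff; rewrite nmulr_rle0// => h'; rewrite (ltW h) h' orbT.
  by move: ff; rewrite pmulr_rle0// => h'; rewrite (ltW h) h' orbT.
by rewrite in_itv /= => /andP[s0 s1] sm; exists s.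
Qed.

Let suppB n : dot n O + dot n e <= supp C n.
Proof. by rewrite -dotDr; exact: supp_ub. Qed.

Let suppz n : dot n O + zeta * dot n e + rho * enorm n <= supp C n.
Proof. by have := supp_ball n hC rho0 ballz; rewrite !(dotDr, dotZr). Qed.

(** The ball around [O + zeta *: e] bounds [- dot n e] from below, and the point [O + e] of [C]
    bounds the intercept by 1. *)
Lemma frontP n : n != 0 -> side (1 / 4) n <= 0 ->
  [/\ dot n e < 0, rho * enorm n <= zeta * - dot n e, 1 / 4 <= intercept n, intercept n <= 1 &
   supp C n = dot n (O + intercept n *: e)].
Proof.
move=> n0; rewrite sideE => sn; have := suppz n; have := suppB n => hB hz.
have rn : 0 < rho * enorm n by rewrite mulr_gt0// enorm_gt0.
have ne : dot n e < 0.
  have : (zeta - 1 / 4) * dot n e < 0 by lra.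
  by rewrite pmulr_rlt0//; move: zeta1; lra.
have ie : intercept n * dot n e = supp C n - dot n O by rewrite /intercept divfK ?lt_eqF.
split=> //.
- lra.
- rewrite -(ler_nM2r ne); lra.
- rewrite -(ler_nM2r ne); lra.
- rewrite dotDr dotZr ie; ring.
Qed.

Lemma side_intercept t n : n != 0 -> side (1 / 4) n <= 0 -> side t n = (intercept n - t) * dot n e.
Proof.
move=> n0 sn; have [ne _ _ _ sE] := frontP n0 sn.
by rewrite sideE {1}sE !(dotDr, dotZr); ring.
Qed.

Let side_neq0 n t : side t n != 0 -> n != 0.
Proof.
apply: contraNneq => ->; have [x _ sx] := supp_att 0 hC.
by rewrite /side -sx !dot0l subrr.
Qed.

Let intercept_quarter n : n != 0 -> side (1 / 4) n = 0 -> intercept n = 1 / 4.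
Proof.
move=> n0 sn; have sn' : side (1 / 4) n <= 0 by rewrite sn.
have [ne _ _ _ _] := frontP n0 sn'; move: sn; rewrite side_intercept// => /eqP.
by rewrite mulf_eq0 (lt_eqF ne) orbF subr_eq0 => /eqP.
Qed.

Lemma profile_supp_back g n : 0 <= side (1 / 4) n -> profile_supp g n = supp C n.
Proof. by move=> sn; rewrite /profile_supp ltNge sn. Qed.

Lemma profile_supp_front g n : n != 0 -> side (1 / 4) n <= 0 ->
  profile_supp g n = dot n (O + primitive g (intercept n) *: e).
Proof.
move=> n0; rewrite le_eqVlt => /orP[/eqP sn|]; last by rewrite /profile_supp => ->.
have sn' : side (1 / 4) n <= 0 by rewrite sn.
have [_ _ _ _ sE] := frontP n0 sn'.
by rewrite profile_supp_back ?sn// {1}sE intercept_quarter// primitive_start.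
Qed.

Lemma contact_back g n X : g (1 / 4) = 1 -> 0 <= side (1 / 4) n -> contact g n X = X.
Proof.
move=> g1 sn; rewrite /contact ltNge sn /= primitive_start g1 scale1r; vring.
Qed.

Lemma contact_front g n X : n != 0 -> side (1 / 4) n <= 0 ->
  contact g n X =
  O + primitive g (intercept n) *: e + g (intercept n) *: (X - (O + intercept n *: e)).
Proof.
move=> n0; rewrite le_eqVlt => /orP[/eqP sn|sn]; last by rewrite /contact sn.
by rewrite /contact sn ltxx (intercept_quarter n0 sn).
Qed.

Section profile.
Variable g : R -> R.
Hypothesis ag : admissible eta g.

Let Phi := primitive g.

Let gl : lipschitz (2 * eta) g. Proof. by case: ag. Qed.
Let g1 : g (1 / 4) = 1. Proof. by have [_ h _ _] := ag; apply: h. Qed.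
Let gge x : 1 / 2 <= g x. Proof. by have [_ _ _ h] := ag; case: (h x). Qed.
Let g0 x : 0 < g x. Proof. by have := gge x; lra. Qed.

Lemma dot_contact n X : dot n X = supp C n -> dot n (contact g n X) = profile_supp g n.
Proof.
move=> nX; have [sn|sn] := leP 0 (side (1 / 4) n).
  by rewrite contact_back// profile_supp_back.
have n0 : n != 0 by apply: (side_neq0 (t := 1 / 4)); rewrite lt_eqF.
have [_ _ _ _ sE] := frontP n0 (ltW sn).
rewrite (contact_front _ _ n0 (ltW sn)) (profile_supp_front _ n0 (ltW sn)).
have dn : dot n (X - (O + intercept n *: e)) = 0 by rewrite dotDr dotNr nX {1}sE subrr.
by rewrite (dotDr (_ + _)) (dotZr (g _)) dn mulr0 addr0.
Qed.

(** If all pairs are compatible, the contact points lie in [profile_body g], so each displaced plane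
    touches it. *)
Definition compatible n n' := forall X, C X -> dot n X = supp C n ->
  dot n' (contact g n X) <= profile_supp g n'.

Lemma compatible_back n n' : 0 <= side (1 / 4) n -> 0 <= side (1 / 4) n' -> compatible n n'.
Proof.
by move=> sn sn' X CX _; rewrite contact_back// profile_supp_back// supp_ub.
Qed.

(** The excess over the plane of [n'] is a first-order Taylor remainder of [Phi] minus a multiple of
    the gap of [C]. *)
Let dot_contact_front n n' X : n != 0 -> n' != 0 -> side (1 / 4) n <= 0 -> side (1 / 4) n' <= 0 ->
  let x := intercept n in let x' := intercept n' in
  dot n' (contact g n X) - profile_supp g n' =
    - dot n' e * (Phi x' - Phi x - g x * (x' - x)) - g x * (supp C n' - dot n' X).
Proof.
move=> n0 n'0 sn sn' x x'; have [_ _ _ _ sE] := frontP n'0 sn'.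
rewrite (contact_front _ _ n0 sn) (profile_supp_front _ n'0 sn') sE -/x -/x' -/Phi.
by rewrite !(dotDr, dotNr, dotZr); ring.
Qed.

Let gap_homogeneous n X t n' : C X -> n != 0 -> dot n X = supp C n ->
  1 / 4 <= t -> t <= 3 / 4 -> supp C n = dot n (O + t *: e) ->
  c0 * side t n' ^+ 2 <= enorm n' * (supp C n' - dot n' X).
Proof.
move=> CX n0 nX ta tb nt; have [->|n'0] := eqVneq n' 0.
  have [x _ sx] := supp_att 0 hC.
  by rewrite /side -sx !dot0l subrr expr0n mulr0 enorm0 mul0r.
have nn : 0 < enorm n by rewrite enorm_gt0.
have nn' : 0 < enorm n' by rewrite enorm_gt0.
pose m := (enorm n)^-1 *: n; pose m' := (enorm n')^-1 *: n'.
have mX : normal C X m.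
  apply: supp_normal => //; first exact: enorm_normalize.
  by rewrite /m dotZl suppZ// ?invr_ge0 ?(ltW nn)// nX.
have mt : dot m X = dot m (O + t *: e) by rewrite /m !dotZl nX nt.
have := gapC ta tb mX mt (enorm_normalize n'0).
rewrite suppZ ?invr_ge0 ?(ltW nn')// !dotZl -!mulrBr -/(side t n') exprMn => h.
rewrite -(ler_pM2l (_ : 0 < (enorm n')^-1 ^+ 2)) ?exprn_gt0 ?invr_gt0//.
rewrite mulrCA; apply: (le_trans h).
by rewrite mulrA expr2 -(mulrA _ _ (enorm n')) mulVf ?gt_eqF// mulr1.
Qed.

(** After division by [- dot n' e], the remainder is at most [2 * eta * (x' - x) ^+ 2] and the gap
    at least [c0 * rho / zeta * (x' - x) ^+ 2]; as [g x >= 1 / 2], the gap wins by [etac]. *)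
Lemma compatible_middle n n' : n != 0 -> n' != 0 -> side (1 / 4) n <= 0 -> 0 <= side (3 / 4) n ->
  side (1 / 4) n' <= 0 -> compatible n n'.
Proof.
move=> n0 n'0 sa sb sn' X CX nX; rewrite -subr_le0 dot_contact_front//.
have [ne _ xa x1 sE] := frontP n0 sa; have [n'e n'r x'a x'1 sE'] := frontP n'0 sn'.
set x := intercept n in xa x1 sE *; set x' := intercept n' in x'a x'1 sE' *.
have xb : x <= 3 / 4.
  by move: sb; rewrite side_intercept// -/x nmulr_lge0// subr_le0.
have := gap_homogeneous n' CX n0 nX xa xb sE; rewrite side_intercept// -/x'.
set d := supp C n' - dot n' X => hg.
have := @primitive_taylor _ _ _ x x' gl; rewrite -/Phi.
move=> /(_ _ _ _ _)/(le_trans (ler_norm _)) ht.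
have {}ht : Phi x' - Phi x - g x * (x' - x) <= 2 * eta * (x' - x) ^+ 2 by apply: ht; lra.
rewrite subr_le0; set p := - dot n' e in n'r *; have p0 : 0 < p by rewrite oppr_gt0.
apply: (le_trans (ler_wpM2l (ltW p0) ht)).
have d0 : 0 <= d by rewrite subr_ge0 supp_ub.
apply: (@le_trans _ _ (1 / 2 * d)); last by rewrite ler_wpM2r.
have K0 : 0 < c0 * rho by rewrite mulr_gt0.
have hg' : c0 * p ^+ 2 * (x' - x) ^+ 2 <= enorm n' * d.
  by apply: le_trans hg; rewrite exprMn /p sqrrN; move: c00; lra.
have h1 : rho * (c0 * p ^+ 2 * (x' - x) ^+ 2) <= zeta * p * d.
  apply: (le_trans (ler_wpM2l (ltW rho0) hg')); rewrite mulrA.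
  exact: ler_wpM2r.
have w0 : 0 <= p ^+ 2 * (x' - x) ^+ 2 by rewrite mulr_ge0 ?sqr_ge0.
have h2 := ler_wpM2r w0 etac.
have zp : 0 < zeta * p by rewrite mulr_gt0//; move: zeta1; lra.
rewrite -(ler_pM2l zp).
have -> : zeta * p * (p * (2 * eta * (x' - x) ^+ 2)) =
   1 / 2 * (4 * eta * zeta * (p ^+ 2 * (x' - x) ^+ 2)) by field.
have -> : zeta * p * (1 / 2 * d) = 1 / 2 * (zeta * p * d) by ring.
rewrite ler_pM2l//; apply: (le_trans h2).
by apply: le_trans h1; rewrite le_eqVlt; apply/orP; left; apply/eqP; ring.
Qed.

Let side_far n : side (3 / 4) n <= 0 -> side (1 / 4) n <= 0.
Proof. by rewrite !sideE; have := suppB n; lra. Qed.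

(** Beyond 3 / 4 the primitive is affine, so the Taylor remainder vanishes. *)
Lemma compatible_far n n' : n != 0 -> n' != 0 -> side (3 / 4) n <= 0 -> side (3 / 4) n' <= 0 ->
  compatible n n'.
Proof.
move=> n0 n'0 sb sb' X CX nX; have sa := side_far sb; have sa' := side_far sb'.
rewrite -subr_le0 dot_contact_front//.
have [ne _ _ x1 _] := frontP n0 sa; have [n'e _ _ x'1 _] := frontP n'0 sa'.
have xb : 3 / 4 <= intercept n.
  by move: sb; rewrite side_intercept// nmulr_lle0// subr_ge0.
have x'b : 3 / 4 <= intercept n'.
  by move: sb'; rewrite side_intercept// nmulr_lle0// subr_ge0.
have [_ _ gb _] := ag.
rewrite (primitive_high ag xb x'b) 1?(gb _ xb); [|lra|lra].
by rewrite subrr mulr0 sub0r oppr_le0 mulr_ge0 ?(ltW (g0 _))// subr_ge0 supp_ub.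
Qed.

Let Phi_zeta n : n != 0 -> side (1 / 4) n <= 0 -> 1 / 4 <= Phi (intercept n) <= 1 + eta.
Proof.
move=> n0 sn; have [_ _ xa x1 _] := frontP n0 sn.
exact: (primitive_bounds ag).
Qed.

(** The segment joining opposite normals passes through 0, where [compatible_bridge] finds no normal
    to use. Instead, [O + zeta *: e] serves as a point of comparison: displaced intercepts are at
    most [1 + eta < zeta]. *)
Let compatible_opposite n r : n != 0 -> 0 < r -> compatible n (- r *: n).
Proof.
move=> n0 r0 X CX nX; set n' := - r *: n.
have n'0 : n' != 0 by rewrite scaler_eq0 oppr_eq0 gt_eqF.
have Cz : C (O + zeta *: e) by apply: ballz; rewrite subrr enorm0 ltW.
have Xz : dot n' X <= dot n' (O + zeta *: e).
  by rewrite !(dotZl (- r)) !mulNr lerN2 ler_pM2l// nX supp_ub.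
have [sn|sn] := leP 0 (side (1 / 4) n); have [sn'|sn'] := leP 0 (side (1 / 4) n').
- exact: compatible_back.
- rewrite (contact_back _ g1 sn) (profile_supp_front _ n'0 (ltW sn')); apply: (le_trans Xz).
  have [n'e _ _ _ _] := frontP n'0 (ltW sn').
  rewrite !dotDr lerD2l !dotZr ler_nM2r//.
  by have := Phi_zeta n'0 (ltW sn'); move: etaz; rewrite -/Phi; lra.
- rewrite profile_supp_back//; apply: le_trans (supp_ub n' hC Cz).
  rewrite !(dotZl (- r)) !mulNr lerN2 ler_pM2l// (dot_contact nX) (profile_supp_front _ n0 (ltW sn)).
  have [ne _ _ _ _] := frontP n0 (ltW sn).
  rewrite !dotDr lerD2l !dotZr ler_nM2r//.
  by have := Phi_zeta n0 (ltW sn); move: etaz; rewrite -/Phi; lra.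
- have [ne _ _ _ _] := frontP n0 (ltW sn); have [n'e _ _ _ _] := frontP n'0 (ltW sn').
  by move: n'e; rewrite /n' dotZl mulNr oppr_lt0 pmulr_rgt0// ltNge (ltW ne).
Qed.

(* The planes of support at the contact points of [n] and of a normal [m] of the
   segment [n, n'] separate these points, so that compatibility of [n] with [n']
   follows from that of [m] with [n']. *)
Lemma compatible_bridge t n n' : n != 0 -> n' != 0 ->
  side t n != 0 -> side t n * side t n' <= 0 ->
  (forall m, m != 0 -> side t m = 0 -> [/\ compatible n m, compatible m n & compatible m n']) ->
  compatible n n'.
Proof.
move=> n0 n'0 sn snn' H.
pose m s := n + s *: (n' - n).
have [[s [s0 s1 ms0]]|nm] := pselect (exists s, [/\ 0 <= s, s <= 1 & m s = 0]).
  have sp : 0 < s.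
    rewrite lt_neqAle s0 andbT; apply/eqP => E; move: ms0; rewrite -E /m scale0r addr0 => E'.
    by move: n0; rewrite E' eqxx.
  have s1' : s < 1.
    rewrite lt_neqAle s1 andbT; apply/eqP => E; move: ms0; rewrite E /m scale1r addrC subrK => E'.
    by move: n'0; rewrite E' eqxx.
  have -> : n' = - ((1 - s) / s) *: n.
    have -> : n' = s^-1 *: m s - ((1 - s) / s) *: n.
      by apply/rowP => i; rewrite !mxE; field; rewrite gt_eqF.
    by rewrite ms0 scaler0 sub0r scaleNr.
  by apply: compatible_opposite => //; rewrite divr_gt0// subr_gt0.
have [s [s0 s1 sm]] := side_root snn'; rewrite -/(m s) in sm.
have ms : m s != 0 by apply/eqP => E; apply: nm; exists s.
have sp : 0 < s.
  rewrite lt_neqAle s0 andbT; apply/eqP => E; move: sm sn; rewrite -E /m scale0r addr0 => ->.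
  by rewrite eqxx.
have [c1 c2 c3] := H _ ms sm.
move=> X CX nX; have [X' CX' mX'] := supp_att (m s) hC.
apply: le_trans (c3 _ CX' mX').
have h1 := c1 _ CX nX; have h2 := c2 _ CX' mX'.
rewrite -(dot_contact mX') in h1; rewrite -(dot_contact nX) in h2.
move: (contact g n X) (contact g (m s) X') h1 h2 => Y Y'.
have mE y : dot (m s) y = (1 - s) * dot n y + s * dot n' y.
  by rewrite /m dotDl dotZl dotDl dotNl; ring.
rewrite !mE; move: (dot n Y) (dot n Y') (dot n' Y) (dot n' Y') => u u' v v' h1 h2.
have h3 : s * (v' - v) = (1 - s) * u' + s * v' - ((1 - s) * u + s * v) - (1 - s) * (u' - u) by ring.
rewrite -subr_ge0 -(pmulr_rge0 _ sp) h3.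
have : (1 - s) * (u' - u) <= 0 by rewrite mulr_ge0_le0 ?subr_ge0// subr_le0.
by move: h1; lra.
Qed.

Let quarter_side n : n != 0 -> side (1 / 4) n = 0 -> 0 <= side (3 / 4) n.
Proof.
move=> n0 sn; have sn' : side (1 / 4) n <= 0 by rewrite sn.
by have [ne _ _ _ _] := frontP n0 sn'; move: sn ne; rewrite !sideE; lra.
Qed.

Let compatible_middle_back n n' : n != 0 -> n' != 0 -> side (1 / 4) n < 0 -> 0 <= side (3 / 4) n ->
  0 <= side (1 / 4) n' -> compatible n n'.
Proof.
move=> n0 n'0 sa sb sn'.
apply: (@compatible_bridge (1 / 4)) => //; first by rewrite lt_eqF.
  by rewrite mulr_le0_ge0// ltW.
move=> m m0 sm; have sm' := quarter_side m0 sm; split.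
- by apply: compatible_middle => //; rewrite ?sm// ltW.
- by apply: compatible_middle => //; rewrite ?sm// ltW.
- by apply: compatible_back; rewrite ?sm.
Qed.

(** The gap inequality requires [n] to have intercept in [1/4, 3/4]. The other pairs belong to a
    range of constant slope or are bridged by a normal of intercept exactly 1/4 or 3/4, where the
    neighboring cases overlap. *)
Lemma compatible_all n n' : n != 0 -> n' != 0 -> compatible n n'.
Proof.
move=> n0 n'0; have [sn'|sn'] := leP 0 (side (1 / 4) n'); have [sn|sn] := leP 0 (side (1 / 4) n).
- exact: compatible_back.
- have [sb|sb] := leP 0 (side (3 / 4) n); first exact: compatible_middle_back.
  have sb' : 0 < side (3 / 4) n' \/ side (3 / 4) n' <= 0 by case: leP; [right|left].
  case: sb' => [sb'|sb']; last by apply: compatible_far => //; exact: ltW.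
  apply: (@compatible_bridge (3 / 4)) => //; first by rewrite lt_eqF.
    by rewrite mulr_le0_ge0// ltW.
  move=> m m0 sm; have sm0 : side (3 / 4) m <= 0 by rewrite sm.
  split; [by apply: compatible_far => //; exact: ltW|by apply: compatible_far => //; exact: ltW|].
  have := side_far sm0; rewrite le_eqVlt => /orP[/eqP sma|sma].
    by apply: compatible_back; rewrite ?sma.
  by apply: compatible_middle_back => //; rewrite sm.
- have [sn0|sn0] := eqVneq (side (1 / 4) n) 0.
    by apply: (compatible_middle n0 n'0 _ (quarter_side n0 sn0) (ltW sn')); rewrite sn0.
  apply: (@compatible_bridge (1 / 4)) => //; first by rewrite mulr_ge0_le0// ltW.
  move=> m m0 sm; split; [by apply: compatible_back; rewrite ?sm..|].
  by apply: (compatible_middle m0 n'0 _ (quarter_side m0 sm) (ltW sn')); rewrite sm.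
- have [sb|sb] := leP 0 (side (3 / 4) n); first by apply: compatible_middle => //; exact: ltW.
  have [sb'|sb'] := leP (side (3 / 4) n') 0; first by apply: compatible_far => //; exact: ltW.
  apply: (@compatible_bridge (3 / 4)) => //; first by rewrite lt_eqF.
    by rewrite mulr_le0_ge0// ltW.
  move=> m m0 sm; have sm0 : side (3 / 4) m <= 0 by rewrite sm.
  split; [by apply: compatible_far => //; exact: ltW|by apply: compatible_far => //; exact: ltW|].
  by apply: (compatible_middle m0 n'0 (side_far sm0) _ (ltW sn')); rewrite sm.
Qed.

Let profile_supp0 : profile_supp g 0 = 0.
Proof.
have s0 : supp C 0 = 0 by have [x _ <-] := supp_att 0 hC; rewrite dot0l.
by rewrite profile_supp_back ?s0// /side s0 dot0l subrr.
Qed.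

Lemma contact_in n X : n != 0 -> C X -> dot n X = supp C n -> profile_body g (contact g n X).
Proof.
move=> n0 CX nX n'; have [->|n'0] := eqVneq n' 0; first by rewrite dot0l profile_supp0.
exact: compatible_all CX nX.
Qed.

(** A lower bound for the distance from [O + zeta *: e] to the displaced planes: their intercepts
    are at most [1 + eta], and [- dot n e >= rho / zeta] for unit [n]. *)
Definition profile_radius := rho * ((zeta - 1 - eta) / zeta).

Let zeta0 : 0 < zeta. Proof. by move: zeta1; lra. Qed.

Lemma profile_radius_gt0 : 0 < profile_radius.
Proof. by rewrite /profile_radius mulr_gt0// divr_gt0//; move: etaz; lra. Qed.

Lemma profile_ball y : enorm (y - (O + zeta *: e)) <= profile_radius -> profile_body g y.
Proof.
move=> yz n; have dn : dot n y <= dot n (O + zeta *: e) + profile_radius * enorm n.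
  rewrite -lerBlDl -dotNr -dotDr; apply: (le_trans (dot_le _ _)).
  by rewrite mulrC ler_wpM2r ?enorm_ge0.
apply: (le_trans dn); have [sn|sn] := leP 0 (side (1 / 4) n).
  rewrite profile_supp_back//; have := suppz n; rewrite !(dotDr, dotZr).
  have : profile_radius * enorm n <= rho * enorm n.
    rewrite ler_wpM2r ?enorm_ge0// /profile_radius ler_piMr ?(ltW rho0)//.
    by rewrite ler_pdivrMr// mul1r; move: eta0; lra.
  lra.
have n0 : n != 0 by apply: (side_neq0 (t := 1 / 4)); rewrite lt_eqF.
rewrite (profile_supp_front _ n0 (ltW sn)) -/Phi; have [ne nr _ _ _] := frontP n0 (ltW sn).
have /andP[_ pz] := Phi_zeta n0 (ltW sn).
rewrite !dotDr !dotZr; set N := dot n e in ne nr *.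
have h1 : profile_radius * enorm n <= (zeta - 1 - eta) * - N.
  have -> : (zeta - 1 - eta) * - N = (zeta - 1 - eta) / zeta * (zeta * - N).
    by move: (zeta) zeta0 => w w0; field; exact: lt0r_neq0.
  rewrite /profile_radius (mulrC rho) -(mulrA _ rho); apply: ler_wpM2l => //.
  by rewrite divr_ge0 ?(ltW zeta0)//; move: etaz; lra.
have h2 : 0 <= (1 + eta - Phi (intercept n)) * - N by rewrite mulr_ge0 ?subr_ge0// oppr_ge0 ltW.
lra.
Qed.

Lemma profile_body_body : convex_body (profile_body g).
Proof.
have [M M0 bM] := body_bounded hC.
split.
- apply/convex_setP => x y t t0 t1 hx hy n; rewrite !(dotDr, dotZr, dotNr).
  have h1 : 0 <= (1 - t) * (profile_supp g n - dot n x) by rewrite mulr_ge0// subr_ge0//; exact: hx.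
  have h2 : 0 <= t * (profile_supp g n - dot n y) by rewrite mulr_ge0// subr_ge0; exact: hy.
  lra.
- apply: (@compact_enorm _ _ (M + enorm O)).
    rewrite (_ : profile_body g = \bigcap_n [set y | dot n y <= profile_supp g n]); last first.
      by apply/seteqP; split=> [y hy n _|y hy n]; apply: hy.
    apply: closed_bigI => n _.
    apply: (@closed_comp _ _ (dot n) [set r | r <= profile_supp g n]) => [y _|].
      exact: continuous_dotr.
    exact: closed_le.
  move=> y /(_ y) hy; have [->|y0] := eqVneq y 0; first by rewrite enorm0 addr_ge0 ?enorm_ge0// ltW.
  have ey : 0 < enorm y by rewrite enorm_gt0.
  rewrite -(ler_pM2r ey) -expr2 sqr_enorm; apply: (le_trans hy).
  have [sn|sn] := leP 0 (side (1 / 4) y).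
    rewrite profile_supp_back// mulrDl; have [x Cx <-] := supp_att y hC.
    have h := dot_le y x; have := ler_wpM2r (ltW ey) (bM _ Cx).
    have := mulr_ge0 (enorm_ge0 O) (ltW ey); lra.
  rewrite (profile_supp_front _ y0 (ltW sn)) -/Phi; have [ne _ _ _ _] := frontP y0 (ltW sn).
  have /andP[pz _] := Phi_zeta y0 (ltW sn).
  rewrite dotDr dotZr; have h := dot_le y O; have := mulr_ge0 (ltW M0) (ltW ey).
  have : Phi (intercept y) * dot y e <= 0 by rewrite mulr_ge0_le0 ?(ltW ne)//; lra.
  lra.
- exists (O + zeta *: e); apply/interior_enormP; exists profile_radius; first exact: profile_radius_gt0.
  exact: profile_ball.
Qed.

Lemma supp_profile n : supp (profile_body g) n = profile_supp g n.
Proof.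
have hP := profile_body_body; have [->|n0] := eqVneq n 0.
  by rewrite profile_supp0; have [x _ <-] := supp_att 0 hP; rewrite dot0l.
apply/eqP; rewrite eq_le; apply/andP; split.
  by apply: supp_le => // y; exact.
have [X CX nX] := supp_att n hC.
by rewrite -(dot_contact nX); apply: supp_ub => //; exact: contact_in.
Qed.

Lemma normal_contact n X : normal C X n -> normal (profile_body g) (contact g n X) n.
Proof.
move=> nX; have [CX n1 _] := nX; have sX := normal_supp hC nX.
apply: supp_normal => //; first exact: profile_body_body.
- by apply: contact_in => //; exact: enorm_neq0.
- by rewrite supp_profile dot_contact.
Qed.

(** Such a point is on the boundary of the convex hull with [O], so it has a normal whose plane of
    support leaves [O] on the inner side. B is on this side too, hence also [O + (1 / 4) *: e]
    between them, and the plane is not displaced. *)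
Lemma boundary_plus_profile : boundary_plus C O `<=` boundary (profile_body g).
Proof.
move=> xi [bxi nxi]; apply/(boundary_bodyP _ profile_body_body).
have hS := stretch_body O (lexx 0) ler01 hC.
have Cxi : C xi by case: bxi => /(body_closed hC).
have : boundary (stretch O 0 C) xi.
  split; first by apply: subset_closure; exact: sub_stretch ler01 _ Cxi.
  move=> ixi; apply: nxi; split=> //; apply: interiorS ixi => _ [l [x [l0 l1 Cx ->]]] D [/convex_setP cD sD].
  by apply: cD => //; apply: sD; [right|left].
move=> /(boundary_bodyP _ hS)[n [Sxi n1 nS]].
have nC y : C y -> dot n (y - xi) <= 0 by move=> Cy; apply: nS; exact: sub_stretch ler01 _ Cy.
have nxi' : normal C xi n by [].
have sn : 0 <= side (1 / 4) n.
  have := nS O; rewrite dotDr dotNr subr_le0 (normal_supp hC nxi') => /(_ _) nO.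
  have {}nO : dot n O <= supp C n.
    apply: nO; exists 0, xi; split=> //; by rewrite scale0r addr0.
  by rewrite sideE; have := suppB n; lra.
exists n; have := normal_contact nxi'; by rewrite contact_back.
Qed.

End profile.

Lemma profile_body1 : profile_body (cst 1) = C.
Proof.
have E n : profile_supp (cst 1) n = supp C n.
  rewrite /profile_supp; case: ifP => // sn.
  have n0 : n != 0 by apply: (side_neq0 (t := 1 / 4)); rewrite lt_eqF.
  have [_ _ xa x1 sE] := frontP n0 (ltW sn).
  by rewrite primitive1 -?sE//; lra.
apply/seteqP; split=> [y hy|y Cy n]; last by rewrite E supp_ub.
by apply: body_in_supp => // n _; rewrite -E.
Qed.

End profile_bodies.

(** * Weights and the slopes derived from them *)

Section weights.
Context {R : realType}.
Implicit Types (w : R -> R) (x y t : R).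

Definition clamp x : R := Num.min (Num.max x (1 / 4)) (3 / 4).

Lemma clampP x : [\/ x <= 1 / 4 /\ clamp x = 1 / 4, 1 / 4 <= x /\ x <= 3 / 4 /\ clamp x = x |
  3 / 4 <= x /\ clamp x = 3 / 4].
Proof.
rewrite /clamp; have [x1|x1] := leP x (1 / 4).
  by apply: Or31; split=> //; rewrite min_l//; lra.
have [x3|x3] := leP x (3 / 4).
  by apply: Or32; split; [exact: ltW|].
by apply: Or33; split; [exact: ltW|].
Qed.

Lemma le_clamp x y : x <= y -> 0 <= clamp y - clamp x <= y - x.
Proof.
move=> xy; have [[hx ->]|[hx [hx' ->]]|[hx ->]] := clampP x;
  have [[hy ->]|[hy [hy' ->]]|[hy ->]] := clampP y; apply/andP; split; lra.
Qed.

Lemma clamp_itv x : 1 / 4 <= clamp x <= 3 / 4.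
Proof.
by have [[hx ->]|[hx [hx' ->]]|[hx ->]] := clampP x; apply/andP; split; lra.
Qed.

Lemma clamp_low x : x <= 1 / 4 -> clamp x = 1 / 4.
Proof. by have [[_ ->]|[h [_ ->]]|[h ->]] := clampP x => // x1; lra. Qed.

Lemma clamp_high x : 3 / 4 <= x -> clamp x = 3 / 4.
Proof. by have [[h ->]|[_ [h ->]]|[h ->]] := clampP x => // x1; lra. Qed.

Variable eta : R.
Hypotheses (eta0 : 0 < eta) (eta1 : eta <= 1 / 10).

(** On [1/4, 3/4] it grows at rate [2 * eta], faster than [root_slope w] for every weight [w]. *)
Definition base_slope x := 1 + 2 * eta * (clamp x - 1 / 4).

Lemma base_slope_bounds x : 1 <= base_slope x <= 1 + eta.
Proof.
have /andP[c1 c2] := clamp_itv x; rewrite /base_slope.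
have h1 : 0 <= eta * (clamp x - 1 / 4) by rewrite mulr_ge0 ?(ltW eta0)// subr_ge0.
have h2 : 0 <= eta * (3 / 4 - clamp x) by rewrite mulr_ge0 ?(ltW eta0)// subr_ge0.
by apply/andP; split; lra.
Qed.

Lemma base_slope_admissible : admissible eta base_slope.
Proof.
split.
- move=> x y; wlog xy : x y / y <= x.
    by move=> H; have [/H//|/ltW /H] := leP y x; rewrite distrC (distrC y).
  have /andP[h1 h2] := le_clamp xy.
  rewrite /base_slope (_ : _ - _ = 2 * eta * (clamp x - clamp y)); last by ring.
  rewrite normrM !ger0_norm ?subr_ge0 ?mulr_ge0 ?(ltW eta0)//; last by rewrite -subr_ge0.
  by rewrite ler_wpM2l// mulr_ge0// ltW.
- by move=> x x1; rewrite /base_slope clamp_low// subrr mulr0 addr0.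
- by move=> x x3; rewrite /base_slope !clamp_high.
- move=> x; have /andP[h1 h2] := base_slope_bounds x; split=> //; lra.
Qed.

Definition weight w := [/\ lipschitz eta w, forall x, x <= 1 / 4 -> w x = 0 &
  forall x, 3 / 4 <= x -> w x = w (3 / 4)].

Lemma weight_clamp w x : weight w -> w x = w (clamp x).
Proof.
move=> [_ w0 w1]; have [[x1 ->]|[_ [_ ->]]|[x3 ->]] := clampP x => //; last exact: w1.
by rewrite !w0.
Qed.

Lemma weight_bound w x : weight w -> `|w x| <= eta / 2.
Proof.
move=> ww; rewrite (weight_clamp x ww); have /andP[c1 c2] := clamp_itv x.
have [wl w0 _] := ww; have := wl (clamp x) (1 / 4); rewrite (w0 (1 / 4))// subr0.
move/le_trans; apply; rewrite ger0_norm ?subr_ge0//.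
by have := mulr_ge0 (ltW eta0) (_ : 0 <= 3 / 4 - clamp x); rewrite subr_ge0 => /(_ c2); lra.
Qed.

Lemma weightD w1 w2 (a b : R) : weight w1 -> weight w2 -> `|a| + `|b| <= 1 ->
  weight (fun x => a * w1 x + b * w2 x).
Proof.
move=> [l1 z1 c1] [l2 z2 c2] ab; split.
- move=> x y; rewrite (_ : _ - _ = a * (w1 x - w1 y) + b * (w2 x - w2 y)); last by ring.
  apply: (le_trans (ler_normD _ _)); rewrite !normrM.
  apply: (@le_trans _ _ ((`|a| + `|b|) * (eta * `|x - y|))); last first.
    by rewrite ler_piMl// mulr_ge0// ltW.
  by rewrite mulrDl lerD// ler_wpM2l.
- by move=> x x1; rewrite z1// z2// !mulr0 addr0.
- by move=> x x3; rewrite (c1 x x3) (c2 x x3).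
Qed.

Definition root_slope w x := Num.sqrt (1 + w x).

Lemma sqrt_quarter : Num.sqrt (1 / 4) = 1 / 2 :> R.
Proof. by rewrite (_ : 1 / 4 = (1 / 2) ^+ 2) ?sqrtr_sqr ?ger0_norm//; field. Qed.

Lemma sqrt_dist (u v : R) : 1 / 4 <= u -> 1 / 4 <= v -> `|Num.sqrt u - Num.sqrt v| <= `|u - v|.
Proof.
move=> u1 v1; have [u0 v0] : 0 <= u /\ 0 <= v by split; lra.
have q := sqrt_quarter.
have su : 1 / 2 <= Num.sqrt u by rewrite -q ler_sqrt.
have sv : 1 / 2 <= Num.sqrt v by rewrite -q ler_sqrt.
have -> : u - v = (Num.sqrt u - Num.sqrt v) * (Num.sqrt u + Num.sqrt v).
  by rewrite -subr_sqr !sqr_sqrtr.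
rewrite normrM ler_peMr//; apply: le_trans (ler_norm _); lra.
Qed.

Lemma weight_quarter w x : weight w -> 1 / 4 <= 1 + w x.
Proof.
by move=> /(weight_bound x); rewrite ler_norml => /andP[h _]; move: eta1; lra.
Qed.

Lemma root_slope_admissible w : weight w -> admissible eta (root_slope w).
Proof.
move=> ww; have [wl w0 w1] := ww; split.
- move=> x y; apply: (le_trans (sqrt_dist (weight_quarter x ww) (weight_quarter y ww))).
  rewrite (_ : _ - _ = w x - w y); last by ring.
  apply: (le_trans (wl x y)); rewrite ler_wpM2r//; move: eta0; lra.
- by move=> x x1; rewrite /root_slope w0// addr0 sqrtr1.
- by move=> x x3; rewrite /root_slope (w1 x x3).
- move=> x; have := weight_bound x ww; rewrite ler_norml => /andP[h1 h2]; split.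
    by rewrite -sqrt_quarter; apply: ler_wsqrtr; exact: weight_quarter.
  have e1 : 0 <= 1 + eta by move: eta0; lra.
  rewrite -(ger0_norm e1) -sqrtr_sqr ler_sqrt ?sqr_ge0// sqrrD expr1n mul1r mulr2n.
  by have := sqr_ge0 eta; move: eta0; lra.
Qed.

(** The squared quotient of [root_slope w] by [base_slope]; quotients of its values at successive
    parameters are the squares of the ratios of [approx]. *)
Definition ratio w x := (1 + w x) / base_slope x ^+ 2.

Lemma ratio_gt0 w x : weight w -> 0 < ratio w x.
Proof.
move=> ww; rewrite divr_gt0//; first by have := weight_quarter x ww; lra.
by rewrite exprn_gt0//; have /andP[h _] := base_slope_bounds x; lra.
Qed.

Lemma ratio_start w x : weight w -> x <= 1 / 4 -> ratio w x = 1.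
Proof.
move=> [_ w0 _] x1; have [_ g1 _ _] := base_slope_admissible.
by rewrite /ratio w0// g1// addr0 expr1n divr1.
Qed.

(** From [x] to [y] the weight grows by at most [eta * d], the square of the base slope by at least
    [4 * (eta * d)]; since [1 + w x >= 1 / 2] and [base_slope x ^+ 2 <= 2], the denominator wins. *)
Lemma ratio_decr w x y : weight w -> x <= y -> ratio w y <= ratio w x.
Proof.
move=> ww xy; have /andP[gx1 gx2] := base_slope_bounds x; have /andP[gy1 gy2] := base_slope_bounds y.
have px : 0 < base_slope x ^+ 2 by rewrite exprn_gt0//; lra.
have py : 0 < base_slope y ^+ 2 by rewrite exprn_gt0//; lra.
rewrite ler_pdivrMr// /ratio mulrAC ler_pdivlMr//.
have /andP[c0 _] := le_clamp xy; set d := clamp y - clamp x in c0 *.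
have dg : base_slope y - base_slope x = 2 * eta * d by rewrite /base_slope /d; ring.
have dw : w y - w x <= eta * d.
  rewrite (weight_clamp x ww) (weight_clamp y ww); have [wl _ _] := ww.
  by apply: (le_trans (ler_norm _)); apply: (le_trans (wl _ _)); rewrite ger0_norm.
have wx := weight_bound x ww; move: wx; rewrite ler_norml => /andP[wx1 wx2].
have ed : 0 <= eta * d by rewrite mulr_ge0// ltW.
move: (base_slope x) (base_slope y) gx1 gx2 gy1 gy2 px py dg => a b gx1 gx2 gy1 gy2 px py dg.
have bE : b = a + 2 * (eta * d) by lra.
have b2 : a ^+ 2 + 4 * (eta * d) <= b ^+ 2.
  have h : 0 <= (eta * d) * (a - 1) by rewrite mulr_ge0// subr_ge0.
  by rewrite bE sqrrD; have := sqr_ge0 (2 * (eta * d)); rewrite mulr2n; lra.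
have a2 : a ^+ 2 <= 2.
  have : 0 <= (11 / 10 - a) * (11 / 10 + a) by rewrite mulr_ge0//; move: eta1 gx1 gx2; lra.
  by lra.
have h1 : 0 <= (eta * d - (w y - w x)) * a ^+ 2 by rewrite mulr_ge0 ?subr_ge0// ltW.
have h2 : (eta * d) * a ^+ 2 <= (eta * d) * 2 by rewrite ler_wpM2l.
have wq : 1 / 2 <= 1 + w x by move: eta1; lra.
have h3 : (1 + w x) * (a ^+ 2 + 4 * (eta * d)) <= (1 + w x) * b ^+ 2.
  by rewrite ler_wpM2l//; lra.
have h4 : 0 <= (w x + 1 / 2) * (eta * d) by rewrite mulr_ge0//; lra.
lra.
Qed.

End weights.

(** * Approximation by iterated stretching, and passage to the limit *)

Section approximation.
Context {R : realType}.
Local Notation V := 'rV[R]_3.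
Implicit Types (n X Y : V) (w : R -> R) (t x h prev : R).

(** The ball gives [supp F n - dot n z >= rad * enorm n], which turns the absolute error [delta]
    into the relative error [delta / rad]. *)
Lemma supp_sandwich (F P : set V) z rad delta : convex_body F -> convex_body P -> 0 < rad ->
  (forall y, enorm (y - z) <= rad -> F y) -> 0 <= delta -> delta <= rad ->
  (forall n, `|supp P n - supp F n| <= delta * enorm n) -> sandwich z (delta / rad) F P.
Proof.
move=> hF hP rad0 ballF d0 dr close; set eps := delta / rad.
have eps0 : 0 <= eps by rewrite divr_ge0// ltW.
have eps1 : eps <= 1 by rewrite ler_pdivrMr// mul1r.
have inner n : delta * enorm n <= eps * (supp F n - dot n z).
  have h := supp_ball n hF rad0 ballF.
  have -> : delta * enorm n = eps * (rad * enorm n) by rewrite mulrA divfK// gt_eqF.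
  by rewrite ler_wpM2l//; lra.
split=> [u Fu|xi Pxi].
  apply: body_in_supp => // n _; have := close n; rewrite ler_norml => /andP[h _].
  have := inner n; have := ler_wpM2l (_ : 0 <= 1 - eps) (supp_ub n hF Fu); rewrite subr_ge0 => /(_ eps1).
  by rewrite !(dotDr, dotNr, dotZr); lra.
have e1 : 0 < 1 + eps by lra.
exists (z + (1 + eps)^-1 *: (xi - z)); last first.
  by rewrite addrAC subrr add0r scalerA mulfV ?gt_eqF// scale1r addrC subrK.
apply: body_in_supp => // n _; rewrite dotDr dotZr mulrC -lerBrDl ler_pdivrMr//.
have := close n; rewrite ler_norml => /andP[_ h].
by have := inner n; have := supp_ub n hP Pxi; rewrite dotDr dotNr; lra.
Qed.

Lemma supp_inj (A B : set V) : convex_body A -> convex_body B ->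
  (forall n, supp A n = supp B n) -> A = B.
Proof.
move=> hA hB AB; apply/seteqP; split; apply: body_supp_subset => // n _; by rewrite AB.
Qed.

Variables (C : set V) (O e : V) (zeta rho c0 eta : R).
Hypotheses (hC : convex_body C) (onB : C (O + e)) (zeta1 : 1 < zeta) (rho0 : 0 < rho).
Hypothesis ballz : forall y, enorm (y - (O + zeta *: e)) <= rho -> C y.
Hypothesis c00 : 0 < c0.
Hypothesis gapC : forall X n t, 1 / 4 <= t -> t <= 3 / 4 -> normal C X n ->
  dot n X = dot n (O + t *: e) -> forall n', enorm n' = 1 ->
  c0 * (supp C n' - dot n' (O + t *: e)) ^+ 2 <= supp C n' - dot n' X.
Hypotheses (eta0 : 0 < eta) (eta1 : eta <= 1 / 10) (etaz : 1 + eta < zeta).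
Hypothesis etac : 4 * eta * zeta <= c0 * rho.

Let gG := base_slope eta.
Let aG : admissible eta gG. Proof. exact: base_slope_admissible. Qed.
Let PhiG := primitive gG.
Let glG : lipschitz (2 * eta) gG. Proof. by case: aG. Qed.
Let base := profile_body C O e gG.
Let front n := intercept C O e n.

Definition deformed w := profile_body C O e (root_slope w).

Let body_profile g (ag : admissible eta g) := profile_body_body hC onB zeta1 rho0 ballz eta0 etaz ag.
Let suppE g (ag : admissible eta g) n :=
  supp_profile hC onB zeta1 rho0 ballz c00 gapC eta0 etaz etac ag n.

Let PhiG_bounds x : 1 / 4 <= x -> x <= 1 -> 1 / 4 <= PhiG x <= 1 + eta.
Proof. exact: primitive_bounds. Qed.

Let PhiG_mono x y : 1 / 4 <= x -> x <= y -> y <= 1 -> PhiG x <= PhiG y.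
Proof.
move=> xa xy y1.
have x0 : 0 < x by lra.
have y2 : y < 2 by lra.
have /andP[h _] := primitive_growth aG x0 xy y2.
by rewrite -subr_ge0; apply: le_trans h; lra.
Qed.

(* The profile body of slope [sqrt (1 + w)] is approximated by stretching the fixed body
   of slope [base_slope eta] successively from the points [O + primitive _ t *: e] with
   [t] equal to [prev + m * h], ..., [prev + h]; the ratios are at most [1] since
   [ratio w] decreases. *)
Fixpoint approx w h prev m : set V := if m is m'.+1 then
    stretch (O + primitive (base_slope eta) (prev + h) *: e)
      (Num.sqrt (ratio eta w (prev + h) / ratio eta w prev)) (approx w h (prev + h) m')
  else profile_body C O e (base_slope eta).

(** The counterpart of [primitive g] for the body [approx]: a stretch keeps the intercepts up to
    that of its center and contracts the larger ones towards it. *)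
Fixpoint psi w h prev m x : R := if m is m'.+1 then
    if x <= prev + h then PhiG x else PhiG (prev + h) +
      Num.sqrt (ratio eta w (prev + h) / ratio eta w prev) * (psi w h (prev + h) m' x - PhiG (prev + h))
  else PhiG x.

Section one_weight.
Variables (w : R -> R) (h : R).
Hypotheses (ww : weight eta w) (h0 : 0 < h).

Let ratio_step prev : 0 <= Num.sqrt (ratio eta w (prev + h) / ratio eta w prev) <= 1.
Proof.
rewrite sqrtr_ge0 -[leRHS]sqrtr1 ler_wsqrtr// ler_pdivrMr ?ratio_gt0// mul1r ratio_decr//.
by rewrite lerDl ltW.
Qed.

Lemma approx_body prev m : convex_body (approx w h prev m).
Proof.
elim: m prev => [|m IH] prev /=; first exact: body_profile.
by have /andP[r0 r1] := ratio_step prev; exact: stretch_body.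
Qed.

Let psi_low prev m x : x <= prev -> psi w h prev m x = PhiG x.
Proof. by case: m => //= m xp; rewrite (le_trans xp)// lerDl ltW. Qed.

Let psi_high prev m x : 1 / 4 <= prev -> prev <= x -> x <= 1 -> PhiG prev <= psi w h prev m x.
Proof.
elim: m prev => [|m IH] prev pa px x1 /=; first exact: PhiG_mono.
have [xh|/ltW hx] := leP x (prev + h); first exact: PhiG_mono.
have ph : 1 / 4 <= prev + h by have := h0; lra.
apply: (@le_trans _ _ (PhiG (prev + h))).
  by apply: PhiG_mono => //; [rewrite lerDl ltW|exact: le_trans hx x1].
by rewrite lerDl mulr_ge0 ?sqrtr_ge0// subr_ge0 IH.
Qed.

Lemma supp_approx prev m n : 1 / 4 <= prev -> prev + m%:R * h <= 3 / 4 ->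
  supp (approx w h prev m) n =
  if side C O e (1 / 4) n < 0 then dot n (O + psi w h prev m (front n) *: e) else supp C n.
Proof.
elim: m prev => [|m IH] prev pa pm /=; first exact: (suppE aG).
have ph : 1 / 4 <= prev + h by have := h0; lra.
have pm' : prev + h + m%:R * h <= 3 / 4.
  by move: pm; rewrite -natr1; lra.
have mh : 0 <= m%:R * h by rewrite mulr_ge0// ltW.
have ph1 : prev + h <= 1 by lra.
have /andP[r0 r1] := ratio_step prev.
set r := Num.sqrt _ in r0 r1 *; rewrite -/gG -/PhiG.
have /andP[P1 P2] := PhiG_bounds ph ph1.
rewrite (supp_stretch _ _ r0 r1 (approx_body _ _)) IH//.
case: ifPn => [sn|]; last first.
  (* The center of the stretch lies on l between [O + (1 / 4) *: e] and [O + zeta *: e], which are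
     both on the inner side of this plane. *)
  rewrite -leNgt sideE => sn; set d := _ - _; have d0 : 0 <= d.
    rewrite /d dotDr dotZr.
    have hB : dot n O + dot n e <= supp C n by rewrite -dotDr; exact: supp_ub.
    have hz : dot n O + zeta * dot n e <= supp C n.
      rewrite -dotZr -dotDr; apply: supp_ub => //; apply: ballz.
      by rewrite subrr enorm0 ltW.
    have [ne|ne] := leP 0 (dot n e).
      have : 0 <= (zeta - PhiG (prev + h)) * dot n e by rewrite mulr_ge0//; move: etaz; lra.
      lra.
    have : 0 <= (PhiG (prev + h) - 1 / 4) * - dot n e by rewrite mulr_ge0//; lra.
    lra.
  by rewrite max_l; [rewrite /d addrC subrK|rewrite ler_piMl].
have n0 : n != 0.
  apply: contraTneq sn => ->; rewrite sideE; have [x _ <-] := supp_att 0 hC.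
  by rewrite !dot0l mulr0 !subr0 ltxx.
have [ne _ xa x1 _] := frontP hC onB zeta1 rho0 ballz n0 (ltW sn).
rewrite -/(front n) in xa x1 *; set x := front n in xa x1 *.
have -> : dot n (O + psi w h (prev + h) m x *: e) - dot n (O + PhiG (prev + h) *: e) =
    (psi w h (prev + h) m x - PhiG (prev + h)) * dot n e.
  by rewrite !(dotDr, dotZr); ring.
have [xh|/ltW hx] := leP x (prev + h).
  rewrite psi_low//; set d := (_ - _) * _; have d0 : 0 <= d.
    by rewrite /d mulr_le0 ?(ltW ne)// subr_le0; exact: PhiG_mono.
  rewrite max_l ?ler_piMl//.
  by rewrite /d !(dotDr, dotZr); ring.
set d := (_ - _) * _; have d0 : d <= 0.
  by rewrite /d mulr_ge0_le0 ?(ltW ne)// subr_ge0; exact: psi_high.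
rewrite max_r; first by rewrite /d !(dotDr, dotZr); ring.
have : 0 <= (1 - r) * - d by rewrite mulr_ge0 ?subr_ge0// oppr_ge0.
lra.
Qed.

Let Phiw := primitive (root_slope w).
Let aw : admissible eta (root_slope w). Proof. exact: root_slope_admissible. Qed.
Let lw : lipschitz (2 * eta) (root_slope w). Proof. by case: aw. Qed.

Let sqrt_ratio x : Num.sqrt (ratio eta w x) * gG x = root_slope w x.
Proof.
have /andP[g1 _] := base_slope_bounds eta0 x.
have g0 : 0 < base_slope eta x by lra.
rewrite /ratio sqrtrM; last by have := weight_quarter eta0 eta1 x ww; lra.
by rewrite sqrtrV ?sqr_ge0// sqrtr_sqr gtr0_norm// divfK// gt_eqF.
Qed.

Let sqrt_ratio_le x : 1 / 4 <= x -> Num.sqrt (ratio eta w x) <= 1.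
Proof.
move=> xa; rewrite -[leRHS]sqrtr1 ler_wsqrtr// -(ratio_start eta0 ww (lexx (1 / 4))).
exact: ratio_decr.
Qed.

(** After multiplication by the root of the ratio both functions have the same slope at [prev]; the
    two Taylor remainders add up to at most [4 * eta * (x - prev) ^+ 2], and [4 * eta <= 1]. *)
Let step_error prev x : 1 / 4 <= prev -> prev <= x -> x <= prev + h -> x <= 1 ->
  `|Num.sqrt (ratio eta w prev) * (PhiG x - PhiG prev) - (Phiw x - Phiw prev)| <= h * (x - prev).
Proof.
move=> pa px xh x1.
have [p0 [p2 [x0 x2]]] : 0 < prev /\ prev < 2 /\ 0 < x /\ x < 2 by split; [|split; [|split]]; lra.
have tG := primitive_taylor glG p0 p2 x0 x2; have tw := primitive_taylor lw p0 p2 x0 x2.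
rewrite -/PhiG -/Phiw in tG tw; set r := Num.sqrt _.
have r1 : r <= 1 by exact: sqrt_ratio_le.
have -> : r * (PhiG x - PhiG prev) - (Phiw x - Phiw prev) =
   r * (PhiG x - PhiG prev - gG prev * (x - prev)) - (Phiw x - Phiw prev - root_slope w prev * (x - prev)).
  by rewrite -sqrt_ratio -/r; ring.
apply: (le_trans (ler_normB _ _)); rewrite normrM ger0_norm ?sqrtr_ge0//.
have h1 : r * `|PhiG x - PhiG prev - gG prev * (x - prev)| <= 1 * (2 * eta * (x - prev) ^+ 2).
  by apply: ler_pM => //; exact: sqrtr_ge0.
apply: (le_trans (lerD h1 tw)).
have xp : 0 <= x - prev by rewrite subr_ge0.
have : (x - prev) ^+ 2 <= h * (x - prev) by rewrite expr2 ler_wpM2r//; lra.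
have : 0 <= (1 / 4 - eta) * (x - prev) ^+ 2 by rewrite mulr_ge0 ?sqr_ge0//; move: eta1; lra.
lra.
Qed.

(** The factor [Num.sqrt (ratio eta w prev)] makes the errors of successive steps add up without
    amplification. From 3 / 4 on, both functions are affine with matching slopes. *)
Lemma psi_error prev m x : 1 / 4 <= prev -> prev + m%:R * h = 3 / 4 -> prev <= x -> x <= 1 ->
  `|Num.sqrt (ratio eta w prev) * (psi w h prev m x - PhiG prev) - (Phiw x - Phiw prev)| <=
  h * (x - prev).
Proof.
elim: m prev => [|m IH] prev pa pm px x1 /=.
  have pb : prev = 3 / 4 by rewrite -pm mul0r addr0.
  have xb : 3 / 4 <= x by rewrite -pb.
  have b2 : 3 / 4 < (2 : R) by lra.
  have x2 : x < 2 by lra.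
  rewrite pb (primitive_high aG (lexx _) xb b2 x2) (primitive_high aw (lexx _) xb b2 x2).
  by rewrite mulrA sqrt_ratio subrr normr0 mulr_ge0 ?(ltW h0)// subr_ge0.
have ph : 1 / 4 <= prev + h by have := h0; lra.
have [xh|/ltW hx] := leP x (prev + h); first exact: step_error.
have pm' : prev + h + m%:R * h = 3 / 4 by move: pm; rewrite -natr1; lra.
have h1 := IH _ ph pm' hx x1.
have pph : prev <= prev + h by rewrite lerDl ltW.
have h2 := step_error pa pph (lexx _) (le_trans hx x1).
have rr : Num.sqrt (ratio eta w prev) * Num.sqrt (ratio eta w (prev + h) / ratio eta w prev) =
    Num.sqrt (ratio eta w (prev + h)).
  rewrite -sqrtrM ?ltW ?ratio_gt0//; congr Num.sqrt.
  by rewrite mulrC divfK// gt_eqF// ratio_gt0.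
have -> : Num.sqrt (ratio eta w prev) * (PhiG (prev + h) +
    Num.sqrt (ratio eta w (prev + h) / ratio eta w prev) * (psi w h (prev + h) m x - PhiG (prev + h)) -
    PhiG prev) - (Phiw x - Phiw prev) =
  (Num.sqrt (ratio eta w (prev + h)) * (psi w h (prev + h) m x - PhiG (prev + h)) -
     (Phiw x - Phiw (prev + h))) +
  (Num.sqrt (ratio eta w prev) * (PhiG (prev + h) - PhiG prev) - (Phiw (prev + h) - Phiw prev)).
  by rewrite -rr; ring.
apply: (le_trans (ler_normD _ _)); apply: (le_trans (lerD h1 h2)); lra.
Qed.

Lemma supp_approx_close m n : 1 / 4 + m%:R * h = 3 / 4 ->
  `|supp (approx w h (1 / 4) m) n - supp (deformed w) n| <= h * enorm e * enorm n.
Proof.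
move=> mh; rewrite supp_approx ?mh// (suppE aw) /profile_supp.
case: ifPn => [sn|_]; last by rewrite subrr normr0 !mulr_ge0 ?enorm_ge0 ?(ltW h0).
have n0 : n != 0.
  apply: contraTneq sn => ->; rewrite sideE; have [x _ <-] := supp_att 0 hC.
  by rewrite !dot0l mulr0 !subr0 ltxx.
have [_ _ xa x1 _] := frontP hC onB zeta1 rho0 ballz n0 (ltW sn).
rewrite -/(front n) in xa x1 *.
have := psi_error (lexx _) mh xa x1.
rewrite ratio_start// sqrtr1 (mul1r (_ - _)) /PhiG /Phiw !primitive_start -/Phiw => er.
rewrite (_ : dot n _ - dot n _ = (psi w h (1 / 4) m (front n) - Phiw (front n)) * dot n e); last first.
  by rewrite !(dotDr, dotZr) /Phiw; ring.
rewrite normrM -mulrA; apply: ler_pM => //; last by rewrite mulrC; exact: dot_le_enorm.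
rewrite (_ : psi _ _ _ _ _ - Phiw _ =
  psi w h (1 / 4) m (front n) - 1 / 4 - (Phiw (front n) - 1 / 4)); last by ring.
by apply: (le_trans er); rewrite ler_piMr ?(ltW h0)//; lra.
Qed.

(* The weights occurring here are affine in [w] and the last body does not depend on [w]. *)
Lemma nu_approx_step prev m D : 1 / 4 <= prev -> prev + m.+1%:R * h <= 3 / 4 -> closed D ->
  ratio eta w prev * nu (approx w h prev m.+1) D =
  ratio eta w (prev + h) * nu (approx w h (prev + h) m) D +
  (ratio eta w prev - ratio eta w (prev + h)) *
     nu (stretch (O + PhiG (prev + h) *: e) 0 base) D.
Proof.
move=> pa pm cD; have ph : 1 / 4 <= prev + h by have := h0; lra.
have pm' : prev + h + m%:R * h <= 3 / 4 by move: pm; rewrite -natr1; lra.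
have mh : 0 <= m%:R * h by rewrite mulr_ge0// ltW.
have ph1 : prev + h <= 1 by lra.
have /andP[r0 r1] := ratio_step prev.
have hA := approx_body (prev + h) m; set Q := O + PhiG (prev + h) *: e.
(* Planes with intercept beyond [prev + h] separate [Q] from the body and disappear in the hull; up
   to [prev + h] the iterated body has the planes of the base body. *)
have same : stretch Q 0 (approx w h (prev + h) m) = stretch Q 0 base.
  apply: supp_inj; [exact: stretch_body|apply: stretch_body => //; exact: body_profile|move=> n].
  rewrite !supp_stretch//; last exact: body_profile.
  rewrite !mul0r supp_approx// (suppE aG) /profile_supp; case: ifPn => // sn.
  have n0 : n != 0.
    apply: contraTneq sn => ->; rewrite sideE; have [x _ <-] := supp_att 0 hC.
    by rewrite !dot0l mulr0 !subr0 ltxx.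
  have [ne _ xa x1 _] := frontP hC onB zeta1 rho0 ballz n0 (ltW sn).
  rewrite -/(front n) -/PhiG in xa x1 *; congr (_ + _).
  have E (u : R) : dot n (O + u *: e) - dot n Q = (u - PhiG (prev + h)) * dot n e.
    by rewrite /Q !(dotDr, dotZr); ring.
  rewrite !E; have [xh|/ltW hx] := leP (front n) (prev + h); first by rewrite psi_low.
  by rewrite !max_r// mulr_ge0_le0 ?(ltW ne)// subr_ge0 ?PhiG_mono// psi_high.
have := hausdorff2_stretch Q r0 r1 hA cD; rewrite same.
have hS : convex_body (stretch Q 0 base) by apply: stretch_body => //; exact: body_profile.
have hS' := stretch_body Q r0 r1 hA.
rewrite !nuE// -!EFinM -EFinD => -[] ->; rewrite sqr_sqrtr; last first.
  by rewrite divr_ge0// ltW// ratio_gt0.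
have rr : ratio eta w prev * (ratio eta w (prev + h) / ratio eta w prev) = ratio eta w (prev + h).
  by rewrite mulrC divfK// gt_eqF// ratio_gt0.
by rewrite -[in RHS]rr; ring.
Qed.

End one_weight.

Lemma nu_approx_affine w1 w2 (a b h : R) prev m D : weight eta w1 -> weight eta w2 ->
  0 <= a -> 0 <= b -> a + b = 1 -> 0 < h ->
  1 / 4 <= prev -> prev + m%:R * h <= 3 / 4 -> closed D ->
  let w := fun x => a * w1 x + b * w2 x in
  ratio eta w prev * nu (approx w h prev m) D =
  a * (ratio eta w1 prev * nu (approx w1 h prev m) D) +
  b * (ratio eta w2 prev * nu (approx w2 h prev m) D).
Proof.
move=> ww1 ww2 a0 b0 ab h0 pa pm cD w.
have ww : weight eta w by apply: weightD => //; rewrite !ger0_norm// ab.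
have rE x : ratio eta w x = a * ratio eta w1 x + b * ratio eta w2 x.
  by rewrite /ratio /w -{1}ab; ring.
elim: m prev pa pm => [|m IH] prev pa pm; first by rewrite rE /=; ring.
have ph : 1 / 4 <= prev + h by lra.
have pm' : prev + h + m%:R * h <= 3 / 4 by move: pm; rewrite -natr1; lra.
by rewrite !nu_approx_step// (IH _ ph pm') !rE; ring.
Qed.

(** At [prev = 1 / 4] all ratios equal 1, so [nu_approx_affine] is the desired relation for the
    approximating bodies. [N] steps of length 1 / (2 N) lead from 1 / 4 to 3 / 4. *)
Lemma nu_deformed_affine w1 w2 (a b : R) D : weight eta w1 -> weight eta w2 ->
  0 <= a -> 0 <= b -> a + b = 1 -> closed D ->
  nu (deformed (fun x => a * w1 x + b * w2 x)) D = a * nu (deformed w1) D + b * nu (deformed w2) D.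
Proof.
move=> ww1 ww2 a0 b0 ab; set w := fun x => _.
have ww : weight eta w by apply: weightD => //; rewrite !ger0_norm// ab.
have hd v : weight eta v -> convex_body (deformed v).
  by move=> wv; apply: body_profile; exact: root_slope_admissible.
pose z := O + zeta *: e; pose rad := profile_radius zeta rho eta.
have rad0 : 0 < rad by exact: profile_radius_gt0.
apply: (nu_affine_limit (z := z) (z1 := z) (z2 := z) (hd _ ww) (hd _ ww1) (hd _ ww2) a0 b0).
move=> d d0.
have en : 0 <= enorm e by exact: enorm_ge0.
pose d' := Num.min d 1 * rad.
have d'0 : 0 < d' by rewrite mulr_gt0// lt_min d0 ltr01.
have [N [N0 NE]] : exists N : nat, 0 < N%:R :> R /\ (enorm e + 1) / d' < N%:R.
  exists (Num.truncn ((enorm e + 1) / d')).+1; split=> //.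
  have pos : 0 <= (enorm e + 1) / d' by rewrite divr_ge0 ?(ltW d'0)//; lra.
  by have /andP[_] := truncn_itv pos.
pose h := (2 * N%:R)^-1 : R.
have h0 : 0 < h by rewrite invr_gt0 mulr_gt0.
have Nh : 1 / 4 + N%:R * h = 3 / 4.
  by rewrite /h; move: (N%:R) (lt0r_neq0 N0) => u u0; field.
have he : h * enorm e < d'.
  move: NE; rewrite ltr_pdivrMr// => NE.
  rewrite /h mulrC ltr_pdivrMr ?mulr_gt0//; have := mulr_gt0 d'0 N0; lra.
have d'r : d' <= rad by rewrite /d' ler_piMl ?(ltW rad0)// ge_min lexx orbT.
exists (h * enorm e / rad), (approx w h (1 / 4) N), (approx w1 h (1 / 4) N), (approx w2 h (1 / 4) N).
have sand v : weight eta v -> sandwich z (h * enorm e / rad) (deformed v) (approx v h (1 / 4) N).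
  move=> wv; apply: supp_sandwich => //.
  - exact: hd.
  - exact: approx_body.
  - by apply: profile_ball => //; exact: root_slope_admissible.
  - by rewrite mulr_ge0// ltW.
  - by apply: ltW; apply: lt_le_trans he d'r.
  - by move=> n; exact: supp_approx_close.
split.
- by apply: divr_ge0; [exact: (mulr_ge0 (ltW h0) en)|exact: ltW].
- rewrite ltr_pdivrMr//; apply: (lt_le_trans he); rewrite /d' ler_wpM2r ?(ltW rad0)//.
  by rewrite ge_min lexx.
- by split; exact: approx_body.
- by split; exact: sand.
have pm : 1 / 4 + N%:R * h <= 3 / 4 by rewrite Nh.
move=> E cE; have := nu_approx_affine ww1 ww2 a0 b0 ab h0 (lexx _) pm cE.
rewrite /= -/w (ratio_start eta0 ww (lexx _)) (ratio_start eta0 ww1 (lexx _)) (ratio_start eta0 ww2 (lexx _)).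
by rewrite !(mul1r (nu _ _)).
Qed.

End approximation.

(** * Positive mass of the bands of normals *)

Section positivity.
Context {R : realType}.
Local Notation V := 'rV[R]_3.
Local Notation H2 := (@hausdorff2 R).
Implicit Types (n m v X : V) (t : R).

Let vec (a b c : R) : V := \row_i [:: a; b; c]`_i.

Lemma transverse_forms v : v != 0 -> exists a1 a2 w1 w2,
  [/\ dot a1 v = 0, dot a2 v = 0, dot a1 w1 = 1, dot a2 w2 = 1 & dot a1 w2 = 0 /\ dot a2 w1 = 0].
Proof.
move=> v0; have [v00|v00] := eqVneq (v 0 0) 0; last first.
  exists (vec (- (v 0 1 / v 0 0)) 1 0), (vec (- (v 0 2 / v 0 0)) 0 1), (vec 0 1 0), (vec 0 0 1).
  by rewrite !dotE !mxE /=; split; [field|field|ring|ring|split; ring].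
have [v01|v01] := eqVneq (v 0 1) 0; last first.
  exists (vec 1 (- (v 0 0 / v 0 1)) 0), (vec 0 (- (v 0 2 / v 0 1)) 1), (vec 1 0 0), (vec 0 0 1).
  by rewrite !dotE !mxE /=; split; [field|field|ring|ring|split; ring].
exists (vec 1 0 0), (vec 0 1 0), (vec 1 0 0), (vec 0 1 0).
by rewrite !dotE !mxE /= v00 v01; split; [ring|ring|ring|ring|split; ring].
Qed.

Variable C : set V.
Hypothesis hC : convex_body C.

(* Near [xi] the boundary is a graph in the direction of an interior point. *)
Lemma boundary_ball_pos xi (r : R) : boundary C xi -> 0 < r ->
  (0 < H2 (boundary C `&` [set x | enorm (x - xi) < r]%R))%E.
Proof.
move=> bxi r0; have /(boundary_bodyP _ hC)[n [Cxi n1 nC]] := bxi.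
have [z [rho [rho0 ballz]]] := body_ball hC.
pose v := z - xi.
have nv : dot n v <= - rho.
  have := supp_ball n hC rho0 ballz; have <- := normal_supp hC (And3 Cxi n1 nC).
  by rewrite n1 mulr1 /v dotDr dotNr; lra.
have v0 : v != 0 by apply: contraTneq nv => ->; rewrite dot0r; move: rho0; lra.
have [a1 [a2 [w1 [w2 [a1v a2v a11 a22 [a12 a21]]]]]] := transverse_forms v0.
pose W := enorm w1 + enorm w2 + 1.
have W0 : 0 < W by have := enorm_ge0 w1; have := enorm_ge0 w2; rewrite /W; lra.
pose B := enorm v + rho + r.
have B0 : 0 < B by have := enorm_ge0 v; rewrite /B; lra.
(* [mu] keeps the points constructed below within [r] of [xi], and [s] keeps the lateral
   displacement below [mu * rho]. *)
pose mu := r / B.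
have mu0 : 0 < mu by rewrite divr_gt0.
have mu1 : mu <= 1 by rewrite ler_pdivrMr// mul1r /B; have := enorm_ge0 v; lra.
have muB : mu * (enorm v + rho) < r.
  have E : mu * B = r by rewrite divfK// gt_eqF.
  have := mulr_gt0 mu0 r0; move: E; rewrite {1}/B; lra.
pose s := mu * rho / W.
have s0 : 0 < s by rewrite divr_gt0// mulr_gt0.
have sW : s * W = mu * rho by rewrite divfK// gt_eqF.
pose A := enorm a1 + enorm a2 + 1.
have A0 : 0 < A by have := enorm_ge0 a1; have := enorm_ge0 a2; rewrite /A; lra.
have lip a : enorm a <= A -> forall x y : V, `|s^-1 * dot a (x - xi) - s^-1 * dot a (y - xi)| <= s^-1 * A * enorm (x - y).
  move=> aA x y; rewrite -mulrBr normrM gtr0_norm ?invr_gt0// -mulrA ler_pM2l ?invr_gt0//.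
  rewrite -dotNr -dotDr (_ : x - xi - (y - xi) = x - y); last by vring.
  by apply: (le_trans (dot_le_enorm _ _)); rewrite ler_wpM2r ?enorm_ge0.
apply: (@hausdorff2_pos _ _ (fun x => s^-1 * dot a1 (x - xi)) (fun x => s^-1 * dot a2 (x - xi)) (s^-1 * A)).
- by rewrite mulr_gt0// invr_gt0.
- by move=> x y _ _; apply: lip; rewrite /A; have := enorm_ge0 a2; lra.
- by move=> x y _ _; apply: lip; rewrite /A; have := enorm_ge0 a1; lra.
move=> a b /andP[ag a1'] /andP[bg b1'].
pose d := s *: (a *: w1 + b *: w2).
have dW : enorm d < mu * rho.
  rewrite -sW /d enormZ gtr0_norm// ltr_pM2l//; apply: (le_lt_trans (enormD _ _)).
  rewrite !enormZ !ger0_norm// /W; have := enorm_ge0 w1; have := enorm_ge0 w2.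
  move=> e1 e2; have := ler_wpM2r e1 b1'; have := ler_wpM2r e2 a1'; lra.
(* On the line through [xi + d] parallel to [v], the point on the side of [z] lies in a contracted
   copy of the ball and the opposite one is cut off by [n], so the boundary is crossed in
   between. *)
have Cp : C (xi + mu *: v + d).
  have -> : xi + mu *: v + d = xi + mu *: (z + mu^-1 *: d - xi).
    rewrite /v; apply/rowP => i; rewrite !mxE; move: (mu) (lt0r_neq0 mu0) => u u0; field; exact: u0.
  apply: body_convex => //; first exact: ltW.
  apply: ballz; rewrite addrAC subrr add0r enormZ gtr0_norm ?invr_gt0//.
  by rewrite mulrC ler_pdivrMr// mulrC ltW.
have Cq : ~ C (xi - mu *: v + d).
  move=> /nC; rewrite (_ : xi - mu *: v + d - xi = d - mu *: v); last by vring.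
  rewrite dotDr dotNr dotZr leNgt; apply/negP; rewrite negbK.
  have := dot_unit_le d n1; rewrite ler_norml => /andP[h _].
  have : mu * dot n v <= mu * - rho by rewrite ler_pM2l.
  lra.
have [t [t0 t1 bt]] := crossing (body_closed hC) Cp Cq.
set y := _ + t *: _ in bt.
have yE : y - xi = d + ((1 - 2 * t) * mu) *: v by rewrite /y; vring.
have yd m : dot m (y - xi) = s * (a * dot m w1 + b * dot m w2) + (1 - 2 * t) * mu * dot m v.
  by rewrite yE dotDr /d (dotZr ((1 - 2 * t) * mu)) (dotZr s) dotDr (dotZr a) (dotZr b).
exists y; split.
- split=> //=; rewrite yE; apply: (le_lt_trans (enormD _ _)); rewrite (enormZ ((1 - 2 * t) * mu)) normrM (gtr0_norm mu0).
  have t2 : `|1 - 2 * t| <= 1 by rewrite ler_norml; apply/andP; split; lra.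
  have := ler_wpM2r (mulr_ge0 (ltW mu0) (enorm_ge0 v)) t2; lra.
- by rewrite yd a1v a11 a12 !mulr0 !addr0 mulr1 mulrA mulVf ?mul1r// lt0r_neq0.
- by rewrite yd a2v a22 a21 !mulr0 addr0 mulr1 add0r mulrA mulVf ?mul1r// lt0r_neq0.
Qed.

Variables (O e : V) (zeta rho c0 : R).
Hypotheses (outside : forall t, t < 1 -> ~ C (O + t *: e)) (onB : C (O + e)).
Hypotheses (zeta1 : 1 < zeta) (rho0 : 0 < rho).
Hypothesis ballz : forall y, enorm (y - (O + zeta *: e)) <= rho -> C y.
Hypothesis c00 : 0 < c0.
Hypothesis gapC : forall X n t, 1 / 4 <= t -> t <= 3 / 4 -> normal C X n ->
  dot n X = dot n (O + t *: e) -> forall n', enorm n' = 1 ->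
  c0 * (supp C n' - dot n' (O + t *: e)) ^+ 2 <= supp C n' - dot n' X.

(** Along a path from a separating normal [n] to [- n] the sign of [side] changes; the detour
    through a vector [u] orthogonal to [n] keeps the path away from 0. *)
Lemma normal_through t : t < 1 -> exists n, n != 0 /\ side C O e t n = 0.
Proof.
move=> t1; have [_ kC _] := hC; have cC : convex_set C by case: hC.
have [n [d [n1 d0 nd]]] := separation cC kC (body_neq0 hC) (outside t1).
have n0 := enorm_neq0 n1.
have sn : side C O e t n < 0.
  by have [x Cx sx] := supp_att n hC; rewrite /side -sx; have := nd _ Cx; lra.
have snN : 0 < side C O e t (- n).
  rewrite /side dotNl opprK; have := supp_ub (- n) hC onB; rewrite dotNl; have := nd _ onB; lra.
have [u [u0 nu]] : exists u, u != 0 /\ dot n u = 0.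
  have [n00|n00] := eqVneq (n 0 0) 0.
    exists (vec 1 0 0); split; last by rewrite dotE !mxE /= n00; ring.
    by apply/eqP => /rowP/(_ 0); rewrite !mxE /= => /eqP; rewrite oner_eq0.
  exists (vec (- n 0 1) (n 0 0) 0); split; last by rewrite dotE !mxE /=; ring.
  by apply/eqP => /rowP/(_ 1); rewrite !mxE /= => /eqP; rewrite (negbTE n00).
have nn : 0 < dot n n by exact: dot_gt0.
have [su|su] := leP 0 (side C O e t u).
  have [s [s0 s1 sE]] := @side_root _ C O e hC t n u (mulr_le0_ge0 (ltW sn) su).
  exists (n + s *: (u - n)); split=> //; apply/eqP => E; have := congr1 (dot n) E.
  rewrite dot0r !(dotDr, dotZr, dotNr) nu => E'.
  have /eqP : (1 - s) * dot n n = 0 by lra.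
  rewrite mulf_eq0 (gt_eqF nn) orbF subr_eq0 => /eqP s1'.
  by move: E u0; rewrite -s1' scale1r addrC subrK => ->; rewrite eqxx.
have [s [s0 s1 sE]] := @side_root _ C O e hC t u (- n) (mulr_le0_ge0 (ltW su) (ltW snN)).
exists (u + s *: (- n - u)); split=> //; apply/eqP => E; have := congr1 (dot n) E.
rewrite dot0r !(dotDr, dotZr, dotNr) nu => E'.
have /eqP : s * dot n n = 0 by lra.
rewrite mulf_eq0 (gt_eqF nn) orbF => /eqP s0'.
by move: E u0; rewrite s0' scale0r addr0 => ->; rewrite eqxx.
Qed.

(** For [1 / 4 <= al < be <= 3 / 4] these are the normals with intercept strictly between [al] and
    [be]. *)
Definition band (al be : R) : set V := [set n | side C O e al n < 0 /\ 0 < side C O e be n].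

Lemma band_open al be : open (band al be).
Proof.
rewrite (_ : band al be = side C O e al @^-1` [set r | r < 0] `&` side C O e be @^-1` [set r | 0 < r])//.
by apply: openI; apply: open_comp => [n _|]; [exact: side_continuous|exact: open_lt|exact: side_continuous|exact: open_gt].
Qed.

(* By the gap inequality all normals at a contact point of a plane of support
   through [O + t e] have intercept [t], hence lie in the band. *)
Lemma band_pos al be : 1 / 4 <= al -> al < be -> be <= 3 / 4 ->
  (0 < H2 (normal_preimage C (band al be)))%E.
Proof.
move=> a1 ab b1; pose t := (al + be) / 2.
have [n' [n'0 sn']] := @normal_through t ltac:(rewrite /t; lra).
pose n := (enorm n')^-1 *: n'; have n1 : enorm n = 1 by exact: enorm_normalize.
have en : 0 < enorm n' by rewrite enorm_gt0.
have sn : side C O e t n = 0.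
  by rewrite /side /n suppZ// ?invr_ge0 ?(ltW en)// dotZl -mulrBr -/(side C O e t n') sn' mulr0.
have [xi Cxi nxi] := supp_att n hC.
have nX : normal C xi n by exact: supp_normal.
have bxi : boundary C xi by apply/(boundary_bodyP _ hC); exists n.
have nt : dot n xi = dot n (O + t *: e).
  by rewrite nxi; apply/eqP; rewrite -subr_eq0; apply/eqP.
have [ta tb] : 1 / 4 <= t /\ t <= 3 / 4 by rewrite /t; split; lra.
have uniq m : normal C xi m -> band al be m.
  move=> mX; have [_ m1 _] := mX; have := gapC ta tb nX nt m1.
  rewrite (normal_supp hC mX) subrr -/(side C O e t m) => sm.
  have s2 : side C O e t m ^+ 2 = 0.
    by apply/eqP; rewrite eq_le sqr_ge0 andbT -(pmulr_rle0 _ c00).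
  have /eqP sm0 : side C O e t m == 0 by rewrite -sqrf_eq0 s2.
  have m0 := enorm_neq0 m1.
  have sm4 : side C O e (1 / 4) m <= 0.
    have hB := supp_ub m hC onB; rewrite dotDr in hB.
    have E : supp C m - dot m O = t * dot m e by move: sm0; rewrite sideE; lra.
    have : (1 - t) * dot m e <= 0 by lra.
    rewrite pmulr_rle0 => [me|]; last lra.
    rewrite sideE E.
    have : (t - 1 / 4) * dot m e <= 0 by rewrite mulr_ge0_le0// subr_ge0.
    lra.
  have [me _ _ _ _] := frontP hC onB zeta1 rho0 ballz m0 sm4.
  have hab : 0 < (be - al) * - dot m e by rewrite mulr_gt0 ?subr_gt0// oppr_gt0.
  by move: sm0; rewrite /band /= !sideE /t; split; lra.
(* The points with some normal outside the band form a closed set that misses [xi], so near [xi] all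
   normals lie in the band. *)
have cl : closed (normal_preimage C (~` band al be)).
  apply: compact_is_closed; apply: normal_preimage_compact => //.
  by apply: open_closedC; exact: band_open.
have nxi' : ~ normal_preimage C (~` band al be) xi.
  by move=> [m nb mX]; apply: nb; exact: uniq.
have [r r0 Hr] : exists2 r, 0 < r & forall y, enorm (y - xi) < r -> ~ normal_preimage C (~` band al be) y.
  have : nbhs xi (~` normal_preimage C (~` band al be)).
    by apply: open_nbhs_nbhs; split=> //; exact: closed_openC.
  by move=> /nbhs_enormP.
apply: (lt_le_trans (boundary_ball_pos bxi r0)); apply: le_hausdorff2 => y [by_ yr].
have /(boundary_bodyP _ hC)[m my] := by_.
exists m => //; apply: contrapT => nb; apply: (Hr y yr); by exists m.
Qed.

End positivity.

(** * The families and the span of their director vectors *)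

Section families.
Context {R : realType}.
Local Notation V := 'rV[R]_3.
Local Notation H2 := (@hausdorff2 R).
Implicit Types (n X : V) (w : R -> R) (A : set (S2 R)).

Variables (C : set V) (O e : V) (zeta rho c0 eta : R).
Hypotheses (hC : convex_body C) (outside : forall t, t < 1 -> ~ C (O + t *: e)).
Hypotheses (onB : C (O + e)) (zeta1 : 1 < zeta) (rho0 : 0 < rho).
Hypothesis ballz : forall y, enorm (y - (O + zeta *: e)) <= rho -> C y.
Hypothesis c00 : 0 < c0.
Hypothesis gapC : forall X n t, 1 / 4 <= t -> t <= 3 / 4 -> normal C X n ->
  dot n X = dot n (O + t *: e) -> forall n', enorm n' = 1 ->
  c0 * (supp C n' - dot n' (O + t *: e)) ^+ 2 <= supp C n' - dot n' X.
Hypotheses (eta0 : 0 < eta) (eta1 : eta <= 1 / 10) (etaz : 1 + eta < zeta).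
Hypothesis etac : 4 * eta * zeta <= c0 * rho.

Local Notation D := (deformed C O e).

Lemma deformed_body w : weight eta w -> convex_body (D w).
Proof.
by move=> ww; apply: (profile_body_body hC onB zeta1 rho0 ballz eta0 etaz); exact: root_slope_admissible.
Qed.

Lemma deformed0 : D (fun=> 0) = C.
Proof.
rewrite /deformed (_ : root_slope _ = cst 1).
  exact: (profile_body1 hC onB zeta1 rho0 ballz).
by apply/funext => x; rewrite /root_slope addr0 sqrtr1.
Qed.

Lemma weight0 : weight eta (fun=> 0).
Proof. by split=> // x y; rewrite subrr normr0 mulr_ge0// ltW. Qed.

(* Opaque, since unfolding [surface_measure] makes conversion tests diverge. *)
Fact mass_subproof w A : {r : R | weight eta w -> surface_measure (D w) A = r%:E}.
Proof.
exists (fine (surface_measure (D w) A)) => ww.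
by rewrite fineK// surface_measure_fin_num//; exact: deformed_body.
Qed.

Definition mass w A : R := sval (mass_subproof w A).

Lemma massE w A : weight eta w -> surface_measure (D w) A = (mass w A)%:E.
Proof. exact: (svalP (mass_subproof w A)). Qed.

Lemma mass_affine w w1 w2 (a b : R) A : weight eta w1 -> weight eta w2 -> 0 <= a -> 0 <= b ->
  a + b = 1 -> (forall x, w x = a * w1 x + b * w2 x) -> measurable A ->
  mass w A = a * mass w1 A + b * mass w2 A.
Proof.
move=> ww1 ww2 a0 b0 ab wE mA.
have -> : w = (fun x => a * w1 x + b * w2 x) by exact/funext.
have ww : weight eta (fun x => a * w1 x + b * w2 x) by apply: weightD => //; rewrite !ger0_norm// ab.
have hD := deformed_body ww; have hD1 := deformed_body ww1; have hD2 := deformed_body ww2.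
have : surface_measure (D (fun x => a * w1 x + b * w2 x)) A =
    (a%:E * surface_measure (D w1) A + b%:E * surface_measure (D w2) A)%E.
  apply: (surface_measure_affine hD hD1 hD2 a0 b0) mA => E cE.
  have := nu_deformed_affine hC onB zeta1 rho0 ballz c00 gapC eta0 eta1 etaz etac ww1 ww2 a0 b0 ab cE.
  rewrite (nuE E hD) (nuE E hD1) (nuE E hD2).
  by move: (nu (D _) E) (nu (D w1) E) (nu (D w2) E) => u v v' ->; rewrite EFinD !EFinM.
rewrite (massE A ww) (massE A ww1) (massE A ww2).
by move: (mass _ A) (mass w1 A) (mass w2 A) => u v v'; rewrite -!EFinM -EFinD => -[].
Qed.

Lemma weightZ w (s : R) : weight eta w -> `|s| <= 1 -> weight eta (fun x => s * w x).
Proof.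
move=> ww s1; rewrite (_ : (fun x => _) = (fun x => s * w x + 0 * w x)); last first.
  by apply/funext => x; rewrite mul0r addr0.
by apply: weightD => //; rewrite normr0 addr0.
Qed.

Lemma mass_scale w (s : R) A : weight eta w -> `|s| <= 1 -> measurable A ->
  mass (fun x => s * w x) A = mass (fun=> 0) A + s * (mass w A - mass (fun=> 0) A).
Proof.
move=> ww s1 mA; have ws := weightZ ww s1; have w0 := weight0.
have [s0|s0] := leP 0 s.
  rewrite (@mass_affine _ w (fun=> 0) s (1 - s))//.
  - by ring.
  - by rewrite subr_ge0 (le_trans (ler_norm s)).
  - by ring.
  - by move=> x; rewrite mulr0 addr0.
(* For [s < 0] the weight 0 is a convex combination of [s * w] and [w]; the resulting relation is
   solved for the mass of [s * w]. *)
have s10 : 0 < 1 - s by lra.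
have := @mass_affine (fun=> 0) _ w (1 - s)^-1 (- s / (1 - s)) A ws ww.
rewrite invr_ge0 (ltW s10) divr_ge0 ?oppr_ge0 ?ltW// => /(_ isT isT).
have -> : (1 - s)^-1 + - s / (1 - s) = 1 by field; rewrite gt_eqF.
move=> /(_ erefl) h; have {h}: mass (fun=> 0) A =
    (1 - s)^-1 * mass (fun x => s * w x) A + - s / (1 - s) * mass w A.
  by apply: h => // x; field; rewrite gt_eqF.
move=> ->; field; by rewrite gt_eqF.
Qed.

(** The signs of [a] and [b] are absorbed into the weights, which leaves a convex combination. *)
Lemma mass_comb w1 w2 (a b : R) A : weight eta w1 -> weight eta w2 -> `|a| + `|b| = 1 ->
  measurable A ->
  mass (fun x => a * w1 x + b * w2 x) A - mass (fun=> 0) A =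
  a * (mass w1 A - mass (fun=> 0) A) + b * (mass w2 A - mass (fun=> 0) A).
Proof.
move=> ww1 ww2 ab mA.
have sg1 (r : R) : `|Num.sg r| <= 1 by rewrite normr_sg; case: eqP.
rewrite (@mass_affine _ (fun x => Num.sg a * w1 x) (fun x => Num.sg b * w2 x) `|a| `|b|)//; last 3 first.
- exact: weightZ.
- exact: weightZ.
- by move=> x; rewrite !mulrA !(mulrC `|_|) -!numEsg.
rewrite !mass_scale//; move: (mass _ A) (mass w1 A) (mass w2 A) => m0 m1 m2.
transitivity ((`|a| + `|b| - 1) * m0 + Num.sg a * `|a| * (m1 - m0) + Num.sg b * `|b| * (m2 - m0)).
  by ring.
by rewrite ab -!numEsg; ring.
Qed.

Definition deformation w (s : R) : set V := D (fun x => s * w x).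

Lemma deformation_segment_family w : weight eta w -> segment_family C O (deformation w).
Proof.
move=> ww; have norm1 (s : R) : s \in `[-1, 1] -> `|s| <= 1 by rewrite in_itv /= ler_norml.
split.
- by move=> s /norm1 s1; apply: deformed_body; exact: weightZ.
- rewrite /deformation -[RHS]deformed0; congr (deformed _ _ _ _).
  by apply/funext => x; rewrite mul0r.
- move=> s /norm1 s1.
  apply: (boundary_plus_profile hC onB zeta1 rho0 ballz c00 gapC eta0 etaz etac).
  by apply: root_slope_admissible => //; exact: weightZ.
- move=> s /norm1 s1 A mA; have one : `|1 : R| <= 1 by rewrite normr1.
  have C0 : surface_measure C A = (mass (fun=> 0) A)%:E by rewrite -(massE A weight0) deformed0.
  rewrite /deformation C0 (massE A (weightZ ww s1)) (massE A (weightZ ww one)).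
  rewrite -EFinB -EFinM -EFinD !mass_scale//; congr EFin; ring.
Qed.

Local Notation charges := ({charge set (S2 R) -> \bar R}).

Fact director_subproof w : weight eta w -> {sigma : charges |
  forall A, measurable A -> sigma A = (mass w A - mass (fun=> 0) A)%:E}.
Proof.
move=> ww; exists (cadd (charge_of_finite_measure (surface_fmeasure (deformed_body ww)))
  (cscale (-1) (charge_of_finite_measure (surface_fmeasure hC)))) => A mA.
rewrite EFinB -(massE A ww) -(massE A weight0) deformed0.
transitivity (surface_measure (D w) A + (-1)%:E * surface_measure C A)%E => //.
by rewrite EFinN mulN1e.
Qed.

Definition director w (ww : weight eta w) : charges := sval (director_subproof ww).

Lemma directorE w (ww : weight eta w) A : measurable A ->
  director ww A = (mass w A - mass (fun=> 0) A)%:E.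
Proof. exact: (svalP (director_subproof ww)). Qed.

Lemma director_vectorP w (ww : weight eta w) : director_vector C (deformation w) (director ww).
Proof.
move=> A mA; rewrite (directorE ww mA) EFinB -(massE A ww) -(massE A weight0) deformed0.
by have -> : deformation w 1 = D w by congr deformed; apply/funext => x; rewrite mul1r.
Qed.

Let cscaleE (r : R) (nu : charges) A : (cscale r nu : charges) A = (r%:E * nu A)%E.
Proof. by []. Qed.

Let caddE (nu1 nu2 : charges) A : (cadd nu1 nu2 : charges) A = (nu1 A + nu2 A)%E.
Proof. by []. Qed.

Let weights := {w : R -> R | weight eta w}.
Let lines := \bigcup_(w in [set: weights]) charge_line (director (svalP w)).

(** Weights are stable under combinations with [|a| + |b| <= 1], and as [lines] consists of full
    lines, dividing by [|l1| + |l2|] reduces every sum to this case. *)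
Lemma lines_subspace : charge_subspace lines.
Proof.
split.
- exists (exist _ _ weight0) => //; exists 0 => A mA.
  by rewrite cscaleE mul0e.
- move=> s1 s2 [[w1 ww1] _ [l1 E1]] [[w2 ww2] _ [l2 E2]].
  have [l0|l0] := eqVneq (`|l1| + `|l2|) 0.
    exists (exist _ _ weight0) => //; exists 0 => A mA.
    move/eqP: l0; rewrite paddr_eq0 // !normr_eq0 => /andP[/eqP l10 /eqP l20].
    by rewrite caddE (E1 A mA) (E2 A mA) !cscaleE l10 l20 !mul0e adde0.
  set L := `|l1| + `|l2| in l0.
  have L0 : 0 < L by rewrite lt_neqAle eq_sym l0 addr_ge0.
  have ab : `|l1 / L| + `|l2 / L| = 1.
    by rewrite !normrM normfV (gtr0_norm L0) -mulrDl divff.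
  have ww : weight eta (fun x => l1 / L * w1 x + l2 / L * w2 x).
    by apply: weightD => //; rewrite ab.
  exists (exist _ _ ww) => //; exists L => A mA.
  rewrite caddE (E1 A mA) (E2 A mA) !cscaleE.
  rewrite (directorE _ mA) (directorE _ mA) (directorE _ mA) /=.
  rewrite -!EFinM -EFinD mass_comb//; congr EFin.
  by move: (L) l0 => l l0; field.
- move=> a s [[w ww] _ [l E]]; exists (exist _ _ ww) => //; exists (a * l) => A mA.
  by rewrite cscaleE (E A mA) !cscaleE EFinM muleA.
Qed.

Definition spherical_band (al be : R) : set (S2 R) := set_val @^-1` (band C O e al be).

Lemma spherical_band_measurable al be : measurable (spherical_band al be).
Proof.
by apply: open_S2_measurable; exists (band C O e al be) => //; exact: band_open.
Qed.

Lemma mass_band w al be : weight eta w ->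
  (mass w (spherical_band al be))%:E = H2 (normal_preimage (D w) (band C O e al be)).
Proof.
move=> ww; rewrite -(massE _ ww) surface_measureE; last exact: deformed_body.
by rewrite normal_preimage_S2.
Qed.

(* Where the slope is constant, the contact map is a homothety.  Applied to [w] and
   [- w], this bounds [mass w] on the band from below and from above. *)
Lemma plateau_mass w (al be ga : R) : weight eta w -> 1 / 4 <= al -> al < be -> be <= 3 / 4 ->
  (forall x, al <= x <= be -> root_slope w x = ga) ->
  ga ^+ 2 * mass (fun=> 0) (spherical_band al be) <= mass w (spherical_band al be).
Proof.
move=> ww a1 ab b1 wga; have aw := root_slope_admissible eta0 eta1 ww.
have lw : lipschitz (2 * eta) (root_slope w) by case: aw.
have ga0 : 0 < ga.
  by rewrite -(wga al) ?lexx ?(ltW ab)//; have [_ _ _ h] := aw; have [h1 _] := h al; lra.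
pose Phi := primitive (root_slope w).
rewrite -lee_fin EFinM (mass_band _ _ ww) (mass_band _ _ weight0).
rewrite deformed0 -(hausdorff2_homothety _ (O + Phi al *: e - ga *: (O + al *: e)) ga0).
apply: le_hausdorff2 => _ [X [n [n1 n2] nX] <-]; exists n => //.
have [CX nn _] := nX; have n0 := enorm_neq0 nn.
have sn : side C O e (1 / 4) n <= 0.
  have hB := supp_ub n hC onB; rewrite dotDr in hB.
  move: n1; rewrite !sideE => n1.
  have : (1 - al) * dot n e < 0 by lra.
  rewrite pmulr_rlt0 => [ne|]; last lra.
  have : (al - 1 / 4) * dot n e <= 0 by rewrite mulr_ge0_le0 ?subr_ge0// ltW.
  lra.
have [ne _ _ _ _] := frontP hC onB zeta1 rho0 ballz n0 sn.
have [xa xb] : al <= intercept C O e n /\ intercept C O e n <= be.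
  have sE t := side_intercept hC onB zeta1 rho0 ballz t n0 sn.
  by move: n1 n2; rewrite !sE nmulr_llt0// nmulr_lgt0// subr_gt0 subr_lt0 => /ltW ? /ltW.
have al0 : 0 < al by lra.
have x2 : intercept C O e n < 2 by lra.
have := normal_contact hC onB zeta1 rho0 ballz c00 gapC eta0 etaz etac aw nX.
rewrite (contact_front hC onB zeta1 rho0 ballz)// wga ?xa ?xb//.
have [u /andP[ua ux]] := primitive_mvt lw al0 xa x2.
rewrite wga ?ua ?(le_trans ux)// => PhiE.
rewrite -/Phi (_ : Phi (intercept C O e n) = Phi al + ga * (intercept C O e n - al)); last first.
  by rewrite -PhiE /Phi; ring.
by congr (normal _ _ _); vring.
Qed.

Lemma plateau_massE w (al be ka : R) : weight eta w -> 1 / 4 <= al -> al < be -> be <= 3 / 4 ->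
  (forall x, al <= x <= be -> w x = ka) ->
  mass w (spherical_band al be) - mass (fun=> 0) (spherical_band al be) =
  ka * mass (fun=> 0) (spherical_band al be).
Proof.
move=> ww a1 ab b1 wka; set A := spherical_band al be.
have mA : measurable A by exact: spherical_band_measurable.
have m1 : `|-1 : R| <= 1 by rewrite normrN1.
have wN := weightZ ww m1.
have key v k : weight eta v -> (forall x, al <= x <= be -> v x = k) ->
    (1 + k) * mass (fun=> 0) A <= mass v A.
  move=> wv vk; have k1 : 0 <= 1 + k.
    by rewrite -(vk al) ?lexx ?(ltW ab)//; have := weight_quarter eta0 eta1 al wv; lra.
  rewrite -(sqr_sqrtr k1); apply: plateau_mass => // x xab.
  by rewrite /root_slope vk.
have h1 := key _ _ ww wka.
have h2 : (1 + - ka) * mass (fun=> 0) A <= mass (fun x => -1 * w x) A.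
  by apply: key => // x /wka ->; rewrite mulN1r.
rewrite mass_scale// in h2.
by apply/eqP; rewrite eq_le; apply/andP; split; lra.
Qed.

Lemma band_mass_gt0 al be : 1 / 4 <= al -> al < be -> be <= 3 / 4 ->
  0 < mass (fun=> 0) (spherical_band al be).
Proof.
move=> a1 ab b1; rewrite -lte_fin (mass_band _ _ weight0) deformed0; exact: (band_pos hC outside onB zeta1 rho0 ballz c00 gapC).
Qed.

(** A bump around [c] with plateau of half-width [q], support of half-width [2 * q] and sides of
    slope [eta], the steepest allowed for a weight. *)
Definition trapezoid (c q x : R) : R := eta * Num.max 0 (Num.min q (2 * q - `|x - c|)).

Lemma trapezoid_in c q x : 0 < q -> `|x - c| <= q -> trapezoid c q x = eta * q.
Proof.
move=> q0 xc; rewrite /trapezoid min_l; last by lra.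
by rewrite max_r// ltW.
Qed.

Lemma trapezoid_out c q x : 0 < q -> 2 * q <= `|x - c| -> trapezoid c q x = 0.
Proof.
move=> q0 xc; rewrite /trapezoid max_l ?mulr0//.
by rewrite ge_min; apply/orP; right; lra.
Qed.

Lemma trapezoid_weight c q : 0 < q -> 1 / 4 <= c - 2 * q -> c + 2 * q <= 3 / 4 ->
  weight eta (trapezoid c q).
Proof.
move=> q0 c1 c2.
have out x : x <= 1 / 4 \/ 3 / 4 <= x -> trapezoid c q x = 0.
  case=> h; apply: trapezoid_out => //.
    by rewrite ler0_norm; lra.
  by rewrite ger0_norm; lra.
split.
- move=> x y; rewrite /trapezoid -mulrBr normrM (gtr0_norm eta0) ler_pM2l//.
  have : `| `|x - c| - `|y - c| | <= `|x - y|.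
    by apply: (le_trans (ler_dist_dist _ _)); rewrite (_ : x - c - (y - c) = x - y)//; ring.
  move: `|x - c| `|y - c| => u v; rewrite ler_norml => /andP[h1 h2].
  rewrite ler_norml !maxEle !minEle; apply/andP.
  by do ![case: ifPn; rewrite -?ltNge] => *; split; lra.
- by move=> x h; apply: out; left.
- by move=> x h; rewrite !out//; right.
Qed.

(** The values of the directors of [n.+1] bumps on the bands under their plateaus form a diagonal
    matrix with positive diagonal; [n] spanning charges would factor this matrix through dimension
    [n]. *)
Lemma lines_infinite_dimensional : ~ finite_dimensional lines.
Proof.
move=> [n [ch H]].
(* The [n.+1] intervals of half-width [2 * q] around the centers [c j] fill [1/4, 3/4]. *)
pose q : R := (8 * n.+1%:R)^-1.
have n0 : 0 < n.+1%:R :> R by [].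
have q0 : 0 < q by rewrite invr_gt0 mulr_gt0.
have nq : n.+1%:R * q = 1 / 8 by rewrite /q; move: (n.+1%:R) (lt0r_neq0 n0) => u u0; field.
pose c (j : 'I_n.+1) : R := 1 / 4 + (4 * j%:R + 2) * q.
have jq (j : 'I_n.+1) : 0 <= j%:R * q /\ (j%:R + 1) * q <= 1 / 8.
  split; first by rewrite mulr_ge0// ltW.
  by rewrite -nq ler_pM2r// natr1 ler_nat.
have wt j : weight eta (trapezoid (c j) q).
  by have [h1 h2] := jq j; apply: trapezoid_weight => //; rewrite /c; lra.
pose A (j : 'I_n.+1) := spherical_band (c j - q) (c j + q).
have mA j : measurable (A j) by exact: spherical_band_measurable.
have cq j : [/\ 1 / 4 <= c j - q, c j - q < c j + q & c j + q <= 3 / 4].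
  by have [h1 h2] := jq j; rewrite /c; split; lra.
pose sig j := director (wt j).
have ssig j : lines (sig j).
  exists (exist _ _ (wt j)) => //; exists 1 => B mB.
  by rewrite cscaleE mul1e (directorE (wt j) mB) (directorE _ mB).
have sigE i j : sig i (A j) = (if i == j then eta * q * mass (fun=> 0) (A i) else 0)%:E.
  have [c1 c2 c3] := cq j; rewrite directorE//; congr EFin; case: eqVneq => [<-|ij].
    have [d1 d2 d3] := cq i; apply: plateau_massE => // x /andP[x1 x2].
    by apply: trapezoid_in => //; rewrite ler_norml; apply/andP; split; lra.
  rewrite -[RHS](mul0r (mass (fun=> 0) (A j))); apply: plateau_massE => // x /andP[x1 x2].
  apply: trapezoid_out => //.
  have : (i < j)%N || (j < i)%N by rewrite -neq_ltn.
  case/orP => lt.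
    have : (i%:R + 1) * q <= j%:R * q by rewrite ler_pM2r// natr1 ler_nat.
    move=> le; rewrite ger0_norm; move: x1 x2; rewrite /c; lra.
  have : (j%:R + 1) * q <= i%:R * q by rewrite ler_pM2r// natr1 ler_nat.
  move=> le; rewrite ler0_norm; move: x1 x2; rewrite /c; lra.
have /boolp.choice[cf cfE] j := H _ (ssig j).
pose M : 'M[R]_n.+1 := diag_mx (\row_j (eta * q * mass (fun=> 0) (A j))).
have ME : M = (\matrix_(j, i) cf j i) *m (\matrix_(i, l) fine (ch i (A l))).
  apply/matrixP => j l; rewrite !mxE.
  have := cfE j _ (mA l); rewrite sigE => /esym.
  rewrite (eq_bigr (fun i => (cf j i * fine (ch i (A l)))%:E)); last first.
    by move=> i _; rewrite EFinM fineK// fin_num_measure.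
  rewrite sumEFin => -[E]; rewrite (eq_bigr (fun i => cf j i * fine (ch i (A l)))).
    by rewrite E; case: eqVneq => // ->.
  by move=> i _; rewrite !mxE.
have Mu : M \in unitmx.
  rewrite unitmxE det_diag unitfE; apply/prodf_neq0 => i _; rewrite mxE.
  have [d1 d2 d3] := cq i.
  by rewrite gt_eqF// !mulr_gt0// band_mass_gt0.
have := mulmx_max_rank (\matrix_(j, i) cf j i) (\matrix_(i, l) fine (ch i (A l))).
by rewrite -ME mxrank_unit// ltnn.
Qed.

Lemma families_exist :
  (exists F : R -> set V, segment_family C O F) /\
  (exists (Theta : Type) (F : Theta -> R -> set V)
      (sigma : Theta -> {charge set (S2 R) -> \bar R}),
    [/\ forall theta, segment_family C O (F theta),
        forall theta, director_vector C (F theta) (sigma theta),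
        charge_subspace (\bigcup_theta charge_line (sigma theta)) &
        ~ finite_dimensional (\bigcup_theta charge_line (sigma theta))]).
Proof.
split; first by exists (deformation (fun=> 0)); apply: deformation_segment_family; exact: weight0.
exists weights, (fun w : weights => deformation (sval w)), (fun w : weights => director (svalP w)); split.
- by move=> w; apply: deformation_segment_family; exact: svalP.
- by move=> w; exact: director_vectorP.
- exact: lines_subspace.
- exact: lines_infinite_dimensional.
Qed.

End families.

Theorem theorem1 (R : realType) (C : set 'rV[R]_3) (O : 'rV[R]_3)
    (l : set 'rV[R]_3) (B B' : 'rV[R]_3)
    (hC : convex_body C) (hO : ~ C O)
    (hl : is_line l) (hlO : l O) (hlC : l `&` interior C !=set0)
    (hBB' : l `&` boundary C = [set B; B'])
    (hOB : half_open_segment O B `<=` ~` C)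
    (hB : segment B B' `<=` C)
    (h_i : forall Pi M, half_plane_bounded_by l Pi ->
      tangency_point C O Pi M -> ray_touches C O Pi M)
    (h_ii : exists k : R, 0 < k /\
      forall Pi M, half_plane_bounded_by l Pi -> tangency_point C O Pi M ->
        C1_with_curvature_le (arc_between (boundary C `&` Pi) B M) k) :
  (exists F : R -> set 'rV[R]_3, segment_family C O F) /\
  (exists (Theta : Type) (F : Theta -> R -> set 'rV[R]_3)
      (sigma : Theta -> {charge set (S2 R) -> \bar R}),
    [/\ forall theta, segment_family C O (F theta),
        forall theta, director_vector C (F theta) (sigma theta),
        charge_subspace (\bigcup_theta charge_line (sigma theta)) &
        ~ finite_dimensional (\bigcup_theta charge_line (sigma theta))]).
Proof.
have [lB bB] : (l `&` boundary C) B by rewrite hBB'; left.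
have CB : C B by case: bB => /(body_closed hC).
pose e := B - O; have BE : B = O + e by rewrite /e addrC subrK.
have e0 : e != 0 by rewrite /e subr_eq0; apply/eqP => BO; apply: hO; rewrite -BO.
have lE : l = line O e.
  have [p [v [v0 lv]]] := hl; move: hlO lB; rewrite lv => -[t0 _ t0E] [t1 _ t1E].
  have ev : e = (t1 - t0) *: v by rewrite /e -t1E -t0E; vring.
  have t10 : t1 - t0 != 0 by apply: contra_neq e0 => t10; rewrite ev t10 scale0r.
  apply/seteqP; split=> [_ [t _ <-]|_ [t _ <-]].
    exists ((t - t0) / (t1 - t0)) => //; rewrite ev scalerA divfK// -t0E; vring.
  by exists (t0 + t * (t1 - t0)) => //; rewrite ev -t0E; vring.
(* For [t < 0], the point [O] would lie between [O + t *: e] and [B], hence in [C]. *)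
have outside (t : R) : t < 1 -> ~ C (O + t *: e).
  move=> t1; have [t0|t0] := leP 0 t.
    by apply: hOB; exists t => //=; rewrite in_itv /= t0.
  move=> Ct; apply: hO; have t10 : 0 < 1 - t by lra.
  have -> : O = O + t *: e + (- t / (1 - t)) *: (B - (O + t *: e)).
    by rewrite BE; apply/rowP => i; rewrite !mxE; field; rewrite gt_eqF.
  apply: body_convex => //; first by rewrite divr_ge0 ?oppr_ge0 ?ltW.
  by rewrite ler_pdivrMr//; lra.
have [z [lz iz]] := hlC.
have [zeta zE] : exists zeta : R, O + zeta *: e = z by move: lz; rewrite lE => -[zeta _ <-]; exists zeta.
rewrite -zE in iz; have Cz := interior_subset iz.
(* The interior point on l is not the boundary point [B], and no point before [B] belongs to [C]. *)
have zeta1 : 1 < zeta.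
  rewrite ltNge le_eqVlt; apply/negP => /orP[/eqP z1|/outside//].
  by case: bB => _; apply; move: iz; rewrite z1 scale1r -BE.
have /interior_enormP[rho rho0 ballz] := iz.
have onB : C (O + e) by rewrite -BE.
have [k [k0 curv]] := h_ii.
rewrite lE in h_i curv; rewrite BE in curv.
have a0 : 0 < (1 / 4 : R) by lra.
have b1 : 3 / 4 < (1 : R) by lra.
have [c0 c00 gapC] := gap hC outside onB zeta1 rho0 ballz h_i k0 curv a0 b1.
have zp : 0 < zeta by lra.
(* Half of [zeta - 1] makes [1 + eta < zeta] strict; the last bound lets the gap dominate the Taylor
   remainders. *)
pose eta := Num.min (1 / 10) (Num.min ((zeta - 1) / 2) (c0 * rho / (4 * zeta))).
have eta0 : 0 < eta by rewrite !lt_min !divr_gt0 ?mulr_gt0//; lra.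
have eta1 : eta <= 1 / 10 by rewrite ge_min lexx.
have etaz : 1 + eta < zeta.
  have : eta <= (zeta - 1) / 2 by rewrite !ge_min lexx /= orbT.
  lra.
have etac : 4 * eta * zeta <= c0 * rho.
  have : eta <= c0 * rho / (4 * zeta) by rewrite !ge_min lexx !orbT.
  by rewrite ler_pdivlMr ?mulr_gt0//; lra.
apply: (families_exist hC outside onB zeta1 rho0 ballz c00 _ eta0 eta1 etaz etac).
move=> X n t ta tb nX nt n' n'1; exact: (gapC X n t).
Qed.
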